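(* Let $A,N_1,\dots,N_q\in\mathbb R^{n\times n}$, $B\in\mathbb R^{n\times m}$, $C\in\mathbb R^{p\times n}$ be such that $(A,B,N_i)$ is stabilizable and $(A,C,N_i)$ is observable. Let $P>0$ satisfy $$A^\top P^{-1}+P^{-1}A+\sum_{i,j=1}^q N_i^\top P^{-1}N_jk_{ij}-C^\top C+P^{-1}BB^\top P^{-1}\le 0,$$ and let $Q>0$ be the stabilizing solution of $$A^\top Q+QA+\sum_{i,j=1}^q N_i^\top QN_jk_{ij}+C^\top C-QBB^\top Q=0.$$ Let $1\le r<n$, let $\sigma_1\ge\dots\ge\sigma_n>0$ be the square roots of the eigenvalues of $PQ$, let $\Sigma_r=\operatorname{diag}(\sigma_1,\dots,\sigma_r)$, and assume $\{\sigma_1,\dots,\sigma_r\}\cap\{\sigma_{r+1},\dots,\sigma_n\}=\emptyset$. Let $(A_r,B_r,C_r,N_{i,r})$ be the coefficients of the reduced system obtained by LQG balanced truncation. Then $(A_r-B_rB_r^\top\Sigma_r,\,N_{i,r})$ is stable.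
   Context: Probability setting: $(\Omega,\mathcal F,(\mathcal F_t)_{t\ge0},\mathbb P)$ is a filtered probability space with right-continuous complete filtration; $W=(W_1,\dots,W_q)^\top$ is an adapted $\mathbb R^q$-valued mean-zero Wiener process with covariance matrix $K=(k_{ij})$, i.e. $\mathbb E[W(t)W(t)^\top]=Kt$, whose increments $W(t+h)-W(t)$ are independent of $\mathcal F_t$. $L^2$ is the set of adapted processes $v$ with $\mathbb E\int_0^\infty\|v(s)\|_2^2ds<\infty$. Full system: $dx(t)=[Ax(t)+Bu(t)]dt+\sum_{i=1}^qN_ix(t)dW_i(t)$, $x(0)=x_0\in\mathbb R^n$, $y(t)=Cx(t)$. Its state and output are written $x(\cdot,x_0,u)$, $y(\cdot,x_0,u)$. Definitions (in any dimension): $(A,N_i)$ is stable (mean square asymptotically) if there are $M\ge1$, $c>0$ with $\mathbb E\|x(t,x_0,0)\|_2^2\le Me^{-ct}\|x_0\|_2^2$ for all $x_0$, $t\ge0$. $(A,B,N_i)$ is stabilizable if for every $x_0$ there is $u\in L^2$ with $x(\cdot,x_0,u)\in L^2$. $(A,C,N_i)$ is observable if $y(t,x_0,0)=0$ a.s. for all $t\ge0$ implies $x_0=0$. A solution $Q$ of the Riccati equation is stabilizing if $(A-BB^\top Q,N_i)$ is stable; under the assumptions of the claim a stabilizing solution exists and is positive definite. LQG balanced truncation: choose a nonsingular $S_b\in\mathbb R^{n\times n}$ with $S_bPS_b^\top=S_b^{-\top}QS_b^{-1}=\Sigma_n=\operatorname{diag}(\sigma_1,\dots,\sigma_n)$,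 and put $(A_n,N_{i,n},B_n,C_n)=(S_bAS_b^{-1},S_bN_iS_b^{-1},S_bB,CS_b^{-1})$. Then $A_r,N_{i,r}$ are the upper-left $r\times r$ blocks of $A_n,N_{i,n}$, $B_r$ consists of the first $r$ rows of $B_n$, and $C_r$ of the first $r$ columns of $C_n$. *)

(* Defs.v *)
From HB Require Import structures.
From mathcomp Require Import all_boot all_order all_algebra.
From mathcomp Require Import all_classical all_reals all_analysis.
Set Implicit Arguments.
Unset Strict Implicit.
Unset Printing Implicit Defensive.
Import Order.TTheory GRing.Theory Num.Theory.
Import numFieldNormedType.Exports.
Local Open Scope classical_set_scope.
Local Open Scope ring_scope.

(** * Stochastic basis and driving noise

    Time runs over [R]; only the values at times [t >= 0] are ever used. *)

Section Basis.
Context {d : measure_display} {Omega : measurableType d} {R : realType}.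
Variable Pr : probability Omega R.
Variable F : R -> set (set Omega).

(* The usual conditions.  The last clause says that every subset of a null set
   is an event of [F 0]; in particular the underlying space is complete. *)
Record usual_filtration : Prop := {
  filt_sigma : forall t : R, 0 <= t -> sigma_algebra [set: Omega] (F t);
  filt_measurable : forall t : R, 0 <= t -> F t `<=` measurable;
  filt_mono : forall s t : R, 0 <= s -> s <= t -> F s `<=` F t;
  filt_right_continuous : forall t : R, 0 <= t ->
    \bigcap_(s in [set s | t < s]) F s = F t;
  filt_complete : forall E, Pr.-negligible E -> F 0 E }.

(* Measurability of a real random variable with respect to a sub-sigma-algebra. *)
Definition measurable_wrt (G : set (set Omega)) (X : Omega -> R) : Prop :=
  preimage_set_system [set: Omega] X measurable `<=` G.

Definition adapted (k : nat) (v : R -> Omega -> 'cV[R]_k) : Prop :=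
  forall t : R, 0 <= t -> forall i, measurable_wrt (F t) (fun w => v t w i 0).

(* Centred Gaussian law of variance [v]; the library's [normal_prob] is not the
   Dirac mass when the deviation vanishes, whence the case distinction. *)
Definition centred_gaussian (v : R) (E : set R) : \bar R :=
  if v == 0 then \d_(0 : R) E else normal_prob 0 (Num.sqrt v) E.

(* [F]-Wiener process with covariance matrix [K], possibly singular: a random
   vector is [N(0, C)] when each of its projections on a vector [a] is
   [N(0, a^T C a)]. *)
Record wiener (q : nat) (K : 'M[R]_q) (W : R -> Omega -> 'cV[R]_q) : Prop := {
  wiener_adapted : adapted W;
  wiener_0 : {ae Pr, forall w, W 0 w = 0};
  wiener_continuous : {ae Pr, forall w, forall i,
    {within [set t : R | 0 <= t], continuous (fun t => W t w i 0)}};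
  wiener_mean : forall t : R, 0 <= t -> forall i,
    ('E_Pr[fun w => W t w i 0%R] = 0)%E;
  wiener_covariance : forall t : R, 0 <= t -> forall i j,
    ('E_Pr[fun w => (W t w i 0 * W t w j 0)%R] = (K i j * t)%:E)%E;
  wiener_gaussian : forall s t : R, 0 <= s -> s <= t ->
    forall (a : 'cV[R]_q) (E : set R), measurable E ->
    Pr [set w | E ((a^T *m (W t w - W s w)) 0 0)]
    = centred_gaussian ((t - s) * (a^T *m K *m a) 0 0) E;
  wiener_independent : forall s t : R, 0 <= s -> s <= t ->
    forall E H : set Omega, F s E ->
    g_sigma_preimage (fun (i : 'I_q) w => W t w i 0 - W s w i 0) H ->
    Pr (E `&` H) = (Pr E * Pr H)%E }.

(** * The Ito integral *)

(* The process [sum_k xi_k 1_(tau_k, tau_(k+1)]], for [k < sp_size]. *)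
Record simple_process := SimpleProcess {
  sp_size : nat;
  sp_time : nat -> R;
  sp_coef : nat -> Omega -> R }.

Definition sp_eval (phi : simple_process) (s : R) (w : Omega) : R :=
  \sum_(k < sp_size phi)
    sp_coef phi k w * \1_(`]sp_time phi k, sp_time phi k.+1]%classic) s.

Definition sp_integral (b : R -> Omega -> R) (phi : simple_process)
    (w : Omega) : R :=
  \sum_(k < sp_size phi)
    sp_coef phi k w * (b (sp_time phi k.+1) w - b (sp_time phi k) w).

Record simple_on (t : R) (phi : simple_process) : Prop := {
  simple_first : sp_time phi 0 = 0;
  simple_last : sp_time phi (sp_size phi) = t;
  simple_mono : forall k, (k < sp_size phi)%N ->
    sp_time phi k <= sp_time phi k.+1;
  simple_coef : forall k, (k < sp_size phi)%N ->
    measurable_wrt (F (sp_time phi k)) (sp_coef phi k);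
  simple_bounded : exists M : R, forall k w, (k < sp_size phi)%N ->
    `|sp_coef phi k w| <= M }.

(* [J] is (a version of) the integral of [f] against the scalar process [b]
   over [0, t]: the [L^2(Pr)]-limit of the elementary integrals of simple
   processes approximating [f] in [L^2(ds x Pr)]. *)
Definition is_ito (b : R -> Omega -> R) (t : R) (f : R -> Omega -> R)
    (J : Omega -> R) : Prop :=
  measurable_fun [set: Omega] J /\
  exists phi : nat -> simple_process,
    [/\ forall k, simple_on t (phi k),
        (fun k => \int[Pr]_w \int[lebesgue_measure]_(s in `[0%R, t])
           ((f s w - sp_eval (phi k) s w) ^+ 2)%:E)%E @ \oo --> 0%E
      & (fun k => \int[Pr]_w
           ((J w - sp_integral b (phi k) w) ^+ 2)%:E)%E @ \oo --> 0%E].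

(** * Linear stochastic systems *)

Definition sqnorm2 (k : nat) (v : 'cV[R]_k) : R := \sum_(i < k) v i 0 ^+ 2.

(* Joint measurability on [0, oo) x Omega. *)
Definition measurable_process (k : nat) (v : R -> Omega -> 'cV[R]_k) : Prop :=
  forall i, measurable_fun ([set t : R | 0 <= t] `*` [set: Omega])
    (fun p : measurableTypeR R * Omega => v p.1 p.2 i 0).

(* The space written [L^2]. *)
Definition L2_process (k : nat) (v : R -> Omega -> 'cV[R]_k) : Prop :=
  [/\ adapted v, measurable_process v &
      (\int[Pr]_w \int[lebesgue_measure]_(s in `[0%R, +oo[)
         (sqnorm2 (v s w))%:E < +oo)%E].

Section System.
Context {q : nat}.
Variable W : R -> Omega -> 'cV[R]_q.

(* [x] solves [dx = (A x + f) dt + sum_i N_i x dW_i], [x(0) = x0]; a controlled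
   system has [f = B u]. *)
Record is_state (n : nat) (A : 'M[R]_n) (N : 'I_q -> 'M[R]_n)
    (x0 : 'cV[R]_n) (f : R -> Omega -> 'cV[R]_n)
    (x : R -> Omega -> 'cV[R]_n) : Prop := {
  state_adapted : adapted x;
  state_measurable : measurable_process x;
  state_continuous : {ae Pr, forall w, forall i,
    {within [set t : R | 0 <= t], continuous (fun t => x t w i 0)}};
  state_L2_loc : forall T : R, 0 <= T ->
    (\int[Pr]_w \int[lebesgue_measure]_(s in `[0%R, T])
       (sqnorm2 (x s w))%:E < +oo)%E;
  state_integral : forall t : R, 0 <= t ->
    exists J : 'I_q -> Omega -> 'cV[R]_n,
      (forall i a, is_ito (fun s w => W s w i 0) t
         (fun s w => (N i *m x s w) a 0) (fun w => J i w a 0)) /\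
      {ae Pr, forall w, forall a,
         x t w a 0 = x0 a 0
           + \int[lebesgue_measure]_(s in `[0, t]) ((A *m x s w + f s w) a 0)
           + \sum_(i < q) J i w a 0} }.

(* For every [x0] and every [u] in [L^2] a solution exists and is unique up to
   indistinguishability, and all the properties used below are insensitive to
   the choice of a version.  "[x(., x0, 0)] satisfies [p]" is therefore
   rendered as: every process solving the equation satisfies [p]. *)
Definition free_state (n : nat) (A : 'M[R]_n) (N : 'I_q -> 'M[R]_n)
    (x0 : 'cV[R]_n) (p : (R -> Omega -> 'cV[R]_n) -> Prop) : Prop :=
  forall x, is_state A N x0 (fun _ _ => 0) x -> p x.

Definition stable (n : nat) (A : 'M[R]_n) (N : 'I_q -> 'M[R]_n) : Prop :=
  exists M c : R, [/\ 1 <= M, 0 < c &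
    forall x0, free_state A N x0 (fun x => forall t : R, 0 <= t ->
      ('E_Pr[fun w => sqnorm2 (x t w)]
         <= (M * expR (- c * t) * sqnorm2 x0)%:E)%E)].

Definition stabilizable (n m : nat) (A : 'M[R]_n) (B : 'M[R]_(n, m))
    (N : 'I_q -> 'M[R]_n) : Prop :=
  forall x0, exists u x, [/\ L2_process u,
    is_state A N x0 (fun t w => B *m u t w) x & L2_process x].

Definition observable (n p : nat) (A : 'M[R]_n) (C : 'M[R]_(p, n))
    (N : 'I_q -> 'M[R]_n) : Prop :=
  forall x0, free_state A N x0 (fun x => forall t : R, 0 <= t ->
    {ae Pr, forall w, C *m x t w = 0}) -> x0 = 0.

End System.
End Basis.

(** * Matrix inequalities and LQG balanced truncation *)

Section Balancing.
Context {R : realType}.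

Definition posdef (n : nat) (X : 'M[R]_n) : Prop :=
  X^T = X /\ forall v : 'cV[R]_n, v != 0 -> 0 < (v^T *m X *m v) 0 0.

Definition negsemidef (n : nat) (X : 'M[R]_n) : Prop :=
  X^T = X /\ forall v : 'cV[R]_n, (v^T *m X *m v) 0 0 <= 0.

Definition noise_term (q n : nat) (K : 'M[R]_q) (N : 'I_q -> 'M[R]_n)
    (X : 'M[R]_n) : 'M[R]_n :=
  \sum_(i < q) \sum_(j < q) K i j *: ((N i)^T *m X *m N j).

Definition lqg_filter_lmi (q n m p : nat) (K : 'M[R]_q) (A : 'M[R]_n)
    (B : 'M[R]_(n, m)) (C : 'M[R]_(p, n)) (N : 'I_q -> 'M[R]_n)
    (P : 'M[R]_n) : Prop :=
  negsemidef (A^T *m invmx P + invmx P *m A + noise_term K N (invmx P)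
    - C^T *m C + invmx P *m B *m B^T *m invmx P).

Definition lqg_control_riccati (q n m p : nat) (K : 'M[R]_q) (A : 'M[R]_n)
    (B : 'M[R]_(n, m)) (C : 'M[R]_(p, n)) (N : 'I_q -> 'M[R]_n)
    (Q : 'M[R]_n) : Prop :=
  A^T *m Q + Q *m A + noise_term K N Q + C^T *m C - Q *m B *m B^T *m Q = 0.

(* The numbers [sigma_0 >= ... >= sigma_(n-1) > 0] are the square roots of the
   eigenvalues of [X], listed with algebraic multiplicity. *)
Definition sqrt_spectrum (n : nat) (X : 'M[R]_n) (sigma : 'I_n -> R) : Prop :=
  [/\ forall i j : 'I_n, (i <= j)%N -> sigma j <= sigma i,
      forall i, 0 < sigma i
    & char_poly X = \prod_(i < n) ('X - (sigma i ^+ 2)%:P)].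

Definition balancing (n : nat) (P Q : 'M[R]_n) (sigma : 'I_n -> R)
    (S : 'M[R]_n) : Prop :=
  [/\ S \in unitmx,
      S *m P *m S^T = diag_mx (\row_i sigma i)
    & invmx (S^T) *m Q *m invmx S = diag_mx (\row_i sigma i)].

Section Truncation.
Variables (n r : nat) (hrn : (r <= n)%N) (S : 'M[R]_n).

Definition trunc_state (A : 'M[R]_n) : 'M[R]_r :=
  mxsub (widen_ord hrn) (widen_ord hrn) (S *m A *m invmx S).

Definition trunc_input (m : nat) (B : 'M[R]_(n, m)) : 'M[R]_(r, m) :=
  rowsub (widen_ord hrn) (S *m B).

Definition trunc_output (p : nat) (C : 'M[R]_(p, n)) : 'M[R]_(p, r) :=
  colsub (widen_ord hrn) (C *m invmx S).

Definition trunc_sigma (sigma : 'I_n -> R) : 'M[R]_r :=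
  diag_mx (\row_i sigma (widen_ord hrn i)).

End Truncation.
End Balancing.

(* Main.v *)
(** The second moments [P = E x x^T] of a linear stochastic system solve
    [P' = L P], with [L V = a V + V a^T + sum_ij k_ij N_i V N_j^T], by the Ito
    isometry.

    In balanced coordinates the Riccati equation and the Lyapunov-type
    inequality become conditions on [Sigma] and [Sigma^-1].  Compressing the
    first one to the leading block gives [tr (Sigma_r L_r V) <= 0] for every
    positive semidefinite [V], where [L_r] belongs to the reduced closed loop.
    If moreover [L_r V = 0], all inequalities are equalities; then [C U = 0] for
    the extension [U] of [V] by zero, and the coefficients
    of the full system commute with [Sigma^-2] on the range of [U].  As the two
    blocks of [Sigma] have no common eigenvalue, these coefficients map that
    range into the leading coordinates.  So [U] is stationary for the free full
    system and invisible in its output, hence [U = 0] by observability.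

    Without a positive semidefinite kernel, [L_r] is coercive on the positive
    semidefinite cone; a time average of the moments over a long window is
    almost in this kernel, therefore small, and it dominates the monotone
    quantity [tr (Sigma_r P)] at the end of the window.  This yields exponential
    decay. *)
Require Import Defs.
From HB Require Import structures.
From mathcomp Require Import all_boot all_order all_algebra.
From mathcomp Require Import all_classical all_reals all_analysis.
From mathcomp Require Import measurable_realfun ring lra.
Set Implicit Arguments.
Unset Strict Implicit.
Unset Printing Implicit Defensive.
Import Order.TTheory GRing.Theory Num.Theory.
Import numFieldNormedType.Exports.
Local Open Scope classical_set_scope.
Local Open Scope ring_scope.

(** * Positive semidefinite matrices *)

(** The double sum weighted by [K] has no visible sign. As [K] is a covariance matrix it factors as
    [M^T M], and mixing the [N_i] with the rows of [M] turns that sum into a sum of terms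
    [N_l V N_l^T]; the positivity arguments are run in this form.

    The delicate point is the commutation with [X = Sigma^-2]. The identities found at a stationary
    [U] also show that [X U X] is stationary, so commutation passes to all powers of [X] and then to
    polynomials; one polynomial separates the two blocks of eigenvalues.

    No spectral theory of the generator is invoked: coercivity comes from compactness of the
    trace-one slice of the cone, and the flow estimates use the integral form of the moment
    equation, so nothing is differentiated in time. That equation is itself obtained by expanding
    the product of two coordinates, each split into initial value, drift and martingale part,
    instead of by an Ito formula. Stability and observability both quantify over all solutions, so
    identities for a given solution suffice. *)

Lemma addmxE (R : nmodType) m n (A B : 'M[R]_(m, n)) i j :
  (A + B) i j = A i j + B i j.
Proof. exact: mxE. Qed.

Lemma scalemxE (R : pzRingType) m n a (A : 'M[R]_(m, n)) i j :
  (a *: A) i j = a * A i j.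
Proof. exact: mxE. Qed.

Lemma oppmxE (R : zmodType) m n (A : 'M[R]_(m, n)) i j : (- A) i j = - A i j.
Proof. exact: mxE. Qed.

Section Psd.
Variable R : rcfType.
Implicit Types n m : nat.

(** Symmetry is required separately because a real quadratic form does not see the antisymmetric
    part. *)
Definition psd n (X : 'M[R]_n) :=
  X^T = X /\ forall v : 'cV[R]_n, 0 <= (v^T *m X *m v) 0 0.

Lemma psd_congr n m (X : 'M[R]_n) (M : 'M[R]_(n, m)) :
  psd X -> psd (M^T *m X *m M).
Proof.
move=> [sX pX]; split; first by rewrite !trmx_mul trmxK sX mulmxA.
by move=> v; have := pX (M *m v); rewrite trmx_mul !mulmxA.
Qed.

(* Cholesky factorization: eliminate the first row and column, which vanish
   when the corner entry does. *)
Lemma psd_factor n (X : 'M[R]_n) : psd X -> exists M : 'M[R]_n, X = M^T *m M.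
Proof.
elim: n X => [|n IH] X.
  by exists 0; apply/matrixP => -[].
rewrite -[n.+1]add1n in X *; move=> [sX pX].
set a := X 0 0; pose u : 'rV[R]_n := ursubmx X; pose Y : 'M[R]_n := drsubmx X.
have Xul : ulsubmx X = a%:M.
  by rewrite [LHS]mx11_scalar; congr (_%:M); rewrite !mxE /a; congr (X _ _); apply/val_inj.
have Xdl : dlsubmx X = u^T by rewrite /u trmx_ursub sX.
have XE : X = block_mx a%:M u u^T Y by rewrite -Xul -Xdl submxK.
have sY : Y^T = Y by rewrite /Y trmx_drsub sX.
have quad (c : R) (v : 'cV[R]_n) :
    0 <= a * c ^+ 2 + 2 * c * (u *m v) 0 0 + (v^T *m Y *m v) 0 0.
  have := pX (col_mx c%:M v); rewrite XE tr_col_mx mul_row_block mul_row_col.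
  rewrite tr_scalar_mx !mulmxDl !mul_scalar_mx !mul_mx_scalar -!scalemxAl.
  have E : (v^T *m u^T) 0 0 = (u *m v) 0 0 by rewrite -trmx_mul mxE.
  rewrite !addmxE !scalemxE E [_%:M _ _]mxE eqxx mulr1n.
  by move=> h; apply: le_trans h _; rewrite le_eqVlt; apply/orP; left; apply/eqP; ring.
have a0 : 0 <= a.
  by have := quad 1 0; rewrite !mulmx0 mxE; nra.
have [a_eq0|a_neq0] := eqVneq a 0.
  have u0 : u = 0.
    apply/matrixP => i j; rewrite ord1 [RHS]mxE.
    apply/eqP; apply/negP => /negP uj.
    pose e : 'cV[R]_n := delta_mx j 0; pose y := (e^T *m Y *m e) 0 0.
    (* With corner entry 0 the form is affine in [c]; this [c] gives it the value -1. *)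
    have := quad (- ((y + 1) / (2 * u 0 j))) e.
    have -> : (u *m e) 0 0 = u 0 j by rewrite -colE mxE.
    rewrite -/y a_eq0 mul0r add0r.
    have -> : 2 * - ((y + 1) / (2 * u 0 j)) * u 0 j = - (y + 1) by field.
    by lra.
  have [|M YE] := IH Y.
    by split=> // v; have := quad 0 v; rewrite !(mulr0, mul0r, expr0n)/= !add0r.
  exists (block_mx 0 0 0 M); rewrite XE a_eq0 u0 tr_block_mx mulmx_block.
  by rewrite !(trmx0, mulmx0, mul0mx, add0r, addr0) -YE raddf0.
have apos : 0 < a by rewrite lt0r a_neq0.
pose s := Num.sqrt a.
have s2 : s * s = a by rewrite -expr2 sqr_sqrtr.
have s0 : s != 0 by apply: contraNneq a_neq0 => s0; rewrite -s2 s0 mulr0.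
have [|M YE] := IH (Y - a^-1 *: (u^T *m u)).
  split; first by rewrite linearB linearZ/= trmx_mul trmxK sY.
  (* The minimizer in [c]: the minimum is the Schur complement evaluated at [v]. *)
  move=> v; have := quad (- ((u *m v) 0 0 / a)) v.
  rewrite mulmxBr mulmxBl -scalemxAr -scalemxAl addmxE oppmxE scalemxE.
  have -> : (v^T *m (u^T *m u) *m v) 0 0 = (u *m v) 0 0 ^+ 2.
    rewrite mulmxA -trmx_mul -mulmxA [LHS]mxE big_ord1 [_^T _ _]mxE -expr2 //.
  move=> h; apply: le_trans h _; rewrite le_eqVlt; apply/orP; left; apply/eqP.
  by field.
exists (block_mx s%:M (s^-1 *: u) 0 M).
rewrite XE tr_block_mx mulmx_block !(trmx0, mulmx0, mul0mx, add0r, addr0).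
rewrite tr_scalar_mx -scalar_mxM s2 mul_scalar_mx scalerA divff// scale1r.
rewrite mul_mx_scalar linearZ/= scalerA divff// scale1r -scalemxAl -scalemxAr scalerA.
by rewrite -invfM s2 -YE addrC subrK.
Qed.

End Psd.

(** * Trace pairing of positive semidefinite matrices *)

Section PsdTrace.
Variable R : rcfType.

Lemma tr_gram_ge0 m n (Z : 'M[R]_(m, n)) : 0 <= \tr (Z^T *m Z).
Proof.
apply: sumr_ge0 => i _; rewrite mxE; apply: sumr_ge0 => j _.
by rewrite mxE -expr2 sqr_ge0.
Qed.

Lemma tr_gram_eq0 m n (Z : 'M[R]_(m, n)) : \tr (Z^T *m Z) = 0 -> Z = 0.
Proof.
move=> /eqP; rewrite psumr_eq0; last first.
  by move=> i _; rewrite mxE sumr_ge0// => j _; rewrite mxE -expr2 sqr_ge0.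
move=> /allP h; apply/matrixP => i j; rewrite mxE.
have := h j (mem_index_enum _); rewrite mxE psumr_eq0; last first.
  by move=> k _; rewrite mxE -expr2 sqr_ge0.
move=> /allP/(_ i (mem_index_enum _)); rewrite mxE -expr2.
by rewrite sqrf_eq0 => /eqP.
Qed.

Lemma tr_gram_gram m n k (G : 'M[R]_(k, n)) (W : 'M[R]_(m, n)) :
  \tr (G^T *m G *m (W^T *m W)) = \tr ((W *m G^T)^T *m (W *m G^T)).
Proof.
by rewrite trmx_mul trmxK -[G^T *m G *m _]mulmxA mxtrace_mulC !mulmxA.
Qed.

Lemma psd_tr_gram_ge0 m n (U : 'M[R]_n) (W : 'M[R]_(m, n)) :
  psd U -> 0 <= \tr (U *m (W^T *m W)).
Proof. by move=> /psd_factor[G ->]; rewrite tr_gram_gram tr_gram_ge0. Qed.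

(** With [U = G^T G] the trace is the squared Frobenius norm of [W G^T], so [W G^T = 0] and a
    fortiori [W G^T G = 0]. This turns equality between traces into matrix identities on the range
    of [U]. *)
Lemma psd_tr_gram_eq0 m n (U : 'M[R]_n) (W : 'M[R]_(m, n)) :
  psd U -> \tr (U *m (W^T *m W)) = 0 -> W *m U = 0.
Proof.
move=> /psd_factor[G ->]; rewrite tr_gram_gram => /tr_gram_eq0 h.
by rewrite mulmxA h mul0mx.
Qed.

Lemma psd_tr_ge0 n (U Y : 'M[R]_n) : psd U -> psd Y -> 0 <= \tr (U *m Y).
Proof. by move=> pU /psd_factor[W ->]; apply: psd_tr_gram_ge0. Qed.

Lemma psd_tr_eq0 n (U Y : 'M[R]_n) :
  psd U -> psd Y -> \tr (U *m Y) = 0 -> Y *m U = 0.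
Proof.
move=> pU /psd_factor[W ->] /(psd_tr_gram_eq0 pU) h.
by rewrite -mulmxA h mulmx0.
Qed.

End PsdTrace.

(** * Stationary covariances in balanced coordinates *)

Section Stationary.
Variables (R : rcfType) (n m c k : nat).
Variables (A : 'M[R]_n) (B : 'M[R]_(n, m)) (C : 'M[R]_(c, n)).
Variable N : 'I_k -> 'M[R]_n.
Variables D Di p : 'M[R]_n.
Hypotheses (psdD : psd D) (DDi : D *m Di = 1%:M) (psdDi : psd Di).
Hypotheses (pT : p^T = p) (pp : p *m p = p) (pD : p *m D = D *m p).
Hypothesis riccati :
  A^T *m D + D *m A + \sum_l (N l)^T *m D *m N l + C^T *m C
    - D *m B *m B^T *m D = 0.
Let lmi := A^T *m Di + Di *m A + \sum_l (N l)^T *m Di *m N l - C^T *m C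
    + Di *m B *m B^T *m Di.
Hypothesis filter_lmi : psd (- lmi).

Variables K q X : 'M[R]_n.
Hypotheses (KE : K = A - B *m B^T *m D) (pq : p + q = 1%:M) (XE : X = Di *m Di).

(** Covariances in the kernel of the reduced closed-loop generator, seen in the full space: [p]
    projects onto the retained coordinates, [K] is the closed-loop matrix and not the noise
    covariance, and the [N l] act as coefficients of independent standard noises. *)
Definition stationary (U : 'M[R]_n) :=
  [/\ psd U, p *m U = U &
      p *m K *m U + U *m K^T *m p + \sum_l p *m N l *m U *m (N l)^T *m p = 0].

Let DT : D^T = D. Proof. by case: psdD. Qed.
Let DiT : Di^T = Di. Proof. by case: psdDi. Qed.
Let DiD : Di *m D = 1%:M. Proof. exact: mulmx1C. Qed.
Let DX : D *m X = Di. Proof. by rewrite XE mulmxA DDi mul1mx. Qed.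
Let XD : X *m D = Di. Proof. by rewrite XE -mulmxA DiD mulmx1. Qed.
Let pDi : p *m Di = Di *m p.
Proof. by rewrite -[LHS]mul1mx -DiD -!mulmxA [D *m _]mulmxA -pD -mulmxA DDi mulmx1. Qed.
Let pX : p *m X = X *m p.
Proof. by rewrite XE mulmxA pDi -!mulmxA pDi. Qed.
Let qE : q = 1%:M - p. Proof. by rewrite -pq addrC addKr. Qed.
Let qT : q^T = q. Proof. by rewrite qE linearB/= trmx1 pT. Qed.

Section Consequences.
Variable U : 'M[R]_n.
Hypothesis statU : stationary U.
Let psdU : psd U. Proof. by case: statU. Qed.
Let pU : p *m U = U. Proof. by case: statU. Qed.
Let UT : U^T = U. Proof. by case: psdU. Qed.
Let Up : U *m p = U. Proof. by rewrite -[LHS]trmxK trmx_mul UT pT pU UT. Qed.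

Let ell : p *m K *m U + U *m K^T *m p + \sum_l p *m N l *m U *m (N l)^T *m p = 0.
Proof. by case: statU. Qed.

Let DE : D = p *m D *m p + q *m D *m q.
Proof.
have pDq : p *m D *m q = 0 by rewrite pD -mulmxA qE mulmxBr mulmx1 pp subrr mulmx0.
have qDp : q *m D *m p = 0 by rewrite -mulmxA -pD mulmxA qE mulmxBl mul1mx pp subrr mul0mx.
rewrite -[LHS]mul1mx -[LHS]mulmx1 -pq !mulmxDl !mulmxDr pDq qDp addr0 add0r //.
Qed.

(** Passing from [A] to [K] subtracts [D B B^T D] twice, which reverses the sign of the quadratic
    term: output and control now both enter as nonnegative costs. *)
Lemma closed_loop_riccati :
  K^T *m D + D *m K + \sum_l (N l)^T *m D *m N l + C^T *m C
    + D *m B *m B^T *m D = 0.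
Proof.
rewrite -[RHS]riccati KE linearB/= !trmx_mul trmxK DT mulmxBl mulmxBr !mulmxA.
by apply/matrixP => i j; rewrite !addmxE !oppmxE; ring.
Qed.

(** Stationarity paired with [Y], written in adjoint form against [U]. The projections next to [K]
    are absorbed by [U]; those around the noise are not, so [Y] appears there as [p Y p]. *)
Let tr_ell (Y : 'M[R]_n) : p *m Y = Y *m p ->
  \tr (U *m (Y *m K)) + \tr (U *m (K^T *m Y)) +
  \sum_l \tr (U *m ((N l)^T *m (p *m Y *m p) *m N l)) = 0.
Proof.
move=> pY; rewrite -[RHS](mxtrace0 R n) -[in RHS](mulmx0 _ Y) -[in RHS]ell.
rewrite !mulmxDr !mxtraceD; congr (_ + _ + _).
- have -> : Y *m (p *m K *m U) = p *m (Y *m K *m U) by rewrite !mulmxA pY.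
  by rewrite [RHS]mxtrace_mulC -!mulmxA Up [LHS]mxtrace_mulC -!mulmxA.
- have -> : Y *m (U *m K^T *m p) = (Y *m (U *m K^T)) *m p by rewrite !mulmxA.
  rewrite [RHS]mxtrace_mulC [p *m (Y *m _)]mulmxA pY.
  by rewrite -!mulmxA [p *m (U *m _)]mulmxA pU [RHS]mxtrace_mulC -!mulmxA.
- rewrite mulmx_sumr [RHS]raddf_sum; apply: eq_bigr => l _ /=.
  have -> : Y *m (p *m N l *m U *m (N l)^T *m p)
      = (Y *m p *m N l *m U *m (N l)^T) *m p by rewrite !mulmxA.
  rewrite [RHS]mxtrace_mulC [LHS]mxtrace_mulC -!mulmxA [LHS]mxtrace_mulC.
  by rewrite !mulmxA.
Qed.

Let psd_compress (Y Z : 'M[R]_n) : psd Y -> Z^T = Z -> psd (Z *m Y *m Z).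
Proof. by move=> pY ZT; rewrite -{1}ZT; apply: psd_congr. Qed.

(** Compare the stationarity of [U] with its pairing against the closed-loop Riccati equation. What
    remains is the cost of the output, of the control and of the noise leaving the leading block
    (the [q D q] part): three nonnegative terms with sum zero. *)
Lemma stationary_output :
  [/\ C *m U = 0, B^T *m D *m U = 0 & forall l, q *m N l *m U = 0].
Proof.
have := tr_ell pD.
have : \tr (U *m (K^T *m D + D *m K + \sum_l (N l)^T *m D *m N l + C^T *m C
    + D *m B *m B^T *m D)) = 0 by rewrite closed_loop_riccati mulmx0 mxtrace0.
rewrite !mulmxDr !mxtraceD mulmx_sumr raddf_sum /=.
have -> : \sum_l \tr (U *m ((N l)^T *m D *m N l)) =
    \sum_l \tr (U *m ((N l)^T *m (p *m D *m p) *m N l)) +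
    \sum_l \tr (U *m ((N l)^T *m (q *m D *m q) *m N l)).
  rewrite -big_split; apply: eq_bigr => l _ /=.
  by rewrite {1}DE mulmxDr mulmxDl mulmxDr mxtraceD.
have psdqN l : psd ((N l)^T *m (q *m D *m q) *m N l).
  exact/psd_congr/psd_compress.
have g1 l : 0 <= \tr (U *m ((N l)^T *m (q *m D *m q) *m N l)).
  exact: psd_tr_ge0.
have g2 : 0 <= \sum_l \tr (U *m ((N l)^T *m (q *m D *m q) *m N l)).
  by apply: sumr_ge0.
have g3 : 0 <= \tr (U *m (C^T *m C)) by apply: psd_tr_gram_ge0.
have DBE : D *m B *m B^T *m D = (B^T *m D)^T *m (B^T *m D).
  by rewrite trmx_mul trmxK DT !mulmxA.
have g4 : 0 <= \tr (U *m (D *m B *m B^T *m D)).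
  by rewrite DBE; apply: psd_tr_gram_ge0.
move=> h1 h2; have z3 : \tr (U *m (C^T *m C)) = 0 by lra.
have z4 : \tr (U *m (D *m B *m B^T *m D)) = 0 by lra.
have z2 : \sum_l \tr (U *m ((N l)^T *m (q *m D *m q) *m N l)) = 0 by lra.
split; first exact: psd_tr_gram_eq0.
  by apply: psd_tr_gram_eq0 => //; rewrite -DBE.
move=> l; have := z2 => /eqP; rewrite psumr_eq0// => /allP/(_ l (mem_index_enum _)).
move=> /eqP; have [H HE] := psd_factor psdD.
have -> : (N l)^T *m (q *m D *m q) *m N l = (H *m q *m N l)^T *m (H *m q *m N l).
  by rewrite !trmx_mul qT HE !mulmxA.
move=> /(psd_tr_gram_eq0 psdU) h.
have : Di *m (H^T *m (H *m q *m N l *m U)) = 0 by rewrite h !mulmx0.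
by rewrite !mulmxA -[Di *m H^T *m H]mulmxA -HE DiD mul1mx.
Qed.

Let CU : C *m U = 0. Proof. by have [] := stationary_output. Qed.
Let BDU : B^T *m D *m U = 0. Proof. by have [] := stationary_output. Qed.
Let qNU l : q *m N l *m U = 0. Proof. by have [] := stationary_output. Qed.
Let pNU l : p *m N l *m U = N l *m U.
Proof. by rewrite -[RHS]mul1mx -pq mulmxDl !mulmxA qNU addr0. Qed.
Let UNp l : U *m (N l)^T *m p = U *m (N l)^T.
Proof. by have := congr1 trmx (pNU l); rewrite !trmx_mul UT pT !mulmxA. Qed.
Let KU : K *m U = A *m U.
Proof.
rewrite KE mulmxBl; have -> : B *m B^T *m D *m U = B *m (B^T *m D *m U).
  by rewrite !mulmxA.
by rewrite BDU mulmx0 subr0.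
Qed.
Let UK : U *m K^T = U *m A^T.
Proof. by have := congr1 trmx KU; rewrite !trmx_mul UT. Qed.

Let stat_ell : p *m A *m U + U *m A^T *m p + \sum_l N l *m U *m (N l)^T = 0.
Proof.
rewrite -[RHS]ell -!mulmxA KU [U *m (K^T *m _)]mulmxA UK !mulmxA; congr (_ + _).
by apply: eq_bigr => l _; rewrite pNU -!mulmxA [U *m (_ *m p)]mulmxA UNp.
Qed.

(** On the range of [U] the closed loop acts like [A] and the noise stays in the leading block, so
    the pairing with [Di] involves the full coefficients. Together with [C U = 0] it says that
    [tr (U lmi)] equals [tr (U Di B B^T Di) >= 0], whereas [lmi <= 0]: both traces are zero. *)
Lemma stationary_filter : lmi *m U = 0 /\ B^T *m Di *m U = 0.
Proof.
have := tr_ell pDi.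
have -> : \tr (U *m (Di *m K)) = \tr (U *m (Di *m A)).
  by rewrite [LHS]mxtrace_mulC [RHS]mxtrace_mulC -!mulmxA KU.
rewrite [U *m (K^T *m _)]mulmxA UK -[U *m A^T *m _]mulmxA.
under eq_bigr => l _.
  have -> : \tr (U *m ((N l)^T *m (p *m Di *m p) *m N l)) =
            \tr (U *m ((N l)^T *m Di *m N l)).
    rewrite !mulmxA UNp -[U *m _ *m Di *m p *m _]mulmxA.
    rewrite [LHS]mxtrace_mulC [RHS]mxtrace_mulC !mulmxA pNU //.
  over.
have DBE : Di *m B *m B^T *m Di = (B^T *m Di)^T *m (B^T *m Di).
  by rewrite trmx_mul trmxK DiT !mulmxA.
have g1 : 0 <= \tr (U *m (Di *m B *m B^T *m Di)).
  by rewrite DBE; apply: psd_tr_gram_ge0.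
have := psd_tr_ge0 psdU filter_lmi; have UC : U *m (C^T *m C) = 0.
  by rewrite mulmxA -[U *m C^T]trmxK trmx_mul trmxK UT CU trmx0 mul0mx.
have trl : \tr (U *m - lmi) = - (\tr (U *m (A^T *m Di)) + \tr (U *m (Di *m A)) +
    \sum_l \tr (U *m ((N l)^T *m Di *m N l)) + \tr (U *m (Di *m B *m B^T *m Di))).
  rewrite mulmxN linearN /= /lmi; congr (- _).
  by rewrite !mulmxDr mulmxN UC subr0 !mxtraceD mulmx_sumr raddf_sum.
move=> h1 h2; have z1 : \tr (U *m - lmi) = 0 by lra.
have z2 : \tr (U *m (Di *m B *m B^T *m Di)) = 0 by lra.
split.
  by have := psd_tr_eq0 psdU filter_lmi z1; rewrite mulNmx => /eqP; rewrite oppr_eq0 => /eqP.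
by apply: psd_tr_gram_eq0 => //; rewrite -DBE.
Qed.

Let BDiU : B^T *m Di *m U = 0. Proof. by case: stationary_filter. Qed.
Let filter_eq :
  A^T *m Di *m U + Di *m A *m U + (\sum_l (N l)^T *m Di *m N l) *m U = 0.
Proof.
have [e _] := stationary_filter; rewrite -[RHS]e /lmi !mulmxDl mulNmx.
have -> : C^T *m C *m U = 0 by rewrite -mulmxA CU mulmx0.
have -> : Di *m B *m B^T *m Di *m U = Di *m B *m (B^T *m Di *m U) by rewrite !mulmxA.
by rewrite BDiU mulmx0 subr0 addr0.
Qed.
Let KXU : K *m X *m U = A *m X *m U.
Proof.
rewrite KE !mulmxBl.
have -> : B *m B^T *m D *m X *m U = B *m (B^T *m (D *m X) *m U) by rewrite !mulmxA.
by rewrite DX BDiU mulmx0 subr0.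
Qed.
Let XT : X^T = X. Proof. by rewrite XE trmx_mul DiT. Qed.
Let XDi : X *m Di = Di *m X. Proof. by rewrite XE mulmxA. Qed.
Let UXK : U *m X *m K^T = U *m X *m A^T.
Proof. by have := congr1 trmx KXU; rewrite !trmx_mul UT XT !mulmxA. Qed.
Let psdXUX : psd (X *m U *m X). Proof. exact: psd_compress. Qed.

(* The dissipation [sum_l Z_l^T D Z_l], [Z_l := p N_l X - X N_l], of the dual
   generator at [X] integrates against [U] to minus the integral of the running
   cost against [X U X]: both vanish. *)
Let Z l := p *m N l *m X - X *m N l.

(** Expanding the square leaves two mixed traces; [D X = X D = Di] and [p N U = N U] identify them,
    hence the factor 2. *)
Let dissipation l : \tr (U *m ((Z l)^T *m D *m Z l)) =
  \tr (X *m U *m X *m ((N l)^T *m (p *m D *m p) *m N l))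
  - 2 * \tr (U *m X *m ((N l)^T *m Di *m N l))
  + \tr (U *m (N l)^T *m (Di *m X) *m N l).
Proof.
have trB (Y1 Y2 : 'M[R]_n) : \tr (Y1 - Y2) = \tr Y1 - \tr Y2 by exact: raddfB.
rewrite /Z [(_ - _)^T]linearB/= !trmx_mul pT XT !(mulmxBl, mulmxBr) !mulmxA !trB.
have -> : \tr (U *m X *m (N l)^T *m p *m D *m p *m N l *m X) =
    \tr (X *m U *m X *m (N l)^T *m p *m D *m p *m N l).
  by rewrite mxtrace_mulC !mulmxA.
have -> : \tr (U *m X *m (N l)^T *m p *m D *m X *m N l) =
    \tr (U *m X *m (N l)^T *m Di *m N l).
  rewrite -[_ *m D *m X]mulmxA DX -[_ *m p *m Di]mulmxA pDi mulmxA.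
  have e (Y : 'M[R]_n) : \tr (U *m Y) = \tr (Y *m U) by exact: mxtrace_mulC.
  by rewrite -!mulmxA !e -!mulmxA [p *m (_ *m _)]mulmxA pNU.
have -> : \tr (U *m (N l)^T *m X *m D *m p *m N l *m X) =
    \tr (U *m X *m (N l)^T *m Di *m N l).
  rewrite -[_ *m X *m D]mulmxA XD -[_ *m Di *m p]mulmxA -pDi [_ *m (p *m Di)]mulmxA UNp.
  rewrite -[LHS]mxtrace_tr !trmx_mul UT XT DiT trmxK !mulmxA.
  by rewrite [LHS]mxtrace_mulC !mulmxA.
rewrite -[_ *m X *m D]mulmxA XD -[_ *m Di *m X]mulmxA.
ring.
Qed.

Let trC (Y1 Y2 : 'M[R]_n) : \tr (Y1 *m Y2) = \tr (Y2 *m Y1).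
Proof. exact: mxtrace_mulC. Qed.

(** Three equations enter: the closed-loop Riccati equation paired with [X U X], the filter equality
    multiplied by [X], and stationarity paired with [Di X = D^-3]. With the weights 1, -2, 1 of
    [dissipation] the drift traces [ta] and [tb] cancel. *)
Let sum_dissipation : \sum_l \tr (U *m ((Z l)^T *m D *m Z l)) =
  - (\tr (X *m U *m X *m (C^T *m C)) + \tr (X *m U *m X *m (D *m B *m B^T *m D))
     + \sum_l \tr (X *m U *m X *m ((N l)^T *m (q *m D *m q) *m N l))).
Proof.
under eq_bigr do rewrite dissipation.
rewrite big_split/= sumrB -mulr_sumr.
set s1 := \sum_l _; set s2 := \sum_l _; set s3 := \sum_l _; set s4 := \sum_l _.
pose ta := \tr (A^T *m Di *m U *m X); pose tb := \tr (Di *m A *m U *m X).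
have e1 : s1 + s4 = - (ta + ta + \tr (X *m U *m X *m (C^T *m C)) +
     \tr (X *m U *m X *m (D *m B *m B^T *m D))).
  have := congr1 (fun Y => \tr (X *m U *m X *m Y)) closed_loop_riccati.
  rewrite mulmx0 mxtrace0 !mulmxDr !mxtraceD mulmx_sumr raddf_sum/=.
  have -> : \sum_l \tr (X *m U *m X *m ((N l)^T *m D *m N l)) = s1 + s4.
    rewrite -big_split; apply: eq_bigr => l _ /=.
    by rewrite {1}DE mulmxDr mulmxDl mulmxDr mxtraceD.
  have -> : \tr (X *m U *m X *m (K^T *m D)) = ta.
    have -> : X *m U *m X *m (K^T *m D) = X *m (U *m X *m K^T) *m D by rewrite !mulmxA.
    by rewrite UXK trC !mulmxA DX trC !mulmxA.
  have -> : \tr (X *m U *m X *m (D *m K)) = ta.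
    rewrite trC; have -> : D *m K *m (X *m U *m X) = D *m (K *m X *m U) *m X by rewrite !mulmxA.
    rewrite KXU trC !mulmxA XD -[LHS]mxtrace_tr !trmx_mul UT XT DiT.
    by rewrite [LHS]trC -!mulmxA [LHS]trC !mulmxA.
  lra.
have e2 : ta + tb + s2 = 0.
  have := congr1 (fun Y => \tr (Y *m X)) filter_eq.
  rewrite mul0mx mxtrace0 !mulmxDl !mxtraceD => <-; congr (_ + _).
  rewrite -mulmxA mulmx_suml raddf_sum; apply: eq_bigr => l _ /=.
  exact: trC.
have e3 : s3 = - (tb + tb).
  have := congr1 (fun Y => \tr (Di *m X *m Y)) stat_ell.
  rewrite mulmx0 mxtrace0 !mulmxDr !mxtraceD mulmx_sumr raddf_sum/=.
  have -> : \sum_l \tr (Di *m X *m (N l *m U *m (N l)^T)) = s3.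
    apply: eq_bigr => l _.
    have -> : Di *m X *m (N l *m U *m (N l)^T) = (Di *m X *m N l) *m (U *m (N l)^T).
      by rewrite !mulmxA.
    by rewrite trC !mulmxA.
  have -> : \tr (Di *m X *m (p *m A *m U)) = tb.
    have -> : Di *m X *m (p *m A *m U) = p *m (X *m Di *m A *m U).
      by rewrite !mulmxA pX -[X *m p *m Di]mulmxA pDi !mulmxA XDi.
    by rewrite trC -!mulmxA Up trC !mulmxA.
  have -> : \tr (Di *m X *m (U *m A^T *m p)) = tb.
    have -> : Di *m X *m (U *m A^T *m p) = (X *m Di *m U *m A^T) *m p.
      by rewrite XDi !mulmxA.
    rewrite trC; have -> : p *m (X *m Di *m U *m A^T) = X *m Di *m (p *m U) *m A^T.
      by rewrite !mulmxA pX -[X *m p *m Di]mulmxA pDi !mulmxA.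
    rewrite pU -[RHS]mxtrace_tr !trmx_mul UT XT DiT -!mulmxA [RHS]trC.
    by rewrite -!mulmxA [X *m (Di *m _)]mulmxA XDi [U *m (A^T *m _)]mulmxA [RHS]trC.
  lra.
lra.
Qed.

(** A sum of nonnegative traces equals minus a sum of nonnegative traces, so all vanish:
    [C X U = 0], [q N X U = 0] and [Z U = 0], whence [N X U = X N U]. The closed-loop Riccati
    equation times [X U] and the filter equality then differ only in the terms [D A X U] and
    [Di A U], which gives the commutation for [A]. *)
Lemma stationary_commute : [/\ A *m X *m U = X *m A *m U,
  stationary (X *m U *m X), C *m U = 0, (forall l, p *m N l *m U = N l *m U)
  & p *m A *m U + U *m A^T *m p + \sum_l N l *m U *m (N l)^T = 0].
Proof.
have psdqN l : psd ((N l)^T *m (q *m D *m q) *m N l).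
  exact/psd_congr/psd_compress.
have DBE : D *m B *m B^T *m D = (B^T *m D)^T *m (B^T *m D).
  by rewrite trmx_mul trmxK DT !mulmxA.
have psdZ l : psd ((Z l)^T *m D *m Z l) by exact: psd_congr.
have g0 l : 0 <= \tr (U *m ((Z l)^T *m D *m Z l)) by apply: psd_tr_ge0.
have g1 l : 0 <= \tr (X *m U *m X *m ((N l)^T *m (q *m D *m q) *m N l)).
  exact: psd_tr_ge0.
have g2 : 0 <= \sum_l \tr (X *m U *m X *m ((N l)^T *m (q *m D *m q) *m N l)).
  by apply: sumr_ge0.
have g3 : 0 <= \tr (X *m U *m X *m (C^T *m C)) by apply: psd_tr_gram_ge0.
have g4 : 0 <= \tr (X *m U *m X *m (D *m B *m B^T *m D)).
  by rewrite DBE; apply: psd_tr_gram_ge0.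
have g5 : 0 <= \sum_l \tr (U *m ((Z l)^T *m D *m Z l)) by apply: sumr_ge0.
have sd := sum_dissipation.
have z3 : \tr (X *m U *m X *m (C^T *m C)) = 0 by lra.
have z2 : \sum_l \tr (X *m U *m X *m ((N l)^T *m (q *m D *m q) *m N l)) = 0 by lra.
have z5 : \sum_l \tr (U *m ((Z l)^T *m D *m Z l)) = 0 by lra.
have [H HE] := psd_factor psdD.
have Xinj j (Y1 Y2 : 'M[R]_(j, n)) : Y1 *m X = Y2 *m X -> Y1 = Y2.
  move=> e; have := congr1 (fun Y => Y *m (D *m D)) e.
  by rewrite XE -!mulmxA ![Di *m (D *m D)]mulmxA DiD !mul1mx ![Di *m D]DiD !mulmx1.
have gramD (G : 'M[R]_n) (V : 'M[R]_n) : psd V ->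
    \tr (V *m (G^T *m D *m G)) = 0 -> G *m V = 0.
  move=> pV; have -> : G^T *m D *m G = (H *m G)^T *m (H *m G).
    by rewrite trmx_mul HE !mulmxA.
  move=> /(psd_tr_gram_eq0 pV) h.
  have : Di *m (H^T *m (H *m G *m V)) = 0 by rewrite h !mulmx0.
  by rewrite !mulmxA -[Di *m H^T *m H]mulmxA -HE DiD mul1mx.
have CXU : C *m X *m U = 0.
  have := psd_tr_gram_eq0 psdXUX z3; rewrite !mulmxA => h.
  by apply: Xinj; rewrite h mul0mx.
have ZU l : Z l *m U = 0.
  have := z5 => /eqP; rewrite psumr_eq0// => /allP/(_ l (mem_index_enum _))/eqP.
  exact: gramD.
have qNXU l : q *m N l *m X *m U = 0.
  have := z2 => /eqP; rewrite psumr_eq0// => /allP/(_ l (mem_index_enum _))/eqP.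
  have -> : (N l)^T *m (q *m D *m q) *m N l = (q *m N l)^T *m D *m (q *m N l).
    by rewrite trmx_mul qT !mulmxA.
  by move=> /(gramD _ _ psdXUX); rewrite !mulmxA => h; apply: Xinj; rewrite h mul0mx.
have NXU l : N l *m X *m U = X *m N l *m U.
  have := ZU l; rewrite /Z mulmxBl => /eqP; rewrite subr_eq0 => /eqP <-.
  by rewrite -[LHS]mul1mx -pq mulmxDl !mulmxA qNXU addr0.
have AXU : A *m X *m U = X *m A *m U.
  have := congr1 (fun Y => Y *m (X *m U)) closed_loop_riccati.
  rewrite mul0mx !mulmxDl.
  have -> : C^T *m C *m (X *m U) = 0.
    by rewrite -mulmxA [C *m (X *m U)]mulmxA CXU mulmx0.
  have -> : D *m B *m B^T *m D *m (X *m U) = D *m B *m (B^T *m (D *m X) *m U).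
    by rewrite !mulmxA.
  rewrite DX BDiU mulmx0 !addr0.
  have -> : K^T *m D *m (X *m U) = A^T *m Di *m U.
    have -> : K^T *m D *m (X *m U) = K^T *m (D *m X) *m U by rewrite !mulmxA.
    rewrite DX KE linearB/= !trmx_mul trmxK DT !mulmxBl.
    have -> : D *m (B *m B^T) *m Di *m U = D *m B *m (B^T *m Di *m U) by rewrite !mulmxA.
    by rewrite BDiU mulmx0 subr0.
  have -> : D *m K *m (X *m U) = D *m (A *m X *m U).
    by rewrite -KXU !mulmxA.
  have -> : (\sum_l (N l)^T *m D *m N l) *m (X *m U) =
      (\sum_l (N l)^T *m Di *m N l) *m U.
    rewrite !mulmx_suml; apply: eq_bigr => l _.
    have -> : (N l)^T *m D *m N l *m (X *m U) = (N l)^T *m D *m (N l *m X *m U).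
      by rewrite !mulmxA.
    by rewrite NXU -DX !mulmxA.
  move=> h; have h2 : D *m (A *m X *m U) = Di *m A *m U.
    by apply: (addrI (A^T *m Di *m U)); 
    apply: (addIr ((\sum_l (N l)^T *m Di *m N l) *m U)); rewrite h filter_eq.
  have := congr1 (mulmx Di) h2; rewrite !mulmxA DiD mul1mx => ->.
  by rewrite XE.
split => //.
(* Stationarity of [X U X]: the commutation relations pull one factor [X] out on each side, and the
   stationarity equation of [U] remains in the middle. *)
split => //; first by rewrite !mulmxA pX -[X *m p *m U]mulmxA pU.
have pXAUX Y : p *m (X *m Y) = X *m (p *m Y) by rewrite mulmxA pX mulmxA.
have XpT (Y : 'M[R]_n) : Y *m X *m p = Y *m p *m X by rewrite -mulmxA -pX mulmxA.
have -> : p *m K *m (X *m U *m X) = X *m (p *m A *m U) *m X.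
  have -> : p *m K *m (X *m U *m X) = p *m (K *m X *m U) *m X by rewrite !mulmxA.
  by rewrite KXU AXU !mulmxA pX.
have -> : X *m U *m X *m K^T *m p = X *m (U *m A^T *m p) *m X.
  have -> : X *m U *m X *m K^T *m p = X *m (U *m X *m K^T) *m p by rewrite !mulmxA.
  rewrite UXK; have -> : U *m X *m A^T = U *m A^T *m X.
    by have := congr1 trmx AXU; rewrite !trmx_mul UT XT !mulmxA.
  by rewrite !mulmxA XpT.
have -> : \sum_l p *m N l *m (X *m U *m X) *m (N l)^T *m p =
    X *m (\sum_l N l *m U *m (N l)^T) *m X.
  rewrite mulmx_sumr mulmx_suml; apply: eq_bigr => l _.
  have -> : p *m N l *m (X *m U *m X) *m (N l)^T *m p =
      p *m (N l *m X *m U) *m (X *m (N l)^T) *m p by rewrite !mulmxA.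
  rewrite NXU; have -> : p *m (X *m N l *m U) *m (X *m (N l)^T) *m p =
      X *m (p *m N l *m U) *m X *m (N l)^T *m p by rewrite !mulmxA pX.
  rewrite pNU; have -> : X *m (N l *m U) *m X *m (N l)^T *m p =
    X *m N l *m (U *m X *m (N l)^T) *m p by rewrite !mulmxA.
  have -> : U *m X *m (N l)^T = U *m (N l)^T *m X.
    by have := congr1 trmx (NXU l); rewrite !trmx_mul UT XT !mulmxA.
  rewrite -!mulmxA -pX [(N l)^T *m (p *m X)]mulmxA [U *m (_ *m p *m X)]mulmxA.
  by rewrite [U *m (_ *m p)]mulmxA UNp !mulmxA.
by rewrite -!mulmxDl -!mulmxDr stat_ell mulmx0 mul0mx.
Qed.

End Consequences.

Let iter_mulA (j : nat) (Y Z : 'M[R]_n) :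
  iter j (mulmx X) (Y *m Z) = iter j (mulmx X) Y *m Z.
Proof. by elim: j => //= j ->; rewrite mulmxA. Qed.

(** The induction hypothesis is applied to [X U X], which is again stationary; the extra right
    factor [X] cancels because [X] is invertible. *)
Lemma stationary_commute_pow j U : stationary U ->
  A *m iter j (mulmx X) U = iter j (mulmx X) (A *m U).
Proof.
elim: j U => //= j IH U statU.
have [AXU statX _ _ _] := stationary_commute statU.
have Xinj (Y1 Y2 : 'M[R]_n) : Y1 *m X = Y2 *m X -> Y1 = Y2.
  move=> e; have := congr1 (fun Y => Y *m (D *m D)) e.
  by rewrite XE -!mulmxA ![Di *m (D *m D)]mulmxA DiD !mul1mx ![Di *m D]DiD !mulmx1.
have comm Y : X *m iter j (mulmx X) Y = iter j (mulmx X) (X *m Y).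
  by rewrite -!iterS -iterSr.
apply: Xinj; have := IH _ statX; rewrite iter_mulA -comm !mulmxA => ->.
by rewrite iter_mulA AXU -[X *m A *m U]mulmxA -comm.
Qed.

End Stationary.

(** * Diagonal coordinates and the spectral gap *)

Section Balanced.
Variables (R : rcfType) (n m c k r : nat) (sigma : 'I_n -> R).
Variables (A : 'M[R]_n) (B : 'M[R]_(n, m)) (C : 'M[R]_(c, n)).
Variable N : 'I_k -> 'M[R]_n.
Hypothesis sigma_gt0 : forall i, 0 < sigma i.
Hypothesis gap : forall i j : 'I_n, (i < r)%N -> (r <= j)%N -> sigma i <> sigma j.

Let D : 'M[R]_n := diag_mx (\row_i sigma i).
Let Di : 'M[R]_n := diag_mx (\row_i (sigma i)^-1).
Let p : 'M[R]_n := diag_mx (\row_i (i < r)%N%:R).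

Lemma psd_diag (f : 'I_n -> R) : (forall i, 0 <= f i) -> psd (diag_mx (\row_i f i)).
Proof.
move=> f0; split=> [|v]; first by rewrite tr_diag_mx.
rewrite mxE; apply: sumr_ge0 => i _; rewrite mul_mx_diag !mxE mulrAC.
by rewrite mulr_ge0// -expr2 sqr_ge0.
Qed.

Hypothesis riccati :
  A^T *m D + D *m A + \sum_l (N l)^T *m D *m N l + C^T *m C
    - D *m B *m B^T *m D = 0.
Hypothesis filter_lmi :
  psd (- (A^T *m Di + Di *m A + \sum_l (N l)^T *m Di *m N l - C^T *m C
    + Di *m B *m B^T *m Di)).

(* With [X = D^-2], [A X^j U = X^j A U] extends to polynomials in [X]; the one
   vanishing exactly at the first [r] eigenvalues kills the left-hand side and
   is invertible on the last [n - r] coordinates. *)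
Lemma stationary_invariant (U : 'M[R]_n) :
  stationary N p (A - B *m B^T *m D) U ->
  [/\ A *m U + U *m A^T + \sum_l N l *m U *m (N l)^T = 0 & C *m U = 0].
Proof.
move=> statU.
have psdD : psd D by apply: psd_diag => i; exact: ltW.
have psdDi : psd Di by apply: psd_diag => i; rewrite invr_ge0 ltW.
have DDi : D *m Di = 1%:M.
  rewrite mulmx_diag -diag_const_mx; congr diag_mx; apply/rowP => i.
  by rewrite !mxE divff// gt_eqF.
have pT : p^T = p by rewrite tr_diag_mx.
have pp : p *m p = p.
  rewrite mulmx_diag; congr diag_mx; apply/rowP => i; rewrite !mxE.
  by case: (i < r)%N; rewrite ?mulr1 ?mulr0.
have pD : p *m D = D *m p by exact: diag_mxC.
have pq : p + (1%:M - p) = 1%:M by rewrite addrC subrK.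
have [_ _ CU _ stat_ell] :=
  stationary_commute psdD DDi psdDi pT pp pD riccati filter_lmi erefl pq erefl statU.
have pow j := stationary_commute_pow psdD DDi psdDi pT pp pD riccati filter_lmi
  erefl pq erefl j statU.
have [psdU pU _] := statU.
have UT : U^T = U by case: psdU.
pose x i := (sigma i) ^- 2.
have itE (j : nat) (Y : 'M[R]_n) a b :
    iter j (mulmx (Di *m Di)) Y a b = x a ^+ j * Y a b.
  elim: j => [|j IH]; first by rewrite mul1r.
  rewrite iterS {1}mulmx_diag mul_diag_mx mxE IH !mxE exprS -[RHS]mulrA; congr (_ * _).
  by rewrite /x expr2 invfM.
pose f := \prod_(i < n | (i < r)%N) ('X - (x i)%:P).
(* Entrywise form of [A f(X) U = f(X) A U]; by linearity in [f] it reduces to powers of [X]. *)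
have fE a b : \sum_e A a e * (f.[x e] * U e b) = f.[x a] * (A *m U) a b.
  rewrite horner_coef mulr_suml.
  under [RHS]eq_bigr => j _ do rewrite -mulrA -itE -pow [(A *m iter _ _ _) _ _]mxE mulr_sumr.
  rewrite exchange_big/=; apply: eq_bigr => e _.
  rewrite horner_coef mulr_suml mulr_sumr; apply: eq_bigr => j _.
  by rewrite itE; ring.
have U0 (e b : 'I_n) : (r <= e)%N -> U e b = 0.
  by move=> re; rewrite -pU mul_diag_mx !mxE ltnNge re mul0r.
have pAU : p *m A *m U = A *m U.
  rewrite -mulmxA; apply/matrixP => a b; rewrite mul_diag_mx [LHS]mxE mxE.
  case: ltnP => ra; first by rewrite mul1r.
  rewrite mul0r; have := fE a b; rewrite big1 => [/esym/eqP|e _].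
    rewrite mulf_eq0 => /orP[|/eqP -> //]; rewrite horner_prod prodf_seq_eq0 => /hasP[i _].
    rewrite hornerXsubC subr_eq0 => /andP[ir /eqP]; rewrite /x => /invr_inj.
    move=> /eqP; rewrite eqrXn2// ?ltW// => /eqP e; case: (gap ir ra).
    by rewrite e.
  case: (ltnP e r) => er; last by rewrite U0// !mulr0.
  suff -> : f.[x e] = 0 by rewrite mul0r mulr0.
  by rewrite horner_prod (bigD1 e)//= hornerXsubC subrr mul0r.
split=> //; rewrite -[RHS]stat_ell pAU; congr (_ + _ + _).
by have := congr1 trmx pAU; rewrite !trmx_mul UT pT !mulmxA.
Qed.

End Balanced.

(** * Generators and truncation *)

Section Generator.
Variable R : realType.

(* The second moments of [dx = a x dt + sum_i g_i x dW_i] solve [P' = generator P]. *)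
Definition generator (q r : nat) (K : 'M[R]_q) (a : 'M[R]_r)
    (g : 'I_q -> 'M[R]_r) (V : 'M[R]_r) : 'M[R]_r :=
  a *m V + V *m a^T + \sum_(i < q) \sum_(j < q) K i j *: (g i *m V *m (g j)^T).

(** Formally, if [W = M^T b] with [b] a standard Wiener process, so that [K = M^T M], these are the
    coefficients against the components of [b]. *)
Definition mixed_noise (q k r : nat) (M : 'M[R]_(k, q)) (g : 'I_q -> 'M[R]_r)
  (l : 'I_k) : 'M[R]_r := \sum_(i < q) M l i *: g i.

Lemma mixed_noiseE q k r (M : 'M[R]_(k, q)) (g : 'I_q -> 'M[R]_r) (V : 'M[R]_r) :
  \sum_(i < q) \sum_(j < q) (M^T *m M) i j *: (g i *m V *m (g j)^T) =
  \sum_l mixed_noise M g l *m V *m (mixed_noise M g l)^T.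
Proof.
transitivity (\sum_l \sum_i \sum_j
    (M l i * M l j) *: (g i *m V *m (g j)^T)); last first.
  apply: eq_bigr => l _; rewrite /mixed_noise [(\sum_(i < q) _)^T]linear_sum/=.
  rewrite !mulmx_suml; apply: eq_bigr => i _.
  rewrite mulmx_sumr; apply: eq_bigr => j _.
  by rewrite linearZ/= -!scalemxAl -scalemxAr scalerA.
rewrite [RHS]exchange_big/=; apply: eq_bigr => i _.
rewrite [RHS]exchange_big/=; apply: eq_bigr => j _.
rewrite -scaler_suml; congr (_ *: _).
by rewrite mxE; apply: eq_bigr => l _; rewrite mxE.
Qed.

Lemma noise_termE q k r (M : 'M[R]_(k, q)) (g : 'I_q -> 'M[R]_r) (V : 'M[R]_r) :
  noise_term (M^T *m M) g V =
  \sum_l (mixed_noise M g l)^T *m V *m mixed_noise M g l.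
Proof.
have e l : (mixed_noise M g l)^T = mixed_noise M (fun i => (g i)^T) l.
  by rewrite /mixed_noise linear_sum/=; apply: eq_bigr => i _; rewrite linearZ.
under [RHS]eq_bigr => l _ do rewrite -[X in _ *m X]trmxK e.
rewrite -mixed_noiseE /noise_term.
by apply: eq_bigr => i _; apply: eq_bigr => j _; rewrite trmxK.
Qed.

End Generator.

(** * Passage to balanced coordinates and back *)

Section Truncation.
Variables (R : realType) (q n m c r : nat) (K : 'M[R]_q).
Variables (A : 'M[R]_n) (N : 'I_q -> 'M[R]_n) (B : 'M[R]_(n, m)) (C : 'M[R]_(c, n)).
Variables (P Q S : 'M[R]_n) (sigma : 'I_n -> R) (hrn : (r <= n)%N).
Hypotheses (psdK : psd K) (hPlmi : lqg_filter_lmi K A B C N P).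
Hypothesis hQric : lqg_control_riccati K A B C N Q.
Hypothesis sigma_gt0 : forall i, 0 < sigma i.
Hypothesis gap : forall i j : 'I_n, (i < r)%N -> (r <= j)%N -> sigma i <> sigma j.
Hypothesis hS : balancing P Q sigma S.

Let Ar := trunc_state hrn S A.
Let Nr := fun i => trunc_state hrn S (N i).
Let Br := trunc_input hrn S B.
Let Sr := trunc_sigma hrn sigma.
Let a := Ar - Br *m Br^T *m Sr.

Let D : 'M[R]_n := diag_mx (\row_i sigma i).
Let Di : 'M[R]_n := diag_mx (\row_i (sigma i)^-1).
Let E : 'M[R]_(n, r) := colsub (widen_ord hrn) 1%:M.
Let T := invmx S.

Let ST : S *m T = 1%:M. Proof. by case: hS => uS _ _; rewrite mulmxV. Qed.
Let TS : T *m S = 1%:M. Proof. by case: hS => uS _ _; rewrite mulVmx. Qed.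
Let TTST : T^T *m S^T = 1%:M. Proof. by rewrite -trmx_mul ST trmx1. Qed.
Let STTT : S^T *m T^T = 1%:M. Proof. by rewrite -trmx_mul TS trmx1. Qed.

Let DDi : D *m Di = 1%:M.
Proof.
rewrite mulmx_diag -diag_const_mx; congr diag_mx; apply/rowP => i.
by rewrite !mxE divff// gt_eqF.
Qed.

Let QE : Q = S^T *m D *m S.
Proof.
have [uS _ e] := hS; rewrite /D -e -trmx_inv -/T.
by rewrite !mulmxA STTT mul1mx -mulmxA TS mulmx1.
Qed.

Let PiE : invmx P = S^T *m Di *m S.
Proof.
have [uS e _] := hS.
have PE : P *m (S^T *m Di *m S) = 1%:M.
  have -> : P *m (S^T *m Di *m S) = T *m (S *m P *m S^T) *m Di *m S.
    by rewrite !mulmxA TS mul1mx.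
  by rewrite e -/D -[T *m D *m Di]mulmxA DDi mulmx1 TS.
have uP : P \in unitmx by have [] := mulmx1_unit PE.
by rewrite -[RHS]mul1mx -(mulVmx uP) -[RHS]mulmxA PE mulmx1.
Qed.

Let ETE : E^T *m E = 1%:M.
Proof.
apply/matrixP => i j; rewrite !mxE (bigD1 (widen_ord hrn i))//= big1 => [|e ne].
  by rewrite addr0 !mxE eqxx mul1r.
by rewrite !mxE (negPf ne) mul0r.
Qed.

Let p : 'M[R]_n := diag_mx (\row_i (i < r)%N%:R).

Let EET : E *m E^T = p.
Proof.
apply/matrixP => i j; rewrite !mxE.
case: (ltnP i r) => ir.
  rewrite (bigD1 (Ordinal ir))//= big1 => [|e ne].
    by rewrite !mxE addr0 -val_eqE eqxx mul1r eq_sym.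
  rewrite !mxE -val_eqE/=; case: eqP => [ie|]; last by rewrite mul0r.
  by move: ne; rewrite -val_eqE/= ie eqxx.
rewrite mul0rn big1// => e _; rewrite !mxE -val_eqE/=.
by case: eqP => [ie|]; rewrite ?mul0r//; move: ir; rewrite ie leqNgt ltn_ord.
Qed.

Let DE : D *m E = E *m Sr.
Proof.
rewrite mul_diag_mx mul_mx_diag; apply/matrixP => i j; rewrite !mxE.
by case: eqP => [->|]; rewrite ?mulr1 ?mul1r ?mulr0 ?mul0r.
Qed.

Let mxsubE (Y : 'M[R]_n) : mxsub (widen_ord hrn) (widen_ord hrn) Y = E^T *m Y *m E.
Proof.
apply/matrixP => i j; rewrite !mxE (bigD1 (widen_ord hrn j))//= big1 => [|e ne].
  rewrite !mxE eqxx mulr1 addr0 (bigD1 (widen_ord hrn i))//= big1 => [|e ne].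
    by rewrite !mxE eqxx mul1r addr0.
  by rewrite !mxE (negPf ne) mul0r.
by rewrite !mxE (negPf ne) mulr0.
Qed.

Let BrE : Br = E^T *m (S *m B).
Proof.
apply/matrixP => i j; rewrite [RHS]mxE (bigD1 (widen_ord hrn i))//= big1 => [|e ne].
  by rewrite [E^T _ _]mxE !mxE eqxx mul1r addr0.
by rewrite [E^T _ _]mxE !mxE (negPf ne) mul0r.
Qed.

Let A' := S *m A *m T.
Let B' := S *m B.
Let C' := C *m T.

Let aE : a = E^T *m (A' - B' *m B'^T *m D) *m E.
Proof.
rewrite /a /Ar /trunc_state -/T mxsubE BrE mulmxBr mulmxBl; congr (_ - _).
by rewrite -/B' trmx_mul trmxK -!mulmxA -DE.
Qed.

Section Mixed.
Variables (k : nat) (M : 'M[R]_(k, q)).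
Hypothesis KM : K = M^T *m M.

Let N' l := S *m mixed_noise M N l *m T.

Let NrE l : mixed_noise M Nr l = E^T *m N' l *m E.
Proof.
rewrite /N' /mixed_noise !mulmx_sumr !mulmx_suml mulmx_sumr mulmx_suml.
apply: eq_bigr => i _; rewrite /Nr /trunc_state -/T mxsubE.
by rewrite -!(scalemxAl, scalemxAr).
Qed.

Let conjA Y : T^T *m (A^T *m (S^T *m Y *m S)) *m T = A'^T *m Y.
Proof. by rewrite /A' !trmx_mul -!mulmxA ST mulmx1. Qed.

Let conjA' Y : T^T *m (S^T *m Y *m S *m A) *m T = Y *m A'.
Proof. by rewrite /A' !mulmxA TTST mul1mx. Qed.

Let conjN Y : T^T *m (\sum_l (mixed_noise M N l)^T *m (S^T *m Y *m S)
    *m mixed_noise M N l) *m T = \sum_l (N' l)^T *m Y *m N' l.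
Proof.
rewrite mulmx_sumr mulmx_suml; apply: eq_bigr => l _.
by rewrite /N' !trmx_mul !mulmxA.
Qed.

Let conjC : T^T *m (C^T *m C) *m T = C'^T *m C'.
Proof. by rewrite /C' !trmx_mul !mulmxA. Qed.

Let conjB Y : T^T *m (S^T *m Y *m S *m B *m B^T *m (S^T *m Y *m S)) *m T =
  Y *m B' *m B'^T *m Y.
Proof.
by rewrite /B' !trmx_mul !mulmxA TTST mul1mx -[_ *m S *m T]mulmxA ST mulmx1.
Qed.

Let balanced_riccati :
  A'^T *m D + D *m A' + \sum_l (N' l)^T *m D *m N' l + C'^T *m C'
    - D *m B' *m B'^T *m D = 0.
Proof.
have := congr1 (fun Y => T^T *m Y *m T) hQric.
rewrite mulmx0 mul0mx => e; rewrite -[RHS]e KM noise_termE QE.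
by rewrite mulmxBr mulmxBl !mulmxDr !mulmxDl conjA conjA' conjN conjC conjB.
Qed.

Let balanced_filter_lmi :
  psd (- (A'^T *m Di + Di *m A' + \sum_l (N' l)^T *m Di *m N' l - C'^T *m C'
    + Di *m B' *m B'^T *m Di)).
Proof.
have [sL nL] := hPlmi.
set L := (X in X^T = X) in sL nL; suff -> : A'^T *m Di + Di *m A'
    + \sum_l (N' l)^T *m Di *m N' l - C'^T *m C' + Di *m B' *m B'^T *m Di
    = T^T *m L *m T.
  rewrite -mulNmx -mulmxN; apply: psd_congr; split; first by rewrite linearN/= sL.
  by move=> v; rewrite mulmxN mulNmx oppmxE oppr_ge0.
rewrite /L KM noise_termE PiE !(mulmxDr, mulmxDl) mulmxN mulNmx.
by rewrite conjA conjA' conjN conjC conjB.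
Qed.

Let K' := A' - B' *m B'^T *m D.

Let psdE V : psd V -> psd (E *m V *m E^T).
Proof. by move=> pV; rewrite -{1}(trmxK E); apply: psd_congr. Qed.

Let generatorE V : E *m generator K a Nr V *m E^T =
  p *m K' *m (E *m V *m E^T) + E *m V *m E^T *m K'^T *m p
  + \sum_l p *m N' l *m (E *m V *m E^T) *m (N' l)^T *m p.
Proof.
rewrite aE -/K'; move: (K') => K1.
rewrite /generator KM mixed_noiseE !mulmxDr !mulmxDl -!EET.
congr (_ + _ + _).
- by rewrite !mulmxA.
- by rewrite !trmx_mul trmxK !mulmxA.
- rewrite mulmx_sumr mulmx_suml; apply: eq_bigr => l _.
  by rewrite NrE !trmx_mul trmxK !mulmxA.
Qed.

(** The extension by zero [E V E^T] is [stationary] in balanced coordinates; conjugation by [T], the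
    inverse of [S], brings it back to the original ones, and [E^T S] undoes both operations, so it
    is nonzero. *)
Lemma truncated_kernel_mixed (V : 'M[R]_r) : psd V -> V != 0 ->
  generator K a Nr V = 0 ->
  exists U, [/\ psd U, U != 0, C *m U = 0 & generator K A N U = 0].
Proof.
move=> psdV V0 gV; set U := E *m V *m E^T.
have statU : stationary N' p K' U.
  split; first exact: psdE.
    by rewrite /U !mulmxA -EET -[_ *m E^T *m E]mulmxA ETE mulmx1.
  by rewrite -generatorE gV mulmx0 mul0mx.
have [gU CU] := stationary_invariant sigma_gt0 gap balanced_riccati
  balanced_filter_lmi statU.
have UE : U = E *m V *m E^T by [].
have psdU : psd U by exact: psdE.
exists (T *m U *m T^T); clearbody U; split.
- by rewrite -{1}(trmxK T); apply: psd_congr.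
- apply: contraNneq V0 => e; have := congr1 (fun Y => E^T *m (S *m Y *m S^T) *m E) e.
  rewrite !(mulmx0, mul0mx) UE !mulmxA.
  rewrite -[_ *m S *m T]mulmxA ST mulmx1 -[_ *m T^T *m S^T]mulmxA TTST mulmx1.
  by rewrite ETE mul1mx -mulmxA ETE mulmx1 => ->.
- by rewrite !mulmxA -/C' CU mul0mx.
- have := congr1 (fun Y => T *m Y *m T^T) gU.
  rewrite mulmx0 mul0mx => e; rewrite -[RHS]e /generator KM mixed_noiseE !mulmxDr !mulmxDl.
  congr (_ + _ + _).
  + by rewrite /A' !mulmxA TS mul1mx.
  + by rewrite /A' !trmx_mul -!mulmxA STTT mulmx1.
  + rewrite mulmx_sumr mulmx_suml; apply: eq_bigr => l _.
    rewrite /N' !trmx_mul !mulmxA TS mul1mx -!mulmxA STTT mulmx1.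
    by rewrite !mulmxA.
Qed.

(** The accounting of [stationary_output] without stationarity: the trace is minus the sum of the
    output cost, the control cost and the noise leaving the leading block. *)
Lemma truncated_lyapunov_mixed (V : 'M[R]_r) : psd V ->
  \tr (Sr *m generator K a Nr V) <= 0.
Proof.
move=> psdV; set U := E *m V *m E^T; have psdU : psd U by exact: psdE.
have pU : p *m U = U.
  by rewrite /U !mulmxA -EET -[_ *m E^T *m E]mulmxA ETE mulmx1.
have Up : U *m p = U by rewrite /U -EET !mulmxA -[_ *m E^T *m E]mulmxA ETE mulmx1.
have psdD : psd D by apply: psd_diag => i; exact: ltW.
have DT : D^T = D by case: psdD.
have pD : p *m D = D *m p by exact: diag_mxC.
have -> : \tr (Sr *m generator K a Nr V) =
    \tr (D *m (p *m K' *m U)) + \tr (D *m (U *m K'^T *m p)) +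
    \sum_l \tr (D *m (p *m N' l *m U *m (N' l)^T *m p)).
  rewrite -[\sum_l _](raddf_sum (@mxtrace R n)) -mulmx_sumr -!mxtraceD -!mulmxDr.
  rewrite -generatorE -[Sr]mul1mx -ETE -[E^T *m E *m Sr]mulmxA -DE.
  by rewrite -!mulmxA mxtrace_mulC -!mulmxA.
clearbody U.
have -> : \tr (D *m (p *m K' *m U)) = \tr (U *m (D *m K')).
  move: (K') => K1; have -> : D *m (p *m K1 *m U) = p *m (D *m K1 *m U).
    by rewrite !mulmxA pD.
  by rewrite mxtrace_mulC -!mulmxA Up [RHS]mxtrace_mulC -!mulmxA.
have -> : \tr (D *m (U *m K'^T *m p)) = \tr (U *m (K'^T *m D)).
  move: (K') => K1; have -> : D *m (U *m K1^T *m p) = (D *m (U *m K1^T)) *m p.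
    by rewrite !mulmxA.
  rewrite mxtrace_mulC [p *m (D *m _)]mulmxA pD.
  by rewrite -!mulmxA [p *m (U *m _)]mulmxA pU mxtrace_mulC -!mulmxA.
pose o : 'M[R]_n := 1%:M - p; have po : p + o = 1%:M by rewrite addrC subrK.
have pT : p^T = p by rewrite tr_diag_mx.
have oT : o^T = o by rewrite linearB/= trmx1 pT.
have pp : p *m p = p by rewrite -EET -!mulmxA [E^T *m (E *m _)]mulmxA ETE mul1mx.
have Do : D = p *m D *m p + o *m D *m o.
  have pDo : p *m D *m o = 0 by rewrite pD -mulmxA mulmxBr mulmx1 pp subrr mulmx0.
  have oDp : o *m D *m p = 0 by rewrite -mulmxA -pD mulmxA mulmxBl mul1mx pp subrr mul0mx.
  rewrite -[LHS]mul1mx -[LHS]mulmx1 -po; clearbody o p.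
  by rewrite !mulmxDl !mulmxDr pDo oDp addr0 add0r.
have -> : \sum_l \tr (D *m (p *m N' l *m U *m (N' l)^T *m p)) =
    \sum_l \tr (U *m ((N' l)^T *m D *m N' l)) -
    \sum_l \tr (U *m ((N' l)^T *m (o *m D *m o) *m N' l)).
  apply/esym/eqP; rewrite subr_eq -big_split/=; apply/eqP.
  apply: eq_bigr => l _; move: (N' l) => Z.
  rewrite {1}Do mulmxDr mulmxDl mulmxDr mxtraceD; congr (_ + _).
  have -> : D *m (p *m Z *m U *m Z^T *m p) = (D *m p *m Z *m U *m Z^T) *m p.
    by rewrite !mulmxA.
  by rewrite [RHS]mxtrace_mulC [LHS]mxtrace_mulC -!mulmxA [LHS]mxtrace_mulC -!mulmxA.
have g1 : 0 <= \sum_l \tr (U *m ((N' l)^T *m (o *m D *m o) *m N' l)).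
  apply: sumr_ge0 => l _; apply: psd_tr_ge0 => //; apply: psd_congr.
  by rewrite -{1}oT; apply: psd_congr.
have g2 : 0 <= \tr (U *m (C'^T *m C')) by apply: psd_tr_gram_ge0.
have g3 : 0 <= \tr (U *m (D *m B' *m B'^T *m D)).
  have -> : D *m B' *m B'^T *m D = (B'^T *m D)^T *m (B'^T *m D).
    by rewrite [(B'^T *m D)^T]trmx_mul trmxK DT !mulmxA.
  exact: psd_tr_gram_ge0.
have := congr1 (fun Y => \tr (U *m Y)) (closed_loop_riccati psdD balanced_riccati erefl).
rewrite mulmx0 mxtrace0 -/K'; clearbody o; move: (K') => K1.
rewrite !mulmxDr !mxtraceD mulmx_sumr raddf_sum/= => h.
lra.
Qed.

End Mixed.

Lemma truncated_kernel (V : 'M[R]_r) : psd V -> V != 0 ->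
  generator K a Nr V = 0 ->
  exists U, [/\ psd U, U != 0, C *m U = 0 & generator K A N U = 0].
Proof.
move=> pV V0 gV; have [M KM] := psd_factor psdK.
exact: (truncated_kernel_mixed KM pV V0 gV).
Qed.

Lemma truncated_lyapunov (V : 'M[R]_r) : psd V ->
  \tr (Sr *m generator K a Nr V) <= 0.
Proof.
move=> pV; have [M KM] := psd_factor psdK.
exact: (truncated_lyapunov_mixed KM pV).
Qed.

End Truncation.

(** * Coercivity and decay of moment flows *)

Section PsdBounds.
Variable R : realType.

Lemma psd_diag_ge0 n (V : 'M[R]_n) i : psd V -> 0 <= V i i.
Proof.
move=> [_ /(_ (delta_mx i 0))]; rewrite -colE trmx_delta -rowE !mxE.
by [].
Qed.

(** Off the diagonal, testing the form on [e_i + e_j] and [e_i - e_j] bounds twice the entry in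
    absolute value by [V i i + V j j]. *)
Lemma psd_entry_le n (V : 'M[R]_n) i j : psd V -> `|V i j| <= \tr V.
Proof.
move=> pV; have [VT qV] := pV.
have diag k := psd_diag_ge0 k pV.
have [->|ij] := eqVneq i j.
  rewrite ger0_norm// /mxtrace (bigD1 j)//= lerDl; exact: sumr_ge0.
have le2 : V i i + V j j <= \tr V.
  rewrite /mxtrace (bigD1 i)//= (bigD1 j)//= ?(eq_sym j)// addrA lerDl.
  exact: sumr_ge0.
have Vij : V j i = V i j by rewrite -[in LHS]VT mxE.
have e k l : ((delta_mx k 0 : 'cV[R]_n)^T *m V *m (delta_mx l 0 : 'cV_n)) 0 0 = V k l.
  by rewrite -colE trmx_delta -rowE !mxE.
have h s : 0 <= V i i + s * V i j + s * V i j + s ^+ 2 * V j j.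
  have := qV (delta_mx i 0 + s *: delta_mx j 0).
  rewrite [(_ + _)^T]linearD/= [(s *: _)^T]linearZ/= !(mulmxDl, mulmxDr) -!(scalemxAl, scalemxAr).
  by rewrite !(addmxE, scalemxE) !e Vij expr2 !addrA -mulrA.
have h1 := h 1; have h2 := h (-1).
rewrite ler_norml; apply/andP; split; nra.
Qed.

Lemma psd_trace_ge0 n (V : 'M[R]_n) : psd V -> 0 <= \tr V.
Proof. by move=> pV; apply: sumr_ge0 => i _; exact: psd_diag_ge0. Qed.

Lemma psd_scale n (V : 'M[R]_n) c : 0 <= c -> psd V -> psd (c *: V).
Proof.
move=> c0 [sV qV]; split=> [|v]; first by rewrite linearZ/= sV.
by rewrite -scalemxAr -scalemxAl scalemxE mulr_ge0.
Qed.

End PsdBounds.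

Section Adjoint.
Variables (R : realType) (q r : nat) (K : 'M[R]_q) (a : 'M[R]_r).
Variable g : 'I_q -> 'M[R]_r.

Definition generator_adj (Y : 'M[R]_r) : 'M[R]_r :=
  Y *m a + a^T *m Y + \sum_(i < q) \sum_(j < q) K i j *: ((g j)^T *m Y *m g i).

Lemma tr_generator (Y V : 'M[R]_r) :
  \tr (Y *m generator K a g V) = \tr (generator_adj Y *m V).
Proof.
rewrite /generator /generator_adj !mulmxDr !mulmxDl !mxtraceD; congr (_ + _ + _).
- by rewrite mulmxA.
- by rewrite mulmxA mxtrace_mulC !mulmxA.
- rewrite mulmx_sumr mulmx_suml !raddf_sum; apply: eq_bigr => i _ /=.
  rewrite mulmx_sumr mulmx_suml !raddf_sum; apply: eq_bigr => j _ /=.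
  rewrite -scalemxAr -scalemxAl !linearZ/=; congr (_ * _).
  have -> : Y *m (g i *m V *m (g j)^T) = (Y *m g i *m V) *m (g j)^T by rewrite !mulmxA.
  by rewrite mxtrace_mulC !mulmxA.
Qed.

(** Entries become functionals [tr (Y V)], so that homogeneity, continuity and exchange with time
    integrals need to be known only for these. *)
Lemma generator_entry (V : 'M[R]_r) i j :
  generator K a g V i j = \tr (generator_adj (delta_mx j i) *m V).
Proof.
rewrite -tr_generator mxtrace_mulC /mxtrace (bigD1 i)//= big1 => [|k /negPf ki].
  rewrite addr0 [RHS]mxE (bigD1 j)//= big1 => [|k /negPf ki].
    by rewrite [delta_mx _ _ _ _]mxE !eqxx mulr1 addr0.
  by rewrite [delta_mx _ _ _ _]mxE ki mulr0.
by rewrite mxE big1// => l _; rewrite [delta_mx _ _ _ _]mxE ki andbF mulr0.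
Qed.

Lemma generator_scale c (V : 'M[R]_r) :
  generator K a g (c *: V) = c *: generator K a g V.
Proof.
apply/matrixP => i j; rewrite scalemxE !generator_entry -scalemxAr.
by rewrite mxtraceZ.
Qed.

End Adjoint.

(** * Compactness of the trace-one slice and coercivity *)

Section Coercivity.
Variables (R : realType) (r : nat).

Let continuous_sumR (T : topologicalType) n (F : 'I_n -> T -> R) :
  (forall i, continuous (F i)) -> continuous (fun v => \sum_(i < n) F i v).
Proof.
move=> h; apply: (continuous_big (U := R)); last by move=> i _; exact: h.
by move=> z; apply: cvgD; [exact: cvg_fst|exact: cvg_snd].
Qed.

Lemma continuous_tr_vec (Y : 'M[R]_r) :
  continuous (fun v : 'rV[R]_(r * r) => \tr (Y *m vec_mx v)).
Proof.
have -> : (fun v : 'rV[R]_(r * r) => \tr (Y *m vec_mx v)) =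
    (fun v => \sum_i \sum_j Y i j * v 0 (mxvec_index j i)).
  apply/funext => v; apply: eq_bigr => i _.
  by rewrite mxE; apply: eq_bigr => j _; rewrite mxE.
apply: continuous_sumR => i.
apply: continuous_sumR => j.
move=> v; apply: (@continuous_comp _ _ _ (fun w : 'rV[R]_(r * r) => w 0 (mxvec_index j i)) ( *%R (Y i j))); last exact: mulrl_continuous.
exact: coord_continuous.
Qed.

(** Matrices are flattened to row vectors, for which closed bounded sets are compact. Symmetry, each
    value of the quadratic form and the trace are continuous functionals [tr (Y V)], so the slice is
    an intersection of closed preimages. *)
Lemma closed_psd_slice :
  closed [set v : 'rV[R]_(r * r) | psd (vec_mx v) /\ \tr (vec_mx v) = 1].
Proof.
have trE (v : 'rV[R]_(r * r)) : \tr (vec_mx v) = \tr (1%:M *m vec_mx v) by rewrite mul1mx.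
have qE (v : 'rV[R]_(r * r)) (w : 'cV[R]_r) :
    (w^T *m vec_mx v *m w) 0 0 = \tr ((w *m w^T) *m vec_mx v).
  by rewrite -mxtrace_mulC mulmxA mxtrace_mulC mulmxA /mxtrace big_ord1.
have sE (v : 'rV[R]_(r * r)) i j : vec_mx v i j = \tr (delta_mx j i *m vec_mx v).
  rewrite mxtrace_mulC /mxtrace (bigD1 i)//= big1 => [|k /negPf ki].
    rewrite addr0 [RHS]mxE (bigD1 j)//= big1 => [|k /negPf ki].
      by rewrite [delta_mx _ _ _ _]mxE !eqxx mulr1 addr0.
    by rewrite [delta_mx _ _ _ _]mxE ki mulr0.
  by rewrite mxE big1// => l _; rewrite [delta_mx _ _ _ _]mxE ki andbF mulr0.
have -> : [set v : 'rV[R]_(r * r) | psd (vec_mx v) /\ \tr (vec_mx v) = 1] =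
    (\bigcap_(ij in [set: 'I_r * 'I_r]) ((fun v =>
       \tr ((delta_mx ij.2 ij.1 - delta_mx ij.1 ij.2) *m vec_mx v)) @^-1` [set x | x = 0])) `&`
    (\bigcap_(w in [set: 'cV[R]_r]) ((fun v =>
       \tr ((w *m w^T) *m vec_mx v)) @^-1` [set x | 0 <= x])) `&`
    ((fun v => \tr (1%:M *m vec_mx v)) @^-1` [set x | x = 1]).
  apply/seteqP; split=> [v [[sv qv] tv]|v [[sv qv] tv]].
    split; [split|by rewrite /= -trE] => /= [[i j] _|w _] /=.
      by rewrite mulmxBl raddfB/= -!sE -[in X in X - _]sv [_^T _ _]mxE subrr.
    by rewrite -qE; exact: qv.
  split; last by rewrite trE.
  split=> [|w]; last by rewrite qE; exact: qv.
  apply/matrixP => i j; rewrite [LHS]mxE; have /= := sv (j, i) I.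
  by rewrite mulmxBl raddfB/= -!sE => /eqP; rewrite subr_eq0 => /eqP.
apply: closedI; first apply: closedI.
- apply: closed_bigI => -[i j] _; apply: preimage_closed => [v _|].
    exact: continuous_tr_vec.
  exact: closed_eq.
- apply: closed_bigI => w _; apply: preimage_closed => [v _|].
    exact: continuous_tr_vec.
  exact: closed_ge.
- apply: preimage_closed => [v _|]; first exact: continuous_tr_vec.
  exact: closed_eq.
Qed.

Lemma compact_psd_slice :
  compact [set v : 'rV[R]_(r * r) | psd (vec_mx v) /\ \tr (vec_mx v) = 1].
Proof.
apply: bounded_closed_compact; last exact: closed_psd_slice.
exists 1; split; first exact: num_real.
move=> M M1 v [pv tv]; apply: le_trans (ltW M1).
rewrite [leLHS]/Num.Def.normr/= mx_normrE; apply/bigmax_leP; split=> // -[i k] _ /=.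
rewrite (ord1 i); case/mxvec_indexP: k => a b.
by have := psd_entry_le a b pv; rewrite mxE tv.
Qed.

Variables (q : nat) (K : 'M[R]_q) (a : 'M[R]_r) (g : 'I_q -> 'M[R]_r).
Hypothesis no_kernel : forall V, psd V -> generator K a g V = 0 -> V = 0.

(** The right-hand side is continuous on the compact slice and has no zero there; its minimum is the
    constant, and homogeneity carries the bound to the whole cone. *)
Lemma generator_coercive : exists2 e : R, 0 < e & forall V, psd V ->
  e * \tr V <= \sum_i \sum_j `|generator K a g V i j|.
Proof.
pose A := [set v : 'rV[R]_(r * r) | psd (vec_mx v) /\ \tr (vec_mx v) = 1].
have hom V : psd V -> \tr V = 0 \/ exists2 v, A v & V = \tr V *: vec_mx v.
  move=> pV; have := psd_trace_ge0 pV; rewrite le_eqVlt => /orP[/eqP|tV]; first by left.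
  right; exists (mxvec ((\tr V)^-1 *: V)); rewrite /A/= mxvecK; last first.
    by rewrite scalerA divff ?gt_eqF// scale1r.
  split; first by apply: psd_scale => //; rewrite invr_ge0 ltW.
  by rewrite mxtraceZ mulVf// gt_eqF.
(* The slice is empty only for [r = 0]; every trace is then zero and any constant works. *)
have [A0|] := pselect (A !=set0); last first.
  move=> /nonemptyPn A0; exists 1 => // V pV; case: (hom V pV) => [->|[v]].
    by rewrite mulr0; apply: sumr_ge0 => i _; apply: sumr_ge0.
  by rewrite A0.
pose F (v : 'rV[R]_(r * r)) := \sum_i \sum_j `|generator K a g (vec_mx v) i j|.
have cF : continuous F.
  apply: continuous_sumR => i.
  apply: continuous_sumR => j.
  move=> v; apply: continuous_comp; last exact: norm_continuous.
  have -> : (fun w : 'rV[R]_(r * r) => generator K a g (vec_mx w) i j) =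
      (fun w => \tr (generator_adj K a g (delta_mx j i) *m vec_mx w)).
    by apply/funext => w; rewrite generator_entry.
  exact: continuous_tr_vec.
have [v Av Fv] := compact_EVT_min A0 compact_psd_slice (continuous_subspaceT cF).
have [pv tv] : A v by rewrite inE in Av.
exists (F v).
  rewrite lt0r; apply/andP; split; last by apply: sumr_ge0 => i _; apply: sumr_ge0.
  apply/eqP => F0; have v0 : vec_mx v = 0.
    apply: no_kernel => //; apply/matrixP => i j; rewrite [RHS]mxE.
    move/eqP: F0; rewrite psumr_eq0 => [|k _]; last exact: sumr_ge0.
    move=> /allP/(_ i (mem_index_enum _)); rewrite psumr_eq0 => [|k _ //].
    by move=> /allP/(_ j (mem_index_enum _)); rewrite normr_eq0 => /eqP.
  by move/eqP: tv; rewrite v0 mxtrace0 eq_sym oner_eq0.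
move=> V pV; case: (hom V pV) => [->|[w Aw VE]].
  by rewrite mulr0; apply: sumr_ge0 => i _; apply: sumr_ge0.
have -> : \sum_i \sum_j `|generator K a g V i j| = \tr V * F w.
  rewrite {1}VE generator_scale mulr_sumr; apply: eq_bigr => i _.
  rewrite mulr_sumr; apply: eq_bigr => j _.
  by rewrite scalemxE normrM ger0_norm// psd_trace_ge0.
by rewrite mulrC ler_wpM2l ?psd_trace_ge0//; apply: Fv; rewrite inE.
Qed.

End Coercivity.

Section RintegralSum.
Context d (T : measurableType d) (R : realType).
Variable mu : {measure set T -> \bar R}.
Variables (A : set T) (mA : measurable A).

Lemma integrable_sumR I (s : seq I) (f : I -> T -> R) :
  (forall i, mu.-integrable A (EFin \o f i)) ->
  mu.-integrable A (EFin \o (fun x => \sum_(i <- s) f i x)).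
Proof.
move=> intf; have -> : EFin \o (fun x => \sum_(i <- s) f i x) =
    (fun x => \sum_(i <- s) (f i x)%:E)%E.
  by apply/funext => x; rewrite /= -sumEFin.
by apply: integrable_sum => // i _; exact: intf.
Qed.

Lemma integrableZlR (c : R) (f : T -> R) : mu.-integrable A (EFin \o f) ->
  mu.-integrable A (EFin \o (fun x => c * f x)).
Proof.
by move=> intf; have := integrableZl mA c intf; congr integrable; apply/funext => x.
Qed.

Lemma Rintegral_sum I (s : seq I) (f : I -> T -> R) :
  (forall i, mu.-integrable A (EFin \o f i)) ->
  \int[mu]_(x in A) (\sum_(i <- s) f i x) = \sum_(i <- s) \int[mu]_(x in A) f i x.
Proof.
move=> intf; elim: s => [|i s IH].
  rewrite big_nil /Rintegral; under eq_integral do rewrite big_nil.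
  by rewrite integral0.
rewrite big_cons -IH -RintegralD//; last exact: integrable_sumR.
by apply: eq_Rintegral => x _; rewrite big_cons.
Qed.

End RintegralSum.

Lemma integrable_cst_itv (R : realType) (c s t : R) :
  (@lebesgue_measure R).-integrable `[s, t] (EFin \o cst c).
Proof.
apply: measurable_bounded_integrable => //=.
  by rewrite lebesgue_measure_itv/=; case: ifPn => // _; rewrite -EFinB ltry.
exists `|c|; split; first exact: num_real.
by move=> M cM x _ /=; exact: ltW.
Qed.

(** * Moment flows in integral form *)

Section Decay.
Variables (R : realType) (r q : nat) (K : 'M[R]_q) (a : 'M[R]_r).
Variable g : 'I_q -> 'M[R]_r.
Local Notation leb := (@lebesgue_measure R).

(** The integral form is what Fubini and the isometry deliver; neither continuity nor
    differentiability of [P] is asked for. *)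
Record moment_flow (P : R -> 'M[R]_r) : Prop := {
  flow_psd : forall t, 0 <= t -> psd (P t);
  flow_integrable : forall t, 0 <= t -> forall i j,
    leb.-integrable `[0, t] (EFin \o (fun s => P s i j));
  flow_eq : forall t, 0 <= t -> forall i j,
    P t i j = P 0 i j + \int[leb]_(s in `[0, t]) (generator K a g (P s) i j) }.

Definition mxint (P : R -> 'M[R]_r) (s t : R) : 'M[R]_r :=
  \matrix_(i, j) \int[leb]_(u in `[s, t]) (P u i j).

Variables (P : R -> 'M[R]_r) (hP : moment_flow P).

Let sub_int (s t : R) : 0 <= s -> `[s, t]%classic `<=` `[0, t]%classic.
Proof.
by move=> s0 x; rewrite /= !in_itv/= => /andP[sx ->]; rewrite (le_trans s0 sx).
Qed.

Let intP (s t : R) i j : 0 <= s -> s <= t ->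
  leb.-integrable `[s, t] (EFin \o (fun u => P u i j)).
Proof.
move=> s0 st; have := flow_integrable hP (le_trans s0 st) i j.
by apply: integrableS => //; exact: sub_int.
Qed.

Lemma integrable_tr_flow Y s t : 0 <= s -> s <= t ->
  leb.-integrable `[s, t] (EFin \o (fun u => \tr (Y *m P u))).
Proof.
move=> s0 st; have -> : (fun u => \tr (Y *m P u)) =
    (fun u => \sum_i \sum_j Y i j * P u j i).
  by apply/funext => u; apply: eq_bigr => i _; rewrite mxE.
apply: integrable_sumR => // i; apply: integrable_sumR => // j.
by apply: integrableZlR => //; exact: intP.
Qed.

Lemma tr_mxint Y s t : 0 <= s -> s <= t ->
  \int[leb]_(u in `[s, t]) \tr (Y *m P u) = \tr (Y *m mxint P s t).
Proof.
move=> s0 st; have -> : (fun u => \tr (Y *m P u)) =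
    (fun u => \sum_i \sum_j Y i j * P u j i).
  by apply/funext => u; apply: eq_bigr => i _; rewrite mxE.
have int1 i j : leb.-integrable `[s, t] (EFin \o (fun u => Y i j * P u j i)).
  by apply: integrableZlR => //; exact: intP.
rewrite Rintegral_sum//; last by move=> i; apply: integrable_sumR.
apply: eq_bigr => i _; rewrite Rintegral_sum// mxE; apply: eq_bigr => j _.
by rewrite mxE RintegralZl//; exact: intP.
Qed.

(** By linearity the generator leaves the time integral. The increment is thus the generator at one
    positive semidefinite matrix, to which inequalities on the cone apply directly. *)
Lemma flow_increment s t : 0 <= s -> s <= t ->
  P t - P s = generator K a g (mxint P s t).
Proof.
move=> s0 st; have t0 := le_trans s0 st.
apply/matrixP => i j; rewrite generator_entry -tr_mxint// addmxE oppmxE.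
have -> : (fun u => \tr (generator_adj K a g (delta_mx j i) *m P u)) =
    (fun u => generator K a g (P u) i j).
  by apply/funext => u; rewrite generator_entry.
have int0 : leb.-integrable `[0, t] (EFin \o (fun u => generator K a g (P u) i j)).
  have -> : (fun u => generator K a g (P u) i j) =
      (fun u => \tr (generator_adj K a g (delta_mx j i) *m P u)).
    by apply/funext => u; rewrite generator_entry.
  exact: integrable_tr_flow.
rewrite (flow_eq hP t0) (flow_eq hP s0) opprD addrACA subrr add0r.
rewrite (Rintegral_itvB int0) ?bnd_simp// Rintegral_itv_obnd_cbnd//.
apply: integrableS int0 => // x; rewrite /= !in_itv/= => /andP[/ltW sx ->].
by rewrite (le_trans s0 sx).
Qed.

Lemma psd_mxint s t : 0 <= s -> s <= t -> psd (mxint P s t).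
Proof.
move=> s0 st; split=> [|v].
  apply/matrixP => i j; rewrite !mxE; apply: eq_Rintegral => u.
  rewrite inE/= in_itv/= => /andP[su _].
  by have [e _] := flow_psd hP (le_trans s0 su); rewrite -[in LHS]e mxE.
have -> : (v^T *m mxint P s t *m v) 0 0 = \tr ((v *m v^T) *m mxint P s t).
  by rewrite -mxtrace_mulC mulmxA mxtrace_mulC mulmxA /mxtrace big_ord1.
rewrite -tr_mxint//; apply: Rintegral_ge0 => u; rewrite /= in_itv/= => /andP[su _].
have [_ /(_ v)] := flow_psd hP (le_trans s0 su).
by rewrite -[v *m v^T *m _]mulmxA mxtrace_mulC /mxtrace big_ord1.
Qed.

End Decay.

(** * Exponential decay of moment flows *)

Section Exponential.
Variables (R : realType) (r q : nat) (K : 'M[R]_q) (a : 'M[R]_r).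
Variables (g : 'I_q -> 'M[R]_r) (D : 'M[R]_r) (k1 k2 : R).
Hypothesis k1_gt0 : 0 < k1.
Hypothesis D_lower : forall V, psd V -> k1 * \tr V <= \tr (D *m V).
Hypothesis D_upper : forall V, psd V -> \tr (D *m V) <= k2 * \tr V.
Hypothesis lyapunov : forall V, psd V -> \tr (D *m generator K a g V) <= 0.
Hypothesis no_kernel : forall V, psd V -> generator K a g V = 0 -> V = 0.

Let f (P : R -> 'M[R]_r) t := \tr (D *m P t).

Let f_mono P s t : moment_flow K a g P -> 0 <= s -> s <= t -> f P t <= f P s.
Proof.
move=> hP s0 st; rewrite /f -subr_le0.
have -> : \tr (D *m P t) - \tr (D *m P s) = \tr (D *m (P t - P s)).
  by rewrite mulmxBr raddfB.
by rewrite (flow_increment hP)//; apply: lyapunov; exact: (psd_mxint hP).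
Qed.

Let f_ge0 P t : moment_flow K a g P -> 0 <= t -> 0 <= f P t.
Proof.
move=> hP t0; have pP := flow_psd hP t0; apply: le_trans (D_lower pP).
by apply: mulr_ge0; [exact: ltW|exact: psd_trace_ge0].
Qed.

(* The time average of the flow over a long window is nearly in the kernel of
   the generator, hence small by coercivity; it dominates the value at the end
   of the window. *)
Let halving : exists2 T : R, 0 < T & forall P, moment_flow K a g P ->
  forall s, 0 <= s -> f P (s + T) <= f P s / 2.
Proof.
have [e e0 coer] := generator_coercive no_kernel.
(* Let [V] be the integral of the flow over the window. The trace of [V] is at most [e^-1] times the
   entries of the increment, of which there are [r * r], each at most [2 / k1 * f P s]; with
   [D_upper] this gives [T * f P (s + T) <= c * f P s]. The length [2 * c + 1] makes the ratio at
   most 1/2. *)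
pose c := `|k2| / e * (2 * (r * r)%:R / k1); have c0 : 0 <= c.
  by rewrite mulr_ge0// ?mulr_ge0// ?invr_ge0// ltW.
exists (2 * c + 1) => [|P hP s s0]; first by lra.
set T := 2 * c + 1; have T0 : 0 < T by rewrite /T; lra.
have sT : s <= s + T by rewrite lerDl ltW.
set V := mxint P s (s + T); have pV : psd V by exact: (psd_mxint hP).
have lo : T * f P (s + T) <= \tr (D *m V).
  rewrite -(tr_mxint hP)//.
  have -> : T * f P (s + T) = \int[lebesgue_measure]_(u in `[s, s + T]) f P (s + T).
    rewrite Rintegral_cst//= lebesgue_measure_itv/= lte_fin ltrDl T0.
    by rewrite -EFinB/= addrAC subrr add0r mulrC.
  apply: le_Rintegral => //=.
  - exact: integrable_cst_itv.
  - exact: (integrable_tr_flow hP).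
  - by move=> u; rewrite /= in_itv/= => /andP[su uT]; apply: f_mono => //; exact: le_trans su.
have trb t : 0 <= t -> s <= t -> \tr (P t) <= k1^-1 * f P s.
  move=> t0 st; rewrite ler_pdivlMl//; apply: le_trans (D_lower (flow_psd hP t0)) _.
  exact: f_mono.
have gb : \sum_i \sum_j `|generator K a g V i j| <= (r * r)%:R * (2 / k1 * f P s).
  apply: (@le_trans _ _ (\sum_(i < r) \sum_(j < r) (2 / k1 * f P s))); last first.
    by rewrite !sumr_const !card_ord -mulrnA [leRHS]mulr_natl.
  apply: ler_sum => i _; apply: ler_sum => j _.
  rewrite -(flow_increment hP)// addmxE oppmxE.
  have sT0 := le_trans s0 sT.
  have b1 := le_trans (psd_entry_le i j (flow_psd hP sT0)) (trb _ sT0 sT).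
  have b2 := le_trans (psd_entry_le i j (flow_psd hP s0)) (trb _ s0 (lexx s)).
  apply: le_trans (ler_normB _ _) _.
  have -> : 2 / k1 * f P s = k1^-1 * f P s + k1^-1 * f P s by ring.
  exact: lerD.
have fs := f_ge0 hP s0.
have : T * f P (s + T) <= c * f P s.
  apply: le_trans lo _; apply: le_trans (D_upper pV) _.
  have trV : \tr V <= e^-1 * ((r * r)%:R * (2 / k1 * f P s)).
    by rewrite ler_pdivlMl//; apply: le_trans (coer _ pV) gb.
  apply: (@le_trans _ _ (`|k2| * \tr V)).
    by rewrite ler_wpM2r ?ler_norm// psd_trace_ge0.
  apply: le_trans (ler_wpM2l _ trV) _ => //.
  by rewrite le_eqVlt; apply/orP; left; apply/eqP; rewrite /c; ring.
move=> h; have h2 : (2 * c + 1) * (2 * f P (s + T)) <= (2 * c + 1) * f P s.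
  by move: h; rewrite /T; nra.
by rewrite ler_pdivlMr// mulrC; rewrite ler_pM2l in h2.
Qed.

Lemma flow_decay : exists M c : R, [/\ 1 <= M, 0 < c &
  forall P, moment_flow K a g P -> forall t, 0 <= t ->
    \tr (P t) <= M * expR (- c * t) * \tr (P 0)].
Proof.
have [T T0 half] := halving.
(* The 2 pays for rounding [t / T] down to an integer, [|k2| / k1] for passing from the trace to [f]
   and back; the summand 1 only secures [1 <= M]. *)
exists (1 + 2 * `|k2| / k1), (ln 2 / T); split.
- by rewrite lerDl divr_ge0 ?mulr_ge0// ltW.
- by rewrite divr_gt0// ln_gt0// ltr1n.
move=> P hP t t0.
have iter n : f P (n%:R * T) <= (2^-1) ^+ n * f P 0.
  elim: n => [|n IH]; first by rewrite mul0r expr0 mul1r.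
  have nT : 0 <= n%:R * T by rewrite mulr_ge0// ltW.
  rewrite -natr1 mulrDl mul1r exprS -mulrA.
  by have := half _ hP _ nT; lra.
pose n := Num.truncn (t / T).
have tT0 : 0 <= t / T by rewrite divr_ge0// ltW.
have /andP[n1 n2] := truncn_itv tT0.
have nt : n%:R * T <= t by rewrite -ler_pdivlMr.
have nT : 0 <= n%:R * T by rewrite mulr_ge0// ltW.
have ft := le_trans (f_mono hP nT nt) (iter n).
have hexp : (2^-1) ^+ n <= 2 * expR (- (ln 2 / T) * t).
  have : expR (- (ln 2 * n.+1%:R)) <= expR (- (ln 2 / T) * t).
    rewrite ler_expR mulNr lerN2 -mulrA [T^-1 * t]mulrC ler_wpM2l//; last exact: ltW.
    by rewrite ln_ge0// ler1n.
  rewrite expRN mulrC expRM_natl lnK ?posrE// exprS invfM exprVn; lra.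
have P0 := flow_psd hP (lexx 0); have Pt := flow_psd hP t0.
have lo := D_lower Pt; have up := D_upper P0.
have trP0 := psd_trace_ge0 P0.
have up' : f P 0 <= `|k2| * \tr (P 0).
  by apply: le_trans up _; rewrite ler_wpM2r// ler_norm.
have f0 := f_ge0 hP (lexx 0).
set E := expR _ in hexp *; have E0 : 0 <= E by exact: expR_ge0.
have h1 : k1 * \tr (P t) <= 2 * E * (`|k2| * \tr (P 0)).
  apply: le_trans lo _; apply: le_trans ft _; exact: ler_pM.
have h2 : \tr (P t) <= k1^-1 * (2 * E * (`|k2| * \tr (P 0))) by rewrite ler_pdivlMl.
apply: le_trans h2 _.
have -> : k1^-1 * (2 * E * (`|k2| * \tr (P 0))) = (2 * `|k2| / k1) * (E * \tr (P 0)).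
  by ring.
by rewrite -[leRHS]mulrA [leRHS]mulrDl mul1r lerDr mulr_ge0.
Qed.

End Exponential.

(** On a window of length [h] with [c * h <= 1/2] that starts at a zero of [f], each use of the
    inequality halves the bound, so [f] vanishes there; windows are then chained. The first bound is
    [c] times the integral over the window, because [f] is not assumed bounded. *)
Lemma gronwall_eq0 (R : realType) (f : R -> R) (c : R) : 0 <= c ->
  (forall t, 0 <= t -> 0 <= f t) -> f 0 = 0 ->
  (forall s t, 0 <= s -> s <= t ->
    (@lebesgue_measure R).-integrable `[s, t] (EFin \o f)) ->
  (forall s t, 0 <= s -> s <= t ->
    f t - f s <= c * \int[lebesgue_measure]_(u in `[s, t]) f u) ->
  forall t, 0 <= t -> f t = 0.
Proof.
move=> c0 f0 fz intf incr.
pose h := (2 * c + 1)^-1; have h0 : 0 < h by rewrite invr_gt0; lra.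
have ch : c * h <= 2^-1.
  by rewrite /h ler_pdivrMr; lra.
have step s : 0 <= s -> f s = 0 -> forall t, s <= t -> t <= s + h -> f t = 0.
  move=> s0 fs; pose B := c * \int[lebesgue_measure]_(u in `[s, s + h]) f u.
  have bound n : forall t, s <= t -> t <= s + h -> f t <= 2^-1 ^+ n * B.
    elim: n => [|n IH] t st th.
      rewrite expr0 mul1r; have := incr _ _ s0 st; rewrite fs subr0 => /le_trans; apply.
      rewrite ler_wpM2l// /Rintegral fine_le//.
      - by apply: integrable_fin_num => //; exact: intf.
      - by apply: integrable_fin_num => //; apply: intf => //; rewrite lerDl ltW.
      apply: ge0_subset_integral => //.
      - apply: (measurable_int (@lebesgue_measure R)).
        by apply: intf => //; rewrite lerDl ltW.
      - move=> u; rewrite /= in_itv/= => /andP[su _]; rewrite lee_fin f0//.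
        exact: le_trans su.
      - by move=> u; rewrite /= !in_itv/= => /andP[-> /le_trans]; apply.
    have := incr _ _ s0 st; rewrite fs subr0 => /le_trans; apply.
    apply: (@le_trans _ _ (c * (2^-1 ^+ n * B * (t - s)))).
      rewrite ler_wpM2l//.
      have -> : 2^-1 ^+ n * B * (t - s) =
          \int[lebesgue_measure]_(u in `[s, t]) (2^-1 ^+ n * B).
        rewrite Rintegral_cst//= lebesgue_measure_itv/= lte_fin.
        case: ltP => [_|ts]; first by rewrite -EFinB.
        by have -> : t = s by [apply/eqP; rewrite eq_le ts st]; rewrite subrr.
      apply: le_Rintegral => //=; [exact: intf|exact: integrable_cst_itv|].
      move=> u; rewrite /= in_itv/= => /andP[su ut]; apply: IH => //.
      exact: le_trans th.
    have B0 : 0 <= B.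
      rewrite mulr_ge0// Rintegral_ge0// => u; rewrite /= in_itv/= => /andP[su _].
      by rewrite f0// (le_trans s0 su).
    rewrite exprS; have : c * (t - s) <= 2^-1.
      by apply: le_trans ch; rewrite ler_wpM2l//; lra.
    have : 0 <= 2^-1 ^+ n * B by rewrite mulr_ge0// exprn_ge0// invr_ge0.
    set y := _ ^+ n; nra.
  move=> t st th; apply/eqP; rewrite eq_le f0 ?(le_trans s0)// andbT.
  have : (fun n => (2^-1 : R) ^+ n * B) @ \oo --> 0 * B.
    by apply: cvgMl; apply: cvg_expr; rewrite ger0_norm ?invr_ge0//; lra.
  rewrite mul0r => lim; have := cvg_lim (@Rhausdorff R) lim => <-.
  by apply: limr_ge => //; [apply/cvg_ex; exists 0|near=> n; exact: bound].
have grid n : f (n%:R * h) = 0.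
  elim: n => [|n IH]; first by rewrite mul0r.
  have nh : 0 <= n%:R * h by rewrite mulr_ge0// ltW.
  apply: (step _ nh IH); rewrite -natr1 mulrDl mul1r// lerDl ltW//.
move=> t t0; pose n := Num.truncn (t / h).
have th0 : 0 <= t / h by rewrite divr_ge0// ltW.
have /andP[n1 n2] := truncn_itv th0.
have nh : 0 <= n%:R * h by rewrite mulr_ge0// ltW.
apply: (step _ nh (grid n)); first by rewrite -ler_pdivlMr.
move/ltW: n2; rewrite ler_pdivrMr// -natr1 mulrDl mul1r; exact.
Unshelve. all: by end_near.
Qed.

(** * Flows started in the range of a stationary covariance *)

Section InvariantSubspace.
Variables (R : realType) (n q c : nat) (K : 'M[R]_q) (A : 'M[R]_n).
Variables (N : 'I_q -> 'M[R]_n) (C : 'M[R]_(c, n)) (U : 'M[R]_n).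
Hypotheses (psdK : psd K) (psdU : psd U) (statU : generator K A N U = 0).
Hypothesis CU : C *m U = 0.

Section Annihilator.
Variable G : 'M[R]_n.
Hypothesis GU : G *m U = 0.
Hypothesis factorG : forall k (Y : 'M[R]_(k, n)), Y *m U = 0 -> exists Y', Y = Y' *m G.

(* The range of a stationary covariance is invariant under the dynamics: its
   annihilator [G] satisfies [G A = A' G] and [G N_l = N'_l G]. *)
Lemma annihilator_flow (P : R -> 'M[R]_n) (x0 y : 'cV[R]_n) :
  moment_flow K A N P -> x0 = U *m y -> P 0 = x0 *m x0^T ->
  forall t, 0 <= t -> \tr ((C^T *m C) *m P t) = 0.
Proof.
move=> hP x0E P0E.
have [M KM] := psd_factor psdK; pose Nm := mixed_noise M N.
have genE V : generator K A N V =
    A *m V + V *m A^T + \sum_l Nm l *m V *m (Nm l)^T.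
  by rewrite /generator KM mixed_noiseE.
have UT : U^T = U by case: psdU.
have UG : U *m G^T = 0 by rewrite -UT -trmx_mul GU trmx0.
(* Conjugating stationarity by [G] kills the drift terms, since [G U = 0] and [U G^T = 0]; a sum of
   nonnegative noise traces is left and must vanish. *)
have GNU l : G *m Nm l *m U = 0.
  have h : \sum_l \tr (U *m ((G *m Nm l)^T *m (G *m Nm l))) = 0.
    have := congr1 (fun Y => \tr (G *m Y *m G^T)) statU.
    rewrite genE mulmx0 mul0mx mxtrace0 !(mulmxDl, mulmxDr).
    have -> : G *m (A *m U) *m G^T = 0 by rewrite -!mulmxA UG !mulmx0.
    have -> : G *m (U *m A^T) *m G^T = 0 by rewrite [G *m _]mulmxA GU !mul0mx.
    rewrite !add0r mulmx_sumr mulmx_suml raddf_sum => e; rewrite -[RHS]e.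
    apply: eq_bigr => l' _ /=.
    rewrite [U *m _]mulmxA [LHS]mxtrace_mulC trmx_mul.
    by rewrite !mulmxA.
  move/eqP: h; rewrite psumr_eq0 => [|k _]; last exact: psd_tr_gram_ge0.
  by move=> /allP/(_ l (mem_index_enum _))/eqP/(psd_tr_gram_eq0 psdU).
(* Now that the noise terms are gone, multiplying by [G] on the left alone leaves only [G A U]. *)
have GAU : G *m A *m U = 0.
  have := congr1 (mulmx G) statU; rewrite genE mulmx0 !mulmxDr.
  have -> : G *m (U *m A^T) = 0 by rewrite mulmxA GU mul0mx.
  rewrite addr0 mulmx_sumr big1 ?addr0 ?mulmxA// => l _.
  by rewrite !mulmxA GNU mul0mx.
have [A' GA] := factorG GAU.
have /choice[N' GN] : forall l, exists N'l, G *m Nm l = N'l *m G.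
  by move=> l; exact: factorG.
have [C' CE] := factorG CU.
(* The factorizations through [G] give [tr (G L(V) G^T) = tr (Y Z)] for the generator [L] and
   [Z = G V G^T]. Entries of [Z] are at most [tr Z], so [b] is a growth rate, and Gronwall applies
   to [tr Z] along the flow, which starts at 0. *)
pose Y := A' + A'^T + \sum_l (N' l)^T *m N' l.
pose b := \sum_i \sum_j `|Y i j|.
have psdG V : psd V -> psd (G *m V *m G^T).
  by move=> pV; rewrite -{1}(trmxK G); apply: psd_congr.
have growth V : psd V ->
    \tr ((G^T *m G) *m generator K A N V) <= b * \tr ((G^T *m G) *m V).
  move=> pV; have pZ := psdG _ pV; set Z := G *m V *m G^T in pZ.
  have trG (V' : 'M[R]_n) : \tr ((G^T *m G) *m V') = \tr (G *m V' *m G^T).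
    by rewrite -mulmxA mxtrace_mulC.
  rewrite !trG -/Z; have -> : \tr (G *m generator K A N V *m G^T) = \tr (Y *m Z).
    rewrite genE /Y !(mulmxDl, mulmxDr) !mxtraceD; congr (_ + _ + _).
    - by rewrite mulmxA GA /Z !mulmxA.
      have -> : G *m (V *m A^T) *m G^T = G *m V *m (G *m A)^T by rewrite trmx_mul !mulmxA.
      by rewrite GA trmx_mul mulmxA mxtrace_mulC.
    - rewrite mulmx_sumr !mulmx_suml !raddf_sum; apply: eq_bigr => l _ /=.
      have -> : G *m (Nm l *m V *m (Nm l)^T) *m G^T = (G *m Nm l) *m V *m (G *m Nm l)^T.
        by rewrite trmx_mul !mulmxA.
      rewrite GN trmx_mul; have -> : N' l *m G *m V *m (G^T *m (N' l)^T) =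
        (N' l *m Z) *m (N' l)^T by rewrite !mulmxA.
      by rewrite mxtrace_mulC mulmxA.
  rewrite /b mulr_suml; apply: ler_sum => i _; rewrite mxE mulr_suml.
  apply: ler_sum => j _; apply: le_trans (ler_norm _) _; rewrite normrM.
  by rewrite ler_wpM2l//; exact: psd_entry_le.
have f0 t : 0 <= t -> 0 <= \tr ((G^T *m G) *m P t).
  move=> t0; rewrite mxtrace_mulC; apply: psd_tr_gram_ge0; exact: (flow_psd hP).
have Z0 : forall t, 0 <= t -> \tr ((G^T *m G) *m P t) = 0.
  apply: (@gronwall_eq0 _ (fun t => \tr ((G^T *m G) *m P t)) b) => //.
  - by apply: sumr_ge0 => i _; apply: sumr_ge0.
  - rewrite P0E x0E -!mulmxA [G *m (U *m _)]mulmxA GU mul0mx mulmx0.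
    exact: mxtrace0.
  - by move=> s t s0 st; exact: (integrable_tr_flow hP).
  move=> s t s0 st; rewrite (tr_mxint hP)//.
  have -> : \tr (G^T *m G *m P t) - \tr (G^T *m G *m P s) =
      \tr (G^T *m G *m (P t - P s)) by rewrite mulmxBr raddfB.
  rewrite (flow_increment hP)//; apply: growth; exact: (psd_mxint hP).
move=> t t0; have GP : G *m P t = 0.
  by apply: psd_tr_gram_eq0; [exact: (flow_psd hP)|rewrite mxtrace_mulC Z0].
by rewrite CE -!mulmxA GP !mulmx0 mxtrace0.
Qed.

End Annihilator.

(** The row kernel of [U] serves as [G]: every matrix that kills [U] from the left factors through
    it. *)
Lemma stationary_range_flow (P : R -> 'M[R]_n) (x0 y : 'cV[R]_n) :
  moment_flow K A N P -> x0 = U *m y -> P 0 = x0 *m x0^T ->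
  forall t, 0 <= t -> \tr ((C^T *m C) *m P t) = 0.
Proof.
apply: (annihilator_flow (mulmx_ker U)) => k Y h.
by apply/submxP; rewrite sub_kermx h.
Qed.

End InvariantSubspace.

(** * Square-integrable functions *)

Section SquareIntegrable.
Context d (T : measurableType d) (R : realType).
Variable mu : {measure set T -> \bar R}.
Implicit Types f g h : T -> R.
Local Notation intR f := (mu.-integrable [set: T] (EFin \o f)).

Definition L2fun f := measurable_fun [set: T] f /\
  (\int[mu]_x ((f x) ^+ 2)%:E < +oo)%E.

Definition ip f g : R := \int[mu]_x (f x * g x).

Lemma L2fun_measurable f : L2fun f -> measurable_fun [set: T] f.
Proof. by case. Qed.

Lemma integrable_le f g : measurable_fun [set: T] f -> intR g ->
  (forall x, `|f x| <= g x) -> intR f.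
Proof.
move=> mf ig fg; apply: le_integrable ig => //=; first exact/measurable_EFinP.
by move=> x _; rewrite lee_fin (le_trans (fg x))// ler_norm.
Qed.

Lemma L2fun_sq f : L2fun f -> intR (fun x => f x ^+ 2).
Proof.
move=> [mf if2]; apply/integrableP; split.
  by apply/measurable_EFinP; exact: measurable_funX.
by under eq_integral do rewrite /= ger0_norm ?sqr_ge0//.
Qed.

Lemma sq_L2fun f : measurable_fun [set: T] f -> intR (fun x => f x ^+ 2) -> L2fun f.
Proof.
move=> mf /integrableP[_ if2]; split=> //.
by move: if2; under eq_integral do rewrite /= ger0_norm ?sqr_ge0//.
Qed.

Lemma intRD f g : intR f -> intR g -> intR (fun x => f x + g x).
Proof. by move=> i1 i2; have := integrableD measurableT i1 i2. Qed.

Lemma intRZ c f : intR f -> intR (fun x => c * f x).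
Proof. exact: integrableZlR. Qed.

Lemma L2fun_mul f g : L2fun f -> L2fun g -> intR (fun x => f x * g x).
Proof.
move=> Lf Lg; apply: (@integrable_le _ (fun x => f x ^+ 2 + g x ^+ 2)).
- by apply: measurable_funM; exact: L2fun_measurable.
- by apply: intRD; exact: L2fun_sq.
move=> x; rewrite normrM -[f x ^+ 2]real_normK ?num_real//.
rewrite -[g x ^+ 2]real_normK ?num_real//.
by have := sqr_ge0 (`|f x| - `|g x|); have := normr_ge0 (f x); have := normr_ge0 (g x); nra.
Qed.

Lemma L2funD f g : L2fun f -> L2fun g -> L2fun (fun x => f x + g x).
Proof.
move=> Lf Lg; apply: sq_L2fun.
  by apply: measurable_funD; exact: L2fun_measurable.
have -> : (fun x => (f x + g x) ^+ 2) =
    (fun x => f x ^+ 2 + g x ^+ 2 + 2 * (f x * g x)).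
  by apply/funext => x; ring.
apply: intRD; first by apply: intRD; exact: L2fun_sq.
by apply: intRZ; exact: L2fun_mul.
Qed.

Lemma L2funZ c f : L2fun f -> L2fun (fun x => c * f x).
Proof.
move=> Lf; apply: sq_L2fun; first by apply: measurable_funM => //; exact: L2fun_measurable.
have -> : (fun x => (c * f x) ^+ 2) = (fun x => c ^+ 2 * f x ^+ 2).
  by apply/funext => x; ring.
by apply: intRZ; exact: L2fun_sq.
Qed.

Lemma L2funB f g : L2fun f -> L2fun g -> L2fun (fun x => f x - g x).
Proof.
move=> Lf Lg; have -> : (fun x => f x - g x) = (fun x => f x + -1 * g x).
  by apply/funext => x; ring.
by apply: L2funD => //; exact: L2funZ.
Qed.

Lemma L2fun0 : L2fun (fun _ => 0).
Proof.
apply: sq_L2fun => //; rewrite expr0n/=; exact: integrable0.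
Qed.

Lemma L2fun_sum I (s : seq I) (F : I -> T -> R) :
  (forall i, L2fun (F i)) -> L2fun (fun x => \sum_(i <- s) F i x).
Proof.
move=> LF; elim: s => [|i s IH].
  by under eq_fun do rewrite big_nil; exact: L2fun0.
by under eq_fun do rewrite big_cons; exact: L2funD.
Qed.

Lemma L2fun_bounded_mul f g c : measurable_fun [set: T] f ->
  (forall x, `|f x| <= c) -> L2fun g -> L2fun (fun x => f x * g x).
Proof.
move=> mf fc Lg; have mg := L2fun_measurable Lg; apply: sq_L2fun.
  exact: measurable_funM.
apply: (@integrable_le _ (fun x => c ^+ 2 * g x ^+ 2)).
- by apply: measurable_funX; exact: measurable_funM.
- by apply: intRZ; exact: L2fun_sq.
move=> x; rewrite normrX normrM exprMn [X in _ * X]real_normK ?num_real// ler_wpM2r ?sqr_ge0//.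
by rewrite lerXn2r ?nnegrE// (le_trans _ (fc x)).
Qed.

Lemma ipC f g : ip f g = ip g f.
Proof. by apply: eq_Rintegral => x _; rewrite mulrC. Qed.

Lemma ipDl f g h : L2fun f -> L2fun g -> L2fun h ->
  ip (fun x => f x + g x) h = ip f h + ip g h.
Proof.
move=> Lf Lg Lh; rewrite /ip -RintegralD//; [|exact: L2fun_mul..].
by apply: eq_Rintegral => x _; rewrite mulrDl.
Qed.

Lemma ipBl f g h : L2fun f -> L2fun g -> L2fun h ->
  ip (fun x => f x - g x) h = ip f h - ip g h.
Proof.
move=> Lf Lg Lh; rewrite /ip -RintegralB//; [|exact: L2fun_mul..].
by apply: eq_Rintegral => x _; rewrite mulrBl.
Qed.

Lemma ipZl c f h : L2fun f -> L2fun h -> ip (fun x => c * f x) h = c * ip f h.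
Proof.
move=> Lf Lh; rewrite /ip -RintegralZl//; last exact: L2fun_mul.
by apply: eq_Rintegral => x _; rewrite mulrA.
Qed.

Lemma ip_sqB f g : L2fun f -> L2fun g ->
  ip (fun x => f x - g x) (fun x => f x - g x) = ip f f - 2 * ip f g + ip g g.
Proof.
move=> Lf Lg; have Lfg := L2funB Lf Lg.
rewrite ipBl//; have e h : L2fun h -> ip h (fun x => f x - g x) = ip h f - ip h g.
  by move=> Lh; rewrite ipC ipBl// ![ip _ h]ipC.
by rewrite !e// [ip g f]ipC; ring.
Qed.

Lemma ip_suml I (s : seq I) (F : I -> T -> R) h :
  (forall i, L2fun (F i)) -> L2fun h ->
  ip (fun x => \sum_(i <- s) F i x) h = \sum_(i <- s) ip (F i) h.
Proof.
move=> LF Lh; rewrite /ip -Rintegral_sum//; last by move=> i; exact: L2fun_mul.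
by apply: eq_Rintegral => x _; rewrite mulr_suml.
Qed.

Lemma ip_ge0 f : 0 <= ip f f.
Proof. by apply: Rintegral_ge0 => x _; rewrite -expr2 sqr_ge0. Qed.

(** Weighted Young inequality: integrate [e * (f - c * e^-1 * g)^2 >= 0] with [c] equal to 1 or -1
    according to the sign of the inner product. *)
Lemma ip_am_gm f g e : 0 < e -> L2fun f -> L2fun g ->
  2 * `|ip f g| <= e * ip f f + e^-1 * ip g g.
Proof.
move=> e0 Lf Lg.
have iff := L2fun_mul Lf Lf; have igg := L2fun_mul Lg Lg.
have ifg := L2fun_mul Lf Lg.
have key (c : R) : c ^+ 2 = 1 -> 2 * c * ip f g <= e * ip f f + e^-1 * ip g g.
  move=> c2; rewrite /ip -!RintegralZl// -RintegralD//; [|exact: intRZ..].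
  apply: le_Rintegral => //; [exact: intRZ| by apply: intRD; exact: intRZ|].
  move=> x _.
  have -> : e * (f x * f x) + e^-1 * (g x * g x) =
      2 * c * (f x * g x) + e * (f x - c * e^-1 * g x) ^+ 2.
    have -> : e * (f x - c * e^-1 * g x) ^+ 2 =
      e * (f x * f x) - 2 * c * (f x * g x) + c ^+ 2 * (e^-1 * (g x * g x)).
      by field; rewrite gt_eqF.
    rewrite c2; ring.
  by rewrite lerDl mulr_ge0 ?sqr_ge0// ltW.
have [s0|s0] := leP 0 (ip f g).
  by rewrite ger0_norm//; have := key 1; rewrite expr1n => /(_ erefl); lra.
by rewrite ltr0_norm//; have := key (-1); rewrite sqrrN expr1n => /(_ erefl); lra.
Qed.

Lemma ip_cauchy_schwarz f g : L2fun f -> L2fun g -> ip f g ^+ 2 <= ip f f * ip g g.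
Proof.
move=> Lf Lg; have h e e0 := @ip_am_gm f g e e0 Lf Lg.
set c := `|ip f g| in h; have c0 : 0 <= c by exact: normr_ge0.
rewrite -real_normK ?num_real// -/c.
have a0 := ip_ge0 f; have b0 := ip_ge0 g.
set a := ip f f in h a0 *; set b := ip g g in h b0 *.
have [->|cn0] := eqVneq c 0; first by rewrite expr0n mulr_ge0.
have {}c0 : 0 < c by rewrite lt0r cn0.
have [az|an0] := eqVneq a 0.
  (* When [a = 0] this weight would give [2 * c <= c * b / (b + 1) <= c], impossible for [c > 0].
     Otherwise the weight [c / a] balances the two sides. *)
  have e0 : 0 < (b + 1) / c by rewrite divr_gt0//; lra.
  have := h _ e0; rewrite az mulr0 add0r invf_div => h2.
  have : c / (b + 1) * b <= c by rewrite mulrAC ler_pdivrMr ?ler_pM2l; lra.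
  by move=> h3; exfalso; lra.
have e0 : 0 < c / a by rewrite divr_gt0// lt0r an0.
have := h _ e0; rewrite -mulrA mulVf// mulr1 invfM invrK.
have -> : c^-1 * a * b = (a * b) / c by ring.
move=> h2; have : c <= a * b / c by lra.
by rewrite ler_pdivlMr.
Qed.

Lemma integral_sq f : L2fun f -> (\int[mu]_x ((f x) ^+ 2)%:E = (ip f f)%:E)%E.
Proof.
move=> Lf; rewrite /ip /Rintegral fineK; first by apply: eq_integral => x _; rewrite expr2.
by apply: integrable_fin_num => //; exact: L2fun_mul.
Qed.

(** Kept with extended-real integrals to match the limits in [is_ito]. *)
Definition L2cvg (F : nat -> T -> R) f :=
  (fun k => \int[mu]_x ((f x - F k x) ^+ 2)%:E)%E @ \oo --> 0%E.

(** Convergence to 0 in the extended reals makes some distance finite, and then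
    [f = (f - F k) + F k] is a sum of two square-integrable functions. *)
Lemma L2cvg_L2fun F f : measurable_fun [set: T] f -> (forall k, L2fun (F k)) ->
  L2cvg F f -> L2fun f.
Proof.
move=> mf LF /fine_cvgP[[k _ /(_ k (leqnn k)) hk] _].
have -> : f = (fun x => (f x - F k x) + F k x) by apply/funext => x; rewrite subrK.
apply: L2funD => //; split; last by rewrite ltey_eq hk.
by apply: measurable_funB => //; exact: L2fun_measurable.
Qed.

Lemma L2cvg_ip F f : L2fun f -> (forall k, L2fun (F k)) -> L2cvg F f ->
  (fun k => ip (fun x => f x - F k x) (fun x => f x - F k x)) @ \oo --> (0 : R).
Proof.
move=> Lf LF; rewrite /L2cvg; have -> : (fun k => \int[mu]_x ((f x - F k x) ^+ 2)%:E)%E =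
    EFin \o (fun k => ip (fun x => f x - F k x) (fun x => f x - F k x)).
  by apply/funext => k; rewrite /= integral_sq//; exact: L2funB.
by move=> /fine_cvgP[].
Qed.

Lemma ip_L2cvg F f : L2fun f -> (forall k, L2fun (F k)) ->
  (fun k => ip (fun x => f x - F k x) (fun x => f x - F k x)) @ \oo --> (0 : R) ->
  L2cvg F f.
Proof.
move=> Lf LF h; rewrite /L2cvg; have -> : (fun k => \int[mu]_x ((f x - F k x) ^+ 2)%:E)%E =
    EFin \o (fun k => ip (fun x => f x - F k x) (fun x => f x - F k x)).
  by apply/funext => k; rewrite /= integral_sq//; exact: L2funB.
by apply: cvg_EFin => //; near=> k.
Unshelve. all: by end_near.
Qed.

Lemma ip_continuous F f G g : L2fun f -> (forall k, L2fun (F k)) -> L2cvg F f ->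
  L2fun g -> (forall k, L2fun (G k)) -> L2cvg G g ->
  (fun k => ip (F k) (G k)) @ \oo --> ip f g.
Proof.
move=> Lf LF cF Lg LG cG.
have hF := L2cvg_ip Lf LF cF; have hG := L2cvg_ip Lg LG cG.
pose u k := fun x => f x - F k x; pose v k := fun x => g x - G k x.
have Lu k : L2fun (u k) by exact: L2funB.
have Lv k : L2fun (v k) by exact: L2funB.
have expand k : ip (F k) (G k) = ip f g - ip (u k) g - ip f (v k) + ip (u k) (v k).
  have e1 : ip (u k) g = ip f g - ip (F k) g by exact: ipBl.
  have e2 : ip f (v k) = ip f g - ip f (G k) by rewrite ipC ipBl// ![ip _ f]ipC.
  have e3 : ip (u k) (v k) = ip f (v k) - ip (F k) (v k) by exact: ipBl.
  have e4 : ip (F k) (v k) = ip (F k) g - ip (F k) (G k).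
    by rewrite ipC ipBl// ![ip _ (F k)]ipC.
  by rewrite e3 e1 e2 e4; ring.
apply/cvgrPdist_le => e e0.
pose c := ip f f + ip g g + 1.
have c0 : 0 < c by rewrite /c; have := ip_ge0 f; have := ip_ge0 g; lra.
(* The weight [d'] limits the contribution of the fixed norms of [f] and [g] to [e / 2]; the
   threshold [o] then makes the three error terms small even after division by [d']. *)
pose d' := e / (2 * c); have d0 : 0 < d' by rewrite divr_gt0// mulr_gt0.
pose o := Num.min (d' * (e / 8)) (e / 8).
have o0 : 0 < o by rewrite lt_min mulr_gt0// divr_gt0.
have nG := @cvgr0_norm_le _ _ _ _ _ _ hG _ o0.
have nF := @cvgr0_norm_le _ _ _ _ _ _ hF _ o0.
near=> k; rewrite expand.
have hu : ip (u k) (u k) <= o by apply: le_trans (ler_norm _) _; near: k; exact: nF.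
have hv : ip (v k) (v k) <= o by apply: le_trans (ler_norm _) _; near: k; exact: nG.
move: hu hv; rewrite !le_min => /andP[u1 u2] /andP[v1 v2].
have b1 := ip_am_gm d0 Lg (Lu k); have b2 := ip_am_gm d0 Lf (Lv k).
have b3 := ip_am_gm ltr01 (Lu k) (Lv k).
rewrite ipC in b1.
have dinv (z : R) : d'^-1 * (d' * z) = z by rewrite mulrA mulVf ?mul1r// gt_eqF.
have t1 : d'^-1 * ip (u k) (u k) <= e / 8.
  by rewrite -[leRHS]dinv ler_wpM2l// invr_ge0 ltW.
have t2 : d'^-1 * ip (v k) (v k) <= e / 8.
  by rewrite -[leRHS]dinv ler_wpM2l// invr_ge0 ltW.
have t3 : d' * ip f f + d' * ip g g <= e / 2.
  have -> : e / 2 = d' * c by rewrite /d'; field; rewrite gt_eqF.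
  by rewrite -mulrDr ler_wpM2l ?ltW// /c ltrDl.
rewrite invr1 !mul1r in b3.
have -> : ip f g - (ip f g - ip (u k) g - ip f (v k) + ip (u k) (v k)) =
   ip (u k) g + (ip f (v k) + - ip (u k) (v k)) by ring.
have := ler_normD (ip (u k) g) (ip f (v k) + - ip (u k) (v k)).
have := ler_normD (ip f (v k)) (- ip (u k) (v k)); rewrite normrN.
lra.
Unshelve. all: by end_near.
Qed.

Lemma L2cvg_cst f : L2fun f -> L2cvg (fun _ => f) f.
Proof.
move=> Lf; rewrite /L2cvg; under eq_fun do under eq_integral do
  rewrite subrr expr0n/=.
by rewrite integral0; exact: cvg_cst.
Qed.

End SquareIntegrable.

(** * Independence and Wiener increments *)

Section Tensor.
Context d1 d2 (T1 : measurableType d1) (T2 : measurableType d2) (R : realType).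
Variables (m1 : {sigma_finite_measure set T1 -> \bar R}).
Variables (m2 : {sigma_finite_measure set T2 -> \bar R}).

Lemma integral_tensor (u : T1 -> R) (v : T2 -> R) :
  m1.-integrable [set: T1] (EFin \o u) -> m2.-integrable [set: T2] (EFin \o v) ->
  (m1 \x m2)%E.-integrable [set: T1 * T2] (EFin \o (fun p => u p.1 * v p.2)) /\
  \int[(m1 \x m2)%E]_p (u p.1 * v p.2) = \int[m1]_x u x * \int[m2]_y v y.
Proof.
move=> iu iv.
have mu : measurable_fun [set: T1] u by exact/measurable_EFinP/(measurable_int m1).
have mv : measurable_fun [set: T2] v by exact/measurable_EFinP/(measurable_int m2).
have mf : measurable_fun [set: T1 * T2] (EFin \o (fun p => u p.1 * v p.2)).
  by apply/measurable_EFinP; apply: measurable_funM; apply: measurableT_comp.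
have if12 : (m1 \x m2)%E.-integrable [set: T1 * T2] (EFin \o (fun p => u p.1 * v p.2)).
  apply/integrable12ltyP => //=.
  have e x : (\int[m2]_y `|(u x * v y)%:E| = `|(u x)%:E| * \int[m2]_y `|(v y)%:E|)%E.
    rewrite -ge0_integralZl//; last by apply: measurableT_comp => //; exact/measurable_EFinP.
    by apply: eq_integral => y _; rewrite EFinM abseM.
  under eq_integral do rewrite e.
  rewrite ge0_integralZr//; last 2 first.
    by apply: measurableT_comp => //; exact/measurable_EFinP.
    exact: integral_ge0.
  have [_ u1] := integrableP _ _ _ iu; have [_ v1] := integrableP _ _ _ iv.
  by rewrite lte_mul_pinfty ?integral_ge0// ge0_fin_numE// integral_ge0.
split=> //; rewrite /Rintegral -fineM; [|exact: integrable_fin_num..].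
congr fine; rewrite -integral12_prod_meas1// /fubini_F/=.
have e x : (\int[m2]_y (u x * v y)%:E = (u x)%:E * \int[m2]_y (v y)%:E)%E.
  by rewrite -integralZl//; apply: eq_integral => y _; rewrite EFinM.
under eq_integral do rewrite e.
rewrite -(fineK (integrable_fin_num measurableT iv)).
by rewrite integralZr.
Qed.

End Tensor.

Section Independent.
Context d (Omega : measurableType d) (R : realType) (Pr : probability Omega R).

(** Independence on rectangles identifies the joint law with the product of the two laws, by
    uniqueness of the product measure; Fubini does the rest. *)
Lemma expectation_indep_mfun (X Y : {mfun Omega >-> R}) :
  (forall A B, measurable A -> measurable B ->
    Pr (X @^-1` A `&` Y @^-1` B) = (Pr (X @^-1` A) * Pr (Y @^-1` B))%E) ->
  Pr.-integrable [set: Omega] (EFin \o X) ->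
  Pr.-integrable [set: Omega] (EFin \o Y) ->
  Pr.-integrable [set: Omega] (EFin \o (fun w => X w * Y w)) /\
  \int[Pr]_w (X w * Y w) = \int[Pr]_w X w * \int[Pr]_w Y w.
Proof.
move=> ind iX iY.
pose m1 := distribution Pr X; pose m2 := distribution Pr Y.
pose z (w : Omega) : R * R := (X w, Y w).
have mz : measurable_fun [set: Omega] z by exact: measurable_fun_pair.
pose Z : {mfun Omega >-> (R * R)%type} :=
  MeasurableFun.Pack (MeasurableFun.Class (isMeasurableFun.Build _ _ _ _ _ mz)).
pose mZ := distribution Pr Z.
have eqm A : measurable A -> (m1 \x m2)%E A = mZ A.
  apply: product_measure_unique => A1 B1 mA1 mB1.
  by rewrite /mZ /m1 /m2 /distribution /pushforward/= -ind.
have im (V : {mfun Omega >-> R}) : Pr.-integrable [set: Omega] (EFin \o V) ->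
    (distribution Pr V).-integrable [set: R] (EFin \o idfun).
  move=> iV; apply/integrableP; split; first by apply/measurable_EFinP; exact: measurable_id.
  rewrite ge0_integral_distribution//=; last exact: measurableT_comp.
  by case/integrableP: iV.
have [if12 e12] := integral_tensor (im _ iX) (im _ iY).
pose f (p : R * R) : R := p.1 * p.2.
have mf : measurable_fun [set: R * R] (EFin \o f).
  by apply/measurable_EFinP; apply: measurable_funM.
have ifZ : Pr.-integrable [set: Omega] ((EFin \o f) \o Z).
  apply/integrableP; split; first exact: measurableT_comp.
  have <- : (\int[mZ]_p `|(EFin \o f) p| = \int[Pr]_w `|((EFin \o f) \o Z) w|)%E.
    by rewrite ge0_integral_distribution//; exact: measurableT_comp.
  have <- : (\int[m1 \x m2]_p `|(EFin \o f) p| = \int[mZ]_p `|(EFin \o f) p|)%E.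
    by apply: eq_measure_integral => A mA _; exact: eqm.
  by case/integrableP: if12.
split=> //.
have -> : \int[Pr]_w (X w * Y w) = \int[mZ]_p f p.
  rewrite /Rintegral; congr fine; apply/esym.
  exact: (integral_distribution mf ifZ).
have -> : \int[mZ]_p f p = \int[(m1 \x m2)%E]_p (p.1 * p.2).
  rewrite /Rintegral; congr fine.
  by apply: eq_measure_integral => A mA _; exact/esym/eqm.
rewrite e12; congr (_ * _).
- by rewrite /Rintegral; congr fine; apply: (integral_distribution _ iX).
- by rewrite /Rintegral; congr fine; apply: (integral_distribution _ iY).
Qed.

End Independent.

Section MeasurableWrt.
Context d (Omega : measurableType d) (R : realType).
Variables (G : set (set Omega)) (sG : sigma_algebra [set: Omega] G).
Implicit Types X Y : Omega -> R.

(** The sigma-algebra generated by [G] is [G] itself, so closure properties of ordinary measurable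
    functions transfer to [measurable_wrt]. *)
Lemma measurable_wrtP X :
  measurable_wrt G X <-> measurable_fun [set: g_sigma_algebraType G] X.
Proof.
split=> [h _ A mA|h A [B mB <-]].
  rewrite setTI; apply: sub_sigma_algebra; apply: h; exists A => //.
  by rewrite setTI.
have := h measurableT B mB.
by rewrite /measurable /= (sigma_algebra_id sG).
Qed.

Lemma measurable_wrtB X Y : measurable_wrt G X -> measurable_wrt G Y ->
  measurable_wrt G (fun w => X w - Y w).
Proof.
by move=> /measurable_wrtP mX /measurable_wrtP mY; apply/measurable_wrtP/measurable_funB.
Qed.

Lemma measurable_wrtM X Y : measurable_wrt G X -> measurable_wrt G Y ->
  measurable_wrt G (fun w => X w * Y w).
Proof.
by move=> /measurable_wrtP mX /measurable_wrtP mY; apply/measurable_wrtP/measurable_funM.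
Qed.

Lemma measurable_wrt_cst (c : R) : measurable_wrt G (fun _ : Omega => c).
Proof. by apply/measurable_wrtP. Qed.

Lemma measurable_wrt_sum I (s : seq I) (X : I -> Omega -> R) :
  (forall i, measurable_wrt G (X i)) -> measurable_wrt G (fun w => \sum_(i <- s) X i w).
Proof.
move=> mX; apply/measurable_wrtP; apply: measurable_sum => i.
exact/measurable_wrtP.
Qed.

Lemma measurable_wrt_fun X : G `<=` measurable -> measurable_wrt G X ->
  measurable_fun [set: Omega] X.
Proof.
by move=> sub mX _ A mA; rewrite setTI; apply: sub; apply: mX; exists A; rewrite ?setTI.
Qed.

End MeasurableWrt.

Lemma measurable_wrt_sub d (Omega : measurableType d) (R : realType)
    (G H : set (set Omega)) (X : Omega -> R) :
  G `<=` H -> measurable_wrt G X -> measurable_wrt H X.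
Proof. by move=> GH mX A /mX /GH. Qed.

Section Wiener.
Context d (Omega : measurableType d) (R : realType) (Pr : probability Omega R).
Variables (F : R -> set (set Omega)) (hF : usual_filtration Pr F).
Variables (q : nat) (K : 'M[R]_q) (W : R -> Omega -> 'cV[R]_q).
Hypothesis hW : wiener Pr F K W.
Local Notation E X := (\int[Pr]_w X w).
Local Notation intP X := (Pr.-integrable [set: Omega] (EFin \o X)).
Local Notation L2P := (L2fun Pr).

Definition increment (i : 'I_q) (s t : R) (w : Omega) : R := W t w i 0 - W s w i 0.

Let sF t : 0 <= t -> sigma_algebra [set: Omega] (F t).
Proof. exact: (filt_sigma hF). Qed.

Lemma adapted_measurable t (X : Omega -> R) : 0 <= t -> measurable_wrt (F t) X ->
  measurable_fun [set: Omega] X.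
Proof. by move=> t0; apply: measurable_wrt_fun; exact: (filt_measurable hF). Qed.

Lemma adapted_mono s t (X : Omega -> R) : 0 <= s -> s <= t ->
  measurable_wrt (F s) X -> measurable_wrt (F t) X.
Proof. by move=> s0 st; apply: measurable_wrt_sub; exact: (filt_mono hF). Qed.

Lemma wiener_wrt t i : 0 <= t -> measurable_wrt (F t) (fun w => W t w i 0).
Proof. by move=> t0; exact: (wiener_adapted hW). Qed.

Lemma inc_wrt i s t : 0 <= s -> s <= t -> measurable_wrt (F t) (increment i s t).
Proof.
move=> s0 st; apply: measurable_wrtB; first exact/sF/(le_trans s0).
- exact/wiener_wrt/(le_trans s0).
- by apply: (adapted_mono s0 st); exact: wiener_wrt.
Qed.

Lemma wiener_L2 t i : 0 <= t -> L2P (fun w => W t w i 0).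
Proof.
move=> t0; split; first by apply: (adapted_measurable t0); exact: wiener_wrt.
have := wiener_covariance hW t0 i i; rewrite unlock => e.
by under eq_integral do rewrite expr2; rewrite e ltry.
Qed.

Lemma inc_L2 i s t : 0 <= s -> s <= t -> L2P (increment i s t).
Proof. by move=> s0 st; apply: L2funB; apply: wiener_L2 => //; exact: le_trans st. Qed.

Lemma L2_int (X : Omega -> R) : L2P X -> intP X.
Proof.
move=> LX; have L1 : L2P (fun _ => 1).
  apply: sq_L2fun => //; rewrite expr1n.
  exact: finite_measure_integrable_cst.
by have := L2fun_mul LX L1; congr integrable; apply/funext => w /=; rewrite mulr1.
Qed.

Lemma wiener_E t i : 0 <= t -> E (fun w => W t w i 0) = 0.
Proof. by move=> t0; have := wiener_mean hW t0 i; rewrite unlock /Rintegral => ->. Qed.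

Lemma wiener_cov t i j : 0 <= t ->
  ip Pr (fun w => W t w i 0) (fun w => W t w j 0) = K i j * t.
Proof.
by move=> t0; have := wiener_covariance hW t0 i j; rewrite unlock /ip /Rintegral => ->.
Qed.

Lemma wiener_sym i j : K i j = K j i.
Proof. by rewrite -[LHS]mulr1 -[RHS]mulr1 -!wiener_cov// ipC. Qed.

Let preim_g i s t (A : set R) : measurable A ->
  g_sigma_preimage (fun (i : 'I_q) w => W t w i 0 - W s w i 0) (increment i s t @^-1` A).
Proof.
move=> mA; apply: sub_sigma_algebra.
rewrite (bigD1 i)//=; left; exists A => //; by rewrite setTI.
Qed.

(** [Y] may depend on all coordinates of the increment at once, because products of two coordinates
    occur in the isometry. *)
Lemma inc_indep (X Y : Omega -> R) s t : 0 <= s -> s <= t ->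
  measurable_wrt (F s) X -> intP X ->
  measurable_wrt (g_sigma_preimage (fun (i : 'I_q) w => W t w i 0 - W s w i 0)) Y ->
  intP Y -> intP (fun w => X w * Y w) /\ E (fun w => X w * Y w) = E X * E Y.
Proof.
move=> s0 st mX iX mY iY.
have mX' := adapted_measurable s0 mX.
have mY' : measurable_fun [set: Omega] Y by exact/measurable_EFinP/(measurable_int Pr).
pose X' : {mfun Omega >-> R} :=
  MeasurableFun.Pack (MeasurableFun.Class (isMeasurableFun.Build _ _ _ _ _ mX')).
pose Y' : {mfun Omega >-> R} :=
  MeasurableFun.Pack (MeasurableFun.Class (isMeasurableFun.Build _ _ _ _ _ mY')).
apply: (@expectation_indep_mfun _ _ _ _ X' Y') => // A B mA mB.
apply: (wiener_independent hW s0 st).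
  by apply: mX; exists A; rewrite ?setTI.
by apply: mY; exists B; rewrite ?setTI.
Qed.

Lemma inc_g_wrt i s t :
  measurable_wrt (g_sigma_preimage (fun (i : 'I_q) w => W t w i 0 - W s w i 0)) (increment i s t).
Proof. by move=> _ [A mA <-]; rewrite setTI; exact: preim_g. Qed.

Lemma inc_E i s t : 0 <= s -> s <= t -> E (increment i s t) = 0.
Proof.
move=> s0 st; have t0 := le_trans s0 st.
rewrite /increment RintegralB//; [|exact/L2_int/wiener_L2..].
by rewrite !wiener_E// subrr.
Qed.

Lemma E_mul_inc (X : Omega -> R) i s t : 0 <= s -> s <= t ->
  measurable_wrt (F s) X -> intP X -> E (fun w => X w * increment i s t w) = 0.
Proof.
move=> s0 st mX iX.
have [|_ ->] := inc_indep s0 st mX iX (@inc_g_wrt i s t); first exact/L2_int/inc_L2.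
by rewrite inc_E// mulr0.
Qed.

(** Reduced to covariances at a single time: the increment is orthogonal to [F s], so the mean of
    [W_k(s) W_l(t)] is [K k l * s]. *)
Lemma inc_cov i j s t : 0 <= s -> s <= t ->
  E (fun w => increment i s t w * increment j s t w) = K i j * (t - s).
Proof.
move=> s0 st; have t0 := le_trans s0 st.
have Lt k := wiener_L2 k t0; have Ls k := wiener_L2 k s0.
have cross k l : ip Pr (fun w => W s w k 0) (fun w => W t w l 0) = K k l * s.
  have e : (fun w => W t w l 0) = (fun w => increment l s t w + W s w l 0).
    by apply/funext => w; rewrite /increment subrK.
  rewrite e ipC ipDl//; last exact: inc_L2.
  rewrite [ip _ (increment _ _ _) _]ipC {1}/ip E_mul_inc//; last exact/L2_int.
    by rewrite add0r ipC wiener_cov.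
  exact: wiener_wrt.
have iL k : L2P (increment k s t) by exact: inc_L2.
have e1 : ip Pr (increment i s t) (increment j s t) =
    ip Pr (fun w => W t w i 0) (increment j s t) - ip Pr (fun w => W s w i 0) (increment j s t).
  exact: ipBl.
have e2 Z : L2P Z -> ip Pr Z (increment j s t) =
    ip Pr Z (fun w => W t w j 0) - ip Pr Z (fun w => W s w j 0).
  by move=> LZ; rewrite ipC ipBl// ![ip _ Z _]ipC.
rewrite -[LHS]/(ip Pr _ _) e1 !e2// cross !wiener_cov// [ip _ _ (fun w => W s w j 0)]ipC cross.
by rewrite (wiener_sym j i); ring.
Qed.

End Wiener.

(** * Isometry for products of increments *)

Section Overlap.
Variable R : realType.
Implicit Types a b c d t : R.
Local Notation leb := (@lebesgue_measure R).

(** Length of the intersection of []a, b]] and []c, d]], zero when they are disjoint. *)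
Definition overlap a b c d : R := Num.max 0 (Num.min b d - Num.max a c).

Lemma overlapC a b c d : overlap a b c d = overlap c d a b.
Proof. by rewrite /overlap [Num.min b d]minC [Num.max a c]maxC. Qed.

Lemma indic_itvI a b c d (u : R) :
  \1_(`]a, b]%classic) u * \1_(`]c, d]%classic) u =
  \1_(`]Num.max a c, Num.min b d]%classic) u :> R.
Proof.
have -> : `]Num.max a c, Num.min b d]%classic = `]a, b]%classic `&` `]c, d]%classic.
  apply/seteqP; split=> v; rewrite /= !in_itv/= gt_max le_min.
    by move=> /andP[/andP[-> ->] /andP[-> ->]].
  by move=> [/andP[-> ->] /andP[-> ->]].
by rewrite indicI.
Qed.

Lemma integral_indic_oc a b :
  \int[leb]_u (\1_(`]a, b]%classic) u) = Num.max 0 (b - a) :> R.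
Proof.
rewrite /Rintegral integral_indic//= setIT lebesgue_measure_itv/= lte_fin.
case: ltP => ab; first by rewrite -EFinB/= max_r// subr_ge0 ltW.
by rewrite max_l// subr_le0.
Qed.

Lemma integrable_indic_oc a b :
  leb.-integrable [set: R] (EFin \o \1_(`]a, b]%classic)).
Proof. exact: integrable_indic_itv. Qed.

Lemma integral_overlap a b c d :
  \int[leb]_u (\1_(`]a, b]%classic) u * \1_(`]c, d]%classic) u) = overlap a b c d.
Proof.
by under eq_Rintegral do rewrite indic_itvI; rewrite integral_indic_oc.
Qed.

End Overlap.

Section SimpleIsometry.
Context d (Omega : measurableType d) (R : realType) (Pr : probability Omega R).
Variables (F : R -> set (set Omega)) (hF : usual_filtration Pr F).
Variables (q : nat) (K : 'M[R]_q) (W : R -> Omega -> 'cV[R]_q).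
Hypothesis hW : wiener Pr F K W.
Local Notation E X := (\int[Pr]_w X w).
Local Notation intP X := (Pr.-integrable [set: Omega] (EFin \o X)).
Local Notation L2P := (L2fun Pr).
Local Notation inc := (increment W).

Let sF t : 0 <= t -> sigma_algebra [set: Omega] (F t).
Proof. exact: (filt_sigma hF). Qed.

Definition bounded_wrt t (X : Omega -> R) :=
  measurable_wrt (F t) X /\ exists M : R, forall w, `|X w| <= M.

Lemma bounded_wrtM s (X Y : Omega -> R) : 0 <= s -> bounded_wrt s X -> bounded_wrt s Y ->
  bounded_wrt s (fun w => X w * Y w).
Proof.
move=> s0 [mX [M bX]] [mY [L bY]]; split; first by apply: measurable_wrtM => //; exact: sF.
by exists (M * L) => w; rewrite normrM ler_pM.
Qed.

Lemma bounded_wrt_mono s t (X : Omega -> R) : 0 <= s -> s <= t ->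
  bounded_wrt s X -> bounded_wrt t X.
Proof. by move=> s0 st [mX bX]; split=> //; exact: (adapted_mono hF s0 st). Qed.

Lemma bounded_wrt_L2 s (X : Omega -> R) : 0 <= s -> bounded_wrt s X -> L2P X.
Proof.
move=> s0 [mX [M bX]]; have mX' := adapted_measurable hF s0 mX.
have L1 : L2P (fun _ => 1).
  apply: sq_L2fun => //; rewrite expr1n; exact: finite_measure_integrable_cst.
by have := L2fun_bounded_mul mX' bX L1; congr L2fun; apply/funext => w; rewrite mulr1.
Qed.

Lemma bounded_inc_L2 (X : Omega -> R) s i a b : 0 <= s -> 0 <= a -> a <= b ->
  bounded_wrt s X -> L2P (fun w => X w * inc i a b w).
Proof.
move=> s0 a0 ab [mX [M bX]]; apply: L2fun_bounded_mul bX _.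
  exact: (adapted_measurable hF s0 mX).
exact: (inc_L2 hF hW).
Qed.

Lemma ip_inc0 (X : Omega -> R) i s t : 0 <= s -> s <= t ->
  measurable_wrt (F s) X -> L2P X -> ip Pr X (inc i s t) = 0.
Proof. by move=> s0 st mX LX; apply: (E_mul_inc hF hW i s0 st mX); exact: L2_int. Qed.

Lemma bounded_inc_wrt (X : Omega -> R) s i a b : 0 <= s -> 0 <= a -> a <= b -> s <= b ->
  bounded_wrt s X -> measurable_wrt (F b) (fun w => X w * inc i a b w).
Proof.
move=> s0 a0 ab sb [mX _]; apply: measurable_wrtM; first exact/sF/(le_trans s0).
  exact: (adapted_mono hF s0 sb).
exact: (inc_wrt hF hW).
Qed.

Lemma inc_split i a b c w : inc i a c w = inc i a b w + inc i b c w.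
Proof. by rewrite /increment; ring. Qed.

Lemma ip_inc_common (X : Omega -> R) i j c b : 0 <= c -> c <= b ->
  bounded_wrt c X ->
  ip Pr (fun w => X w * inc i c b w) (inc j c b) = K i j * (b - c) * E X.
Proof.
move=> c0 cb [mX [M bX]]; have LX := bounded_wrt_L2 c0 (conj mX (ex_intro _ M bX)).
have Lb : L2P (inc i c b) by exact: (inc_L2 hF hW).
have Lb' : L2P (inc j c b) by exact: (inc_L2 hF hW).
rewrite -(inc_cov hF hW i j c0 cb) /ip mulrC.
have -> : (fun w => X w * inc i c b w * inc j c b w) =
    (fun w => X w * (inc i c b w * inc j c b w)) by apply/funext => w; rewrite mulrA.
have := inc_indep hF hW c0 cb mX (L2_int LX) _ (L2fun_mul Lb Lb').
case=> //; apply: measurable_wrtM; [exact: smallest_sigma_algebra| |];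
  exact: inc_g_wrt.
Qed.

Lemma ip_inc_start (X : Omega -> R) i j c b e : 0 <= c -> c <= b -> c <= e ->
  bounded_wrt c X ->
  ip Pr (fun w => X w * inc i c b w) (inc j c e) = K i j * (Num.min b e - c) * E X.
Proof.
move=> c0 cb ce bX; have [mX _] := bX; have LX := bounded_wrt_L2 c0 bX.
have [be|/ltW eb] := leP b e.
- rewrite (funext (inc_split j c b e)) ipC.
  have b0 := le_trans c0 cb.
  rewrite ipDl; [|exact: (inc_L2 hF hW)|exact: (inc_L2 hF hW)|exact: (bounded_inc_L2 _ c0)].
  rewrite ipC ip_inc_common// [X in _ + X]ipC ip_inc0 ?addr0//.
    exact: (bounded_inc_wrt c0).
  exact: (bounded_inc_L2 _ c0).
- have e0 := le_trans c0 ce.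
  have -> : (fun w => X w * inc i c b w) =
      (fun w => X w * inc i c e w + X w * inc i e b w).
    by apply/funext => w; rewrite (inc_split i c e b) mulrDr.
  rewrite ipDl; [|exact: (bounded_inc_L2 _ c0)|exact: (bounded_inc_L2 _ c0)|
    exact: (inc_L2 hF hW)].
  rewrite ip_inc_common//.
  have -> : ip Pr (fun w => X w * inc i e b w) (inc j c e) =
      ip Pr (fun w => X w * inc j c e w) (inc i e b).
    by apply: eq_Rintegral => w _; ring.
  rewrite ip_inc0 ?addr0//; first exact: (bounded_inc_wrt c0).
  exact: (bounded_inc_L2 _ c0).
Qed.

(** Split the increment over []a, b]] at [c]: the part before [c] is orthogonal to the increment
    over []c, e]], and the part after starts together with it. *)
Let ip_inc_le (X Y : Omega -> R) i j a b c e : 0 <= a -> a <= b -> a <= c -> c <= e ->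
  bounded_wrt a X -> bounded_wrt c Y ->
  ip Pr (fun w => X w * inc i a b w) (fun w => Y w * inc j c e w) =
  K i j * overlap a b c e * E (fun w => X w * Y w).
Proof.
move=> a0 ab ac ce bX bY; have c0 := le_trans a0 ac; have b0 := le_trans a0 ab.
have LY := bounded_wrt_L2 c0 bY.
have bXc := bounded_wrt_mono a0 ac bX.
have comm (Z : Omega -> R) : ip Pr (fun w => X w * Z w) (fun w => Y w * inc j c e w) =
    ip Pr (fun w => Y w * (X w * Z w)) (inc j c e).
  by apply: eq_Rintegral => w _; ring.
have orth x y : 0 <= x -> x <= y -> y <= c ->
    ip Pr (fun w => X w * inc i x y w) (fun w => Y w * inc j c e w) = 0.
  move=> x0 xy yc; have y0 := le_trans x0 xy; rewrite comm ip_inc0//.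
    apply: measurable_wrtM; [exact: sF|by case: bY|].
    apply: measurable_wrtM; [exact: sF|by case: bXc|].
    by apply: (adapted_mono hF y0 yc); exact: (inc_wrt hF hW).
  have [mY [M bYM]] := bY; apply: L2fun_bounded_mul bYM _.
    exact: (adapted_measurable hF c0).
  exact: (bounded_inc_L2 _ a0).
rewrite /overlap (max_r ac).
have [bc|/ltW cb] := leP b c.
  rewrite orth// max_l ?mulr0 ?mul0r// subr_le0.
  by rewrite ge_min bc.
have -> : (fun w => X w * inc i a b w) =
    (fun w => X w * inc i a c w + X w * inc i c b w).
  by apply/funext => w; rewrite (inc_split i a c b) mulrDr.
rewrite ipDl; [|exact: (bounded_inc_L2 _ a0)|exact: (bounded_inc_L2 _ a0)|
  exact: (bounded_inc_L2 _ c0)].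
rewrite orth// add0r comm max_r; last by rewrite subr_ge0 le_min cb.
have -> : (fun w => Y w * (X w * inc i c b w)) = (fun w => (X w * Y w) * inc i c b w).
  by apply/funext => w; ring.
by rewrite ip_inc_start//; exact: bounded_wrtM.
Qed.

Lemma ip_inc_overlap (X Y : Omega -> R) i j a b c e : 0 <= a -> a <= b -> 0 <= c -> c <= e ->
  bounded_wrt a X -> bounded_wrt c Y ->
  ip Pr (fun w => X w * inc i a b w) (fun w => Y w * inc j c e w) =
  K i j * overlap a b c e * E (fun w => X w * Y w).
Proof.
move=> a0 ab c0 ce bX bY; have [ac|/ltW ca] := leP a c; first exact: ip_inc_le.
rewrite ipC ip_inc_le// overlapC (wiener_sym hW); congr (_ * _).
by apply: eq_Rintegral => w _; rewrite mulrC.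
Qed.

End SimpleIsometry.

(** * The Ito isometry *)

Section ItoIsometry.
Context d (Omega : measurableType d) (R : realType) (Pr : probability Omega R).
Variables (F : R -> set (set Omega)) (hF : usual_filtration Pr F).
Variables (q : nat) (K : 'M[R]_q) (W : R -> Omega -> 'cV[R]_q).
Hypothesis hW : wiener Pr F K W.
Local Notation E X := (\int[Pr]_w X w).
Local Notation L2P := (L2fun Pr).
Local Notation inc := (increment W).
Local Notation leb := (@lebesgue_measure R).
Local Notation T2 := (measurableTypeR R * Omega)%type.
Let mu2 : {measure set T2 -> \bar R} := (leb \x Pr)%E.
Let Wi (i : 'I_q) s w : R := W s w i 0.
Implicit Types (phi psi : @simple_process _ Omega R) (f g : R -> Omega -> R).

(** Multiplication by the indicator of [[0, t]] places integrands of every horizon in one [L^2]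
    space over the full product. *)
Definition cut t f (p : T2) : R := \1_(`[0, t]%classic) p.1 * f p.1 p.2.

Lemma ip_tensor (u v : R -> R) (X Y : Omega -> R) :
  leb.-integrable [set: R] (EFin \o (fun s => u s * v s)) -> L2P X -> L2P Y ->
  ip mu2 (fun p => u p.1 * X p.2) (fun p => v p.1 * Y p.2) =
  (\int[leb]_s (u s * v s)) * ip Pr X Y.
Proof.
move=> iuv LX LY; have [_ <-] := integral_tensor iuv (L2fun_mul LX LY).
by apply: eq_Rintegral => p _; ring.
Qed.

Lemma L2_tensor (a b : R) (X : Omega -> R) : L2P X ->
  L2fun mu2 (fun p => \1_(`]a, b]%classic) p.1 * X p.2).
Proof.
move=> LX; apply: sq_L2fun.
  apply: measurable_funM.
    by apply: (measurableT_comp (f := \1_(`]a, b]%classic) : _ -> R)).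
  by apply: measurableT_comp => //; exact: L2fun_measurable LX.
have [+ _] := integral_tensor (integrable_indic_oc a b) (L2fun_sq LX).
congr integrable; apply/funext => p /=; rewrite exprMn; congr (_ * _)%:E.
by rewrite indicE; case: (_ \in _); rewrite ?expr1n ?expr0n.
Qed.

Section Times.
Variables (t : R) (phi : @simple_process _ Omega R).
Hypothesis hphi : simple_on F t phi.

Lemma sp_time_mono k l : (k <= l <= sp_size phi)%N -> sp_time phi k <= sp_time phi l.
Proof.
elim: l => [|l IH]; first by rewrite andbC => /andP[_]; rewrite leqn0 => /eqP ->.
rewrite leq_eqVlt => /andP[/orP[/eqP-> //|kl] ls].
apply: le_trans (simple_mono hphi ls); apply: IH.
by rewrite -ltnS kl ltnW.
Qed.

Lemma sp_time_ge0 k : (k <= sp_size phi)%N -> 0 <= sp_time phi k.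
Proof. by move=> ks; rewrite -(simple_first hphi) sp_time_mono. Qed.

Lemma sp_time_le k : (k <= sp_size phi)%N -> sp_time phi k <= t.
Proof. by move=> ks; rewrite -(simple_last hphi) sp_time_mono// ks leqnn. Qed.

Lemma sp_coef_bounded (k : 'I_(sp_size phi)) :
  bounded_wrt F (sp_time phi k) (sp_coef phi k).
Proof.
split; first exact: (simple_coef hphi).
by have [M hM] := Defs.simple_bounded hphi; exists M => w; exact: hM.
Qed.

Lemma sp_coef_L2 (k : 'I_(sp_size phi)) : L2P (sp_coef phi k).
Proof. exact/(bounded_wrt_L2 hF _ (sp_coef_bounded k))/sp_time_ge0/ltnW. Qed.

Lemma sp_term_L2 i (k : 'I_(sp_size phi)) :
  L2P (fun w => sp_coef phi k w * inc i (sp_time phi k) (sp_time phi k.+1) w).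
Proof.
apply: (bounded_inc_L2 hF hW _ _ _ _ (sp_coef_bounded k)).
- exact/sp_time_ge0/ltnW.
- exact/sp_time_ge0/ltnW.
- exact: (simple_mono hphi).
Qed.

Lemma sp_integral_L2 i : L2P (sp_integral (Wi i) phi).
Proof. by apply: L2fun_sum => k; exact: sp_term_L2. Qed.

Lemma cut_spE p : cut t (sp_eval phi) p =
  \sum_(k < sp_size phi)
    \1_(`]sp_time phi k, sp_time phi k.+1]%classic) p.1 * sp_coef phi k p.2.
Proof.
rewrite /cut /sp_eval mulr_sumr; apply: eq_bigr => k _.
rewrite [X in _ * X]mulrC mulrA; congr (_ * _).
have -> : `]sp_time phi k, sp_time phi k.+1]%classic =
    `[0, t]%classic `&` `]sp_time phi k, sp_time phi k.+1]%classic.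
  rewrite setIidr// => u; rewrite /= !in_itv/= => /andP[ku uk]; apply/andP; split.
    exact: le_trans (sp_time_ge0 (ltnW (ltn_ord k))) (ltW ku).
  exact: le_trans uk (sp_time_le (ltn_ord k)).
rewrite indicI/= mulrA; congr (_ * _).
by rewrite indicE; case: (_ \in _); rewrite ?mulr0 ?mulr1.
Qed.

Lemma cut_sp_L2 : L2fun mu2 (cut t (sp_eval phi)).
Proof.
have -> : cut t (sp_eval phi) = (fun p => \sum_(k < sp_size phi)
    \1_(`]sp_time phi k, sp_time phi k.+1]%classic) p.1 * sp_coef phi k p.2).
  by apply/funext => p; exact: cut_spE.
by apply: L2fun_sum => k; apply: L2_tensor; exact: sp_coef_L2.
Qed.

End Times.

(** Both sides are double sums over the two partitions and agree term by term, since the time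
    integral of a product of two indicators is the [overlap]. *)
Lemma simple_isometry t phi psi i j : simple_on F t phi -> simple_on F t psi ->
  ip Pr (sp_integral (Wi i) phi) (sp_integral (Wi j) psi) =
  K i j * ip mu2 (cut t (sp_eval phi)) (cut t (sp_eval psi)).
Proof.
move=> h1 h2.
have -> : ip Pr (sp_integral (Wi i) phi) (sp_integral (Wi j) psi) =
    \sum_(k < sp_size phi) \sum_(l < sp_size psi)
      K i j * overlap (sp_time phi k) (sp_time phi k.+1) (sp_time psi l) (sp_time psi l.+1)
      * E (fun w => sp_coef phi k w * sp_coef psi l w).
  rewrite /sp_integral (ip_suml _ (sp_term_L2 h1 i) (sp_integral_L2 h2 j)).
  apply: eq_bigr => k _; rewrite ipC.
  rewrite (ip_suml _ (sp_term_L2 h2 j) (sp_term_L2 h1 i k)).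
  apply: eq_bigr => l _; rewrite ipC.
  apply: (ip_inc_overlap hF hW).
  - exact/(sp_time_ge0 h1)/ltnW.
  - exact: (simple_mono h1).
  - exact/(sp_time_ge0 h2)/ltnW.
  - exact: (simple_mono h2).
  - exact: (sp_coef_bounded h1).
  - exact: (sp_coef_bounded h2).
have tL1 (k : 'I_(sp_size phi)) := L2_tensor (sp_time phi k) (sp_time phi k.+1) (sp_coef_L2 h1 k).
have tL2 (k : 'I_(sp_size psi)) := L2_tensor (sp_time psi k) (sp_time psi k.+1) (sp_coef_L2 h2 k).
rewrite (funext (cut_spE h1)) (ip_suml _ tL1 (cut_sp_L2 h2)) mulr_sumr.
apply: eq_bigr => k _; rewrite ipC (funext (cut_spE h2)) (ip_suml _ tL2 (tL1 k)) mulr_sumr.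
apply: eq_bigr => l _; rewrite ipC ip_tensor; last 2 first.
- exact: (sp_coef_L2 h1).
- exact: (sp_coef_L2 h2).
- by rewrite integral_overlap mulrA.
- have -> : (fun s : R => \1_(`]sp_time phi k, sp_time phi k.+1]%classic) s *
      \1_(`]sp_time psi l, sp_time psi l.+1]%classic) s) =
      \1_(`]Num.max (sp_time phi k) (sp_time psi l),
            Num.min (sp_time phi k.+1) (sp_time psi l.+1)]%classic) :> (R -> R).
    by apply/funext => s; exact: indic_itvI.
  exact: integrable_indic_oc.
Qed.

Lemma cutB t f g p : cut t f p - cut t g p = cut t (fun s w => f s w - g s w) p.
Proof. by rewrite /cut mulrBr. Qed.

Lemma integral_cut_sq t f : measurable_fun [set: T2] (cut t f) ->
  (\int[Pr]_w \int[leb]_(s in `[0%R, t]) ((f s w) ^+ 2)%:E =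
   \int[mu2]_p ((cut t f p) ^+ 2)%:E)%E.
Proof.
move=> mf; pose G (p : T2) := ((cut t f p) ^+ 2)%:E.
have mG : measurable_fun [set: T2] G.
  by apply/measurable_EFinP; exact: measurable_funX.
have G0 p : (0 <= G p)%E by rewrite lee_fin sqr_ge0.
rewrite -[RHS]/(\int[(leb \x Pr)%E]_p G p)%E.
rewrite [RHS](fubini_tonelli2 (m1 := leb) (m2 := Pr) _ mG G0).
apply: eq_integral => w _; rewrite /fubini_G [LHS]integral_mkcond.
apply: eq_integral => s _; rewrite patchE /G /cut indicE/=.
by case: (s \in _); rewrite ?mul1r// mul0r expr0n.
Qed.

(** Joint measurability of the integrand, which [is_ito] does not contain and Tonelli requires. *)
Definition mcut t f := measurable_fun [set: T2] (cut t f).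

Record ito_approx i t f (J : Omega -> R) (phi : nat -> @simple_process _ Omega R) : Prop := {
  ito_simple : forall k, simple_on F t (phi k);
  ito_cvg_integrand : L2cvg mu2 (fun k => cut t (sp_eval (phi k))) (cut t f);
  ito_cvg_integral : L2cvg Pr (fun k => sp_integral (Wi i) (phi k)) J;
  ito_integrand_L2 : L2fun mu2 (cut t f);
  ito_L2 : L2P J }.

Lemma is_itoP i t f J : is_ito Pr F (Wi i) t f J -> mcut t f ->
  exists phi : nat -> @simple_process _ Omega R, ito_approx i t f J phi.
Proof.
move=> [mJ [phi [sphi c1 c2]]] mf; exists phi.
have cphi k : L2fun mu2 (cut t (sp_eval (phi k))) by exact: cut_sp_L2.
have ek k : (\int[mu2]_p ((cut t f p - cut t (sp_eval (phi k)) p) ^+ 2)%:E =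
    \int[Pr]_w \int[leb]_(s in `[0%R, t]) ((f s w - sp_eval (phi k) s w) ^+ 2)%:E)%E.
  rewrite (integral_cut_sq (f := fun s w => f s w - sp_eval (phi k) s w)).
    by apply: eq_integral => p _; rewrite cutB.
  rewrite -(funext (cutB t f (sp_eval (phi k)))).
  by apply: measurable_funB => //; exact: L2fun_measurable (cphi k).
have c1' : L2cvg mu2 (fun k => cut t (sp_eval (phi k))) (cut t f).
  by rewrite /L2cvg (funext ek).
split=> //.
- exact: L2cvg_L2fun c1'.
- apply: L2cvg_L2fun c2 => // k; exact: (sp_integral_L2 (sphi k)).
Qed.

Lemma ito_isometry i j t f g J J' : is_ito Pr F (Wi i) t f J -> mcut t f ->
  is_ito Pr F (Wi j) t g J' -> mcut t g ->
  ip Pr J J' = K i j * ip mu2 (cut t f) (cut t g).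
Proof.
move=> hf mf hg mg; have [phi [s1 e1 c1 Lf LJ]] := is_itoP hf mf.
have [psi [s2 e2 c2 Lg LJ']] := is_itoP hg mg.
have l1 := ip_continuous LJ (fun k => sp_integral_L2 (s1 k) i) c1
  LJ' (fun k => sp_integral_L2 (s2 k) j) c2.
have l2 := ip_continuous Lf (fun k => cut_sp_L2 (s1 k)) e1 Lg (fun k => cut_sp_L2 (s2 k)) e2.
have l3 : (fun k => K i j * ip mu2 (cut t (sp_eval (phi k))) (cut t (sp_eval (psi k)))) @ \oo -->
    K i j * ip mu2 (cut t f) (cut t g) by apply: cvgMr; exact: l2.
have eq : (fun k => ip Pr (sp_integral (Wi i) (phi k)) (sp_integral (Wi j) (psi k))) =
    (fun k => K i j * ip mu2 (cut t (sp_eval (phi k))) (cut t (sp_eval (psi k)))).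
  by apply/funext => k; exact: simple_isometry.
rewrite eq in l1; exact: (cvg_unique _ l1 l3).
Qed.

Lemma is_ito_L2 i t f J : is_ito Pr F (Wi i) t f J -> mcut t f -> L2P J.
Proof. by move=> h mf; have [phi []] := is_itoP h mf. Qed.

Lemma is_ito_integrand_L2 i t f J : is_ito Pr F (Wi i) t f J -> mcut t f ->
  L2fun mu2 (cut t f).
Proof. by move=> h mf; have [phi []] := is_itoP h mf. Qed.

Lemma is_ito_simple i t phi : simple_on F t phi ->
  is_ito Pr F (Wi i) t (sp_eval phi) (sp_integral (Wi i) phi).
Proof.
move=> sphi; split; first exact: L2fun_measurable (sp_integral_L2 sphi i).
exists (fun _ => phi); split=> //; last exact: (L2cvg_cst (sp_integral_L2 sphi i)).
under eq_fun do under eq_integral do under eq_integral do rewrite subrr expr0n/=.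
under eq_fun do under eq_integral do rewrite integral0.
by rewrite integral0; exact: cvg_cst.
Qed.

(** Expanding the square reduces this to the isometry for three inner products, so linearity of the
    integral is not involved. *)
Lemma ito_dist i t f J phi : is_ito Pr F (Wi i) t f J -> mcut t f -> simple_on F t phi ->
  ip Pr (fun w => J w - sp_integral (Wi i) phi w) (fun w => J w - sp_integral (Wi i) phi w) =
  K i i * ip mu2 (fun p => cut t f p - cut t (sp_eval phi) p)
                 (fun p => cut t f p - cut t (sp_eval phi) p).
Proof.
move=> hf mf sphi; have hp := is_ito_simple i sphi.
have mp : mcut t (sp_eval phi) by exact: L2fun_measurable (cut_sp_L2 sphi).
have LJ := is_ito_L2 hf mf; have LI := is_ito_L2 hp mp.
have Lf := is_ito_integrand_L2 hf mf; have Lp := is_ito_integrand_L2 hp mp.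
rewrite !ip_sqB// (ito_isometry hf mf hf mf).
by rewrite (ito_isometry hf mf hp mp) (ito_isometry hp mp hp mp); ring.
Qed.

(** Partition points after [s] collapse onto [s]. The coefficients attached to them are replaced by
    0, since they need not be measurable at time [s]. *)
Definition sp_stop (s : R) phi : @simple_process _ Omega R :=
  SimpleProcess (sp_size phi) (fun k => Num.min (sp_time phi k) s)
    (fun k w => if sp_time phi k <= s then sp_coef phi k w else 0).

Section Stop.
Variables (s t : R) (phi : @simple_process _ Omega R).
Hypotheses (s0 : 0 <= s) (st : s <= t) (hphi : simple_on F t phi).

Lemma sp_stop_simple : simple_on F s (sp_stop s phi).
Proof.
split=> /=.
- by rewrite (simple_first hphi) min_l.
- by rewrite (simple_last hphi) min_r.
- move=> k ks; have := simple_mono hphi ks.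
  by rewrite le_min !ge_min lexx orbT andbT => ->.
- move=> k ks; have [ts|ts] := leP (sp_time phi k) s.
    exact: (simple_coef hphi).
  by apply: measurable_wrt_cst; exact: (filt_sigma hF).
- have [M hM] := Defs.simple_bounded hphi; exists `|M| => k w ks.
  case: ifP => _; last by rewrite normr0.
  by apply: le_trans (hM _ _ ks) _; exact: ler_norm.
Qed.

Lemma cut_sp_stop p : cut s (sp_eval (sp_stop s phi)) p = cut s (sp_eval phi) p.
Proof.
rewrite /cut indicE; case: (boolP (p.1 \in _)) => [|_]; last by rewrite !mul0r.
rewrite inE/= in_itv/= => /andP[_ ps]; congr (_ * _).
apply: eq_bigr => k _ /=; rewrite !indicE.
have e1 : (p.1 \in `]Num.min (sp_time phi k) s, Num.min (sp_time phi k.+1) s]%classic) =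
   (p.1 \in `]sp_time phi k, sp_time phi k.+1]%classic).
  apply/idP/idP; rewrite !inE/= !in_itv/= gt_min le_min ps andbT => /andP[+ ->].
    by rewrite [s < _]ltNge ps orbF => ->.
  by move=> ->.
rewrite e1; case: (leP (sp_time phi k) s) => // sk.
have -> : (p.1 \in `]sp_time phi k, sp_time phi k.+1]%classic) = false.
  apply/negbTE; rewrite notin_setE/= in_itv/= => /andP[kp _].
  by have := lt_trans sk kp; rewrite ltNge ps.
by rewrite !mulr0.
Qed.

Lemma sp_stop_ip i (X : Omega -> R) : measurable_wrt (F s) X -> L2P X ->
  ip Pr (sp_integral (Wi i) phi) X = ip Pr (sp_integral (Wi i) (sp_stop s phi)) X.
Proof.
move=> mX LX; have hs := sp_stop_simple.
rewrite /sp_integral (ip_suml _ (sp_term_L2 hphi i) LX) (ip_suml _ (sp_term_L2 hs i) LX).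
apply: eq_bigr => k _.
have tk0 := sp_time_ge0 hphi (ltnW (ltn_ord k)).
have tk1 := simple_mono hphi (ltn_ord k).
set a := sp_time phi k in tk0 tk1 *; set b := sp_time phi k.+1 in tk1 *.
have b0 : 0 <= b := le_trans tk0 tk1.
have [mc [M bc]] := sp_coef_bounded hphi k.
have bw := sp_coef_bounded hphi k; rewrite -/a in mc bw.
(* []a', b']] is the part of the interval after [s]; its increment is orthogonal to everything known
   at time [a'], in particular to [X] times the coefficient. *)
pose a' := Num.max a s; pose b' := Num.max b s.
have a'0 : 0 <= a' by rewrite le_max tk0.
have a'b' : a' <= b'.
  by rewrite ge_max; apply/andP; split; rewrite le_max ?tk1 ?lexx ?orbT.
have aa' : a <= a' by rewrite le_max lexx.
have sa' : s <= a' by rewrite le_max lexx orbT.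
have orth : ip Pr (fun w => sp_coef phi k w * inc i a' b' w) X = 0.
  rewrite -[RHS](ip_inc0 hF hW (X := fun w => sp_coef phi k w * X w) i a'0 a'b').
  - by apply: eq_Rintegral => w _; ring.
  - apply: measurable_wrtM; first exact: (filt_sigma hF).
      exact: (adapted_mono hF tk0 aa').
    exact: (adapted_mono hF s0 sa').
  - by apply: L2fun_bounded_mul bc LX; exact: (adapted_measurable hF tk0).
have -> : (fun w => sp_coef phi k w * (Wi i b w - Wi i a w)) =
  (fun w => sp_coef (sp_stop s phi) k w *
      (Wi i (Num.min b s) w - Wi i (Num.min a s) w) + sp_coef phi k w * inc i a' b' w).
  apply/funext => w /=; rewrite -/a /a' /b' /increment /Wi.
  case: (leP a s) => [_|/ltW sa]; first by case: (leP b s) => _; ring.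
  by rewrite (max_l (le_trans sa tk1)); ring.
rewrite ipDl//; first by rewrite orth addr0.
- exact: (sp_term_L2 hs i k).
- exact: (bounded_inc_L2 hF hW _ tk0).
Qed.

End Stop.

(** The martingale property in weak form. The integrals at [s] and [t] come with unrelated
    approximations; but the approximations of [J], stopped at [s], also converge to [J'], because
    the isometry bounds their distance by that of the integrands on [[0, s]], hence on [[0, t]]. *)
Lemma ito_martingale i s t f J J' (X : Omega -> R) : 0 <= s -> s <= t ->
  is_ito Pr F (Wi i) t f J -> mcut t f -> is_ito Pr F (Wi i) s f J' -> mcut s f ->
  measurable_wrt (F s) X -> L2P X -> ip Pr J X = ip Pr J' X.
Proof.
move=> s0 st hf mf hf' mf' mX LX; have [phi [sphi c1 c2 Lf LJ]] := is_itoP hf mf.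
have LJ' := is_ito_L2 hf' mf'; have Lf' := is_ito_integrand_L2 hf' mf'.
have sstop k := sp_stop_simple s0 st (sphi k).
have LI k : L2P (sp_integral (Wi i) (phi k)) by exact: sp_integral_L2.
have LS k : L2P (sp_integral (Wi i) (sp_stop s (phi k))) by exact: sp_integral_L2.
have cX := L2cvg_cst LX; have LX' (k : nat) := LX.
have l1 := ip_continuous LJ LI c2 LX LX' cX.
suff cS : L2cvg Pr (fun k => sp_integral (Wi i) (sp_stop s (phi k))) J'.
  have l2 := ip_continuous LJ' LS cS LX LX' cX.
  have eq : (fun k => ip Pr (sp_integral (Wi i) (phi k)) X) =
      (fun k => ip Pr (sp_integral (Wi i) (sp_stop s (phi k))) X).
    by apply/funext => k; exact: (sp_stop_ip s0 st).
  by rewrite eq in l1; exact: (cvg_unique _ l1 l2).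
have Lc k : L2fun mu2 (cut t (sp_eval (phi k))) by exact: cut_sp_L2.
have zero := L2cvg_ip Lf Lc c1.
apply: ip_L2cvg => //.
have eqk k : ip Pr (fun w => J' w - sp_integral (Wi i) (sp_stop s (phi k)) w)
      (fun w => J' w - sp_integral (Wi i) (sp_stop s (phi k)) w) =
    K i i * ip mu2 (fun p => cut s f p - cut s (sp_eval (phi k)) p)
                   (fun p => cut s f p - cut s (sp_eval (phi k)) p).
  rewrite (ito_dist hf' mf' (sstop k)); congr (_ * _).
  by apply: eq_Rintegral => p _; rewrite cut_sp_stop.
rewrite (funext eqk).
rewrite -[0](mulr0 (K i i)); apply: cvgMr.
apply: (squeeze_cvgr _ (cvg_cst 0) zero); near=> k; rewrite ip_ge0/=.
have Ld : L2fun mu2 (fun p => cut s f p - cut s (sp_eval (phi k)) p).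
  have := cut_sp_L2 (sstop k); rewrite (funext (cut_sp_stop s (phi k))).
  exact: L2funB.
have Ld' : L2fun mu2 (fun p => cut t f p - cut t (sp_eval (phi k)) p) by exact: L2funB.
apply: le_Rintegral => //; [exact: L2fun_mul|exact: L2fun_mul|].
move=> p _; rewrite !cutB -!expr2 /cut !exprMn ler_wpM2r ?sqr_ge0//.
rewrite !indicE; case: (boolP (p.1 \in _)) => [ps|_]; last by rewrite expr0n sqr_ge0.
have -> // : p.1 \in `[0, t]%classic.
move: ps; rewrite !inE/= !in_itv/= => /andP[-> ps].
exact: le_trans st.
Unshelve. all: by end_near.
Qed.

End ItoIsometry.

(** * Drift integrals *)

Section RintegralFubini.
Context d1 d2 (T1 : measurableType d1) (T2 : measurableType d2) (R : realType).
Variables (m1 : {sigma_finite_measure set T1 -> \bar R}).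
Variables (m2 : {sigma_finite_measure set T2 -> \bar R}).

(** Inner Fubini integrals may be infinite on a null set, where [fine] returns 0; this does not
    change the outer integral. *)
Lemma Rintegral_fine d (T : measurableType d) (m : {measure set T -> \bar R})
    (G : T -> \bar R) : m.-integrable [set: T] G ->
  m.-integrable [set: T] (EFin \o (fine \o G)) /\
  fine (\int[m]_x G x)%E = \int[m]_x fine (G x).
Proof.
move=> iG; have mG := measurable_int m iG.
have mf : measurable_fun [set: T] (EFin \o (fine \o G)).
  by apply/measurable_EFinP; exact: measurableT_comp.
have ae : {ae m, forall x, [set: T] x -> G x = (EFin \o (fine \o G)) x}.
  by apply: filterS (integrable_ae measurableT iG) => x h xT /=; rewrite fineK// h.
split; last by rewrite /Rintegral; congr fine; exact: ae_eq_integral.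
apply/integrableP; split=> //; have [_] := integrableP _ _ _ iG.
apply: le_lt_trans; rewrite le_eqVlt; apply/orP; left; apply/eqP/esym.
apply: ae_eq_integral => //; [exact: measurableT_comp|exact: measurableT_comp|].
by apply: filterS ae => x h xT; rewrite (h xT).
Qed.

Variable f : T1 * T2 -> R.
Hypothesis intf : (m1 \x m2)%E.-integrable [set: T1 * T2] (EFin \o f).

Lemma Rfubini12 :
  m1.-integrable [set: T1] (EFin \o (fun x => \int[m2]_y f (x, y))) /\
  \int[(m1 \x m2)%E]_p f p = \int[m1]_x \int[m2]_y f (x, y).
Proof.
have iF := integrable_fubini_F intf; have [i1 e1] := Rintegral_fine iF.
by split=> //; rewrite {1}/Rintegral -(integral12_prod_meas1 intf) e1.
Qed.

Lemma Rfubini21 :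
  m2.-integrable [set: T2] (EFin \o (fun y => \int[m1]_x f (x, y))) /\
  \int[(m1 \x m2)%E]_p f p = \int[m2]_y \int[m1]_x f (x, y).
Proof.
have iG : m2.-integrable [set: T2] (fubini_G m1 (EFin \o f)).
  have mf := measurable_int _ intf; apply/integrableP; split.
    exact: (measurable_fubini_G intf).
  apply: le_lt_trans (_ : (\int[m2]_y \int[m1]_x `|(EFin \o f) (x, y)| < +oo)%E).
    apply: ge0_le_integral => //.
    - by apply: measurableT_comp => //; exact: (measurable_fubini_G intf).
    - apply: (@measurable_fun_fubini_tonelli_G _ _ _ _ _ m1 (abse \o (EFin \o f))).
        exact: measurableT_comp.
      by move=> y; exact: abse_ge0.
    - move=> y _; apply: le_abse_integral => //.
      by apply: (measurableT_comp mf); exact: measurable_pair2.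
  exact/(integrable21ltyP _ _ mf).
have [i1 e1] := Rintegral_fine iG.
by split=> //; rewrite {1}/Rintegral -(integral21_prod_meas1 intf) e1.
Qed.

End RintegralFubini.

Section ParameterIntegral.
Context d1 d2 (T1 : measurableType d1) (T2 : measurableType d2) (R : realType).
Variable m2 : {sigma_finite_measure set T2 -> \bar R}.

(** Integrability is not assumed: positive and negative parts are integrated by Tonelli, and [fine]
    of the difference is measurable in any case. *)
Lemma measurable_Rintegral (k : T1 * T2 -> R) : measurable_fun [set: T1 * T2] k ->
  measurable_fun [set: T1] (fun x => \int[m2]_y k (x, y)).
Proof.
move=> mk; apply: measurableT_comp => //.
have -> : (fun x => \int[m2]_y (k (x, y))%:E)%E =
   (fun x => \int[m2]_y ((EFin \o k)^\+ (x, y)) - \int[m2]_y ((EFin \o k)^\- (x, y)))%E.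
  by apply/funext => x; rewrite integralE; congr (_ - _)%E; apply: eq_integral => y _; rewrite unlock.
have mk' : measurable_fun [set: T1 * T2] (EFin \o k) by exact/measurable_EFinP.
apply: emeasurable_funB.
- suff : measurable_fun [set: T1] (fubini_F m2 ((EFin \o k)^\+)%E) by [].
  by apply: measurable_fun_fubini_tonelli_F => //; exact: measurable_funepos.
- suff : measurable_fun [set: T1] (fubini_F m2 ((EFin \o k)^\-)%E) by [].
  by apply: measurable_fun_fubini_tonelli_F => //; exact: measurable_funeneg.
Qed.

End ParameterIntegral.

Section Triangle.
Variable R : realType.
Local Notation leb := (@lebesgue_measure R).

(* Splitting the square along its diagonal. *)
Lemma integral_triangle (f g : R -> R) :
  leb.-integrable [set: R] (EFin \o f) -> leb.-integrable [set: R] (EFin \o g) ->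
  (\int[leb]_s f s) * (\int[leb]_u g u) =
  \int[leb]_s (f s * \int[leb]_(u in `]-oo, s]) g u) +
  \int[leb]_u (g u * \int[leb]_(s in `]-oo, u]) f s).
Proof.
move=> intf intg; have [itens <-] := integral_tensor intf intg.
pose low (p : measurableTypeR R * measurableTypeR R) : R := \1_(`[0, +oo[%classic) (p.1 - p.2).
have mlow : measurable_fun [set: measurableTypeR R * measurableTypeR R] low.
  apply: (measurableT_comp (f := \1_(`[0, +oo[%classic) : R -> R)) => //.
  exact: measurable_funB.
have mt : measurable_fun [set: measurableTypeR R * measurableTypeR R] (fun p => f p.1 * g p.2).
  by apply/measurable_EFinP; exact: (measurable_int _ itens).
have weighted (c : measurableTypeR R * measurableTypeR R -> R) :
    measurable_fun [set: _] c -> (forall p, 0 <= c p <= 1) ->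
    (leb \x leb)%E.-integrable [set: _] (EFin \o (fun p => c p * (f p.1 * g p.2))).
  move=> mc c01; apply: (le_integrable _ _ _ itens) => //.
    by apply/measurable_EFinP; exact: measurable_funM.
  move=> p _ /=; rewrite lee_fin normrM ler_piMl//.
  by have /andP[c0 c1] := c01 p; rewrite ger0_norm.
have low01 p : 0 <= low p <= 1.
  by rewrite /low indicE; case: (_ \in _); rewrite /= ?ler01 ?lexx.
have i1 := weighted low mlow low01.
have i2 : (leb \x leb)%E.-integrable [set: _]
    (EFin \o (fun p => (1 - low p) * (f p.1 * g p.2))).
  apply: weighted; first exact: measurable_funB.
  by move=> p; have /andP[? ?] := low01 p; apply/andP; split; lra.
have -> : \int[(leb \x leb)%E]_p (f p.1 * g p.2) =
    \int[(leb \x leb)%E]_p (low p * (f p.1 * g p.2)) +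
    \int[(leb \x leb)%E]_p ((1 - low p) * (f p.1 * g p.2)).
  by rewrite -RintegralD//; apply: eq_Rintegral => p _; ring.
have part (h : R -> R) (D : set R) (c : R) : measurable D ->
    leb.-integrable [set: R] (EFin \o h) ->
    \int[leb]_u (\1_D u * (c * h u)) = c * \int[leb]_(u in D) h u.
  move=> mD ih; rewrite -RintegralZl//; last exact: integrableS ih.
  rewrite [RHS]Rintegral_mkcond; apply: eq_Rintegral => u _.
  by rewrite patchE indicE; case: (_ \in _); rewrite ?mul1r ?mul0r.
have [_ ->] := Rfubini12 i1; have [_ ->] := Rfubini21 i2; congr (_ + _).
- apply: eq_Rintegral => s _; rewrite -part//.
  apply: eq_Rintegral => u _; congr (_ * _).
  by rewrite /low !indicE !mem_setE !in_itv/= andbT subr_ge0.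
- apply: eq_Rintegral => u _.
  (* The complement of [low] is the strict region [s < u]; adding the endpoint does not change the
     integral. *)
  rewrite -(Rintegral_itv_bndo_bndc (a := -oo%O)); last exact: integrableS intf.
  rewrite -part//; apply: eq_Rintegral => s _.
  rewrite [f s * g u]mulrC; congr (_ * _).
  rewrite /low !indicE !mem_setE !in_itv/= andbT subr_ge0.
  by case: leP => _; rewrite ?subrr ?subr0.
Qed.

End Triangle.

(** * Time integrals of square-integrable processes *)

Section Drift.
Context d (Omega : measurableType d) (R : realType) (Pr : probability Omega R).
Local Notation L2P := (L2fun Pr).
Local Notation leb := (@lebesgue_measure R).
Local Notation T2 := (measurableTypeR R * Omega)%type.
Let mu2 : {measure set T2 -> \bar R} := (leb \x Pr)%E.
Implicit Types f g h : R -> Omega -> R.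

Definition proc_L2 t f := L2fun mu2 (cut t f).
Definition ip2 t f g : R := ip mu2 (cut t f) (cut t g).
Definition drift g (s : R) (w : Omega) : R := \int[leb]_(u in `[0, s]) g u w.

Lemma cut_in t f s w : 0 <= s -> s <= t -> cut t f (s, w) = f s w.
Proof.
move=> s0 st; rewrite /cut indicE/= mem_set ?mul1r//.
by rewrite /= in_itv/= s0.
Qed.

Lemma cut_out t f s w : ~~ (0 <= s <= t) -> cut t f (s, w) = 0.
Proof.
move=> st; rewrite /cut indicE/= memNset ?mul0r//.
by rewrite /= in_itv/=; apply/negP.
Qed.

Lemma cut_fun_itv t f w : (fun s => cut t f (s, w)) = (f ^~ w) \_ `[0, t].
Proof.
apply/funext => s; rewrite patchE /cut indicE/=.
by case: (_ \in _); rewrite ?mul1r ?mul0r.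
Qed.

Lemma Rintegral_cut t f w :
  \int[leb]_s cut t f (s, w) = \int[leb]_(s in `[0, t]) f s w.
Proof. by rewrite [RHS]Rintegral_mkcond -cut_fun_itv. Qed.

Lemma measurable_section (F : T2 -> R) w : measurable_fun [set: T2] F ->
  measurable_fun [set: measurableTypeR R] (fun s => F (s, w)).
Proof. by move=> mF; apply: (measurableT_comp mF); exact: measurable_pair2. Qed.

Lemma measurable_section1 (F : T2 -> R) (s : R) : measurable_fun [set: T2] F ->
  measurable_fun [set: Omega] (fun w => F (s, w)).
Proof. by move=> mF; apply: (measurableT_comp mF); exact: measurable_pair1. Qed.

Lemma measurable_indic_fst (D : set R) : measurable D ->
  measurable_fun [set: T2] (fun p : T2 => \1_D p.1 : R).
Proof. by move=> mD; apply: (measurableT_comp (f := \1_D : R -> R)). Qed.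

Lemma proc_L2_cst t (X : Omega -> R) : L2P X -> proc_L2 t (fun _ => X).
Proof.
move=> LX; apply: sq_L2fun.
  apply: measurable_funM; first exact: measurable_indic_fst.
  by apply: measurableT_comp => //; exact: L2fun_measurable LX.
have ii : leb.-integrable [set: R] (EFin \o \1_(`[0, t]%classic)).
  exact: integrable_indic_itv.
have [+ _] := integral_tensor ii (L2fun_sq LX).
congr integrable; apply/funext => p /=; rewrite /cut exprMn; congr (_ * _)%:E.
by rewrite indicE; case: (_ \in _); rewrite ?expr1n ?expr0n.
Qed.

Lemma drift_cut t g s w : 0 <= s -> s <= t ->
  drift g s w = \int[leb]_(u in `[0, s]) cut t g (u, w).
Proof.
move=> s0 st; apply: eq_Rintegral => u; rewrite inE/= in_itv/= => /andP[u0 us].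
by rewrite cut_in// (le_trans us).
Qed.

Section Fixed.
Variables (t : R) (t0 : 0 <= t) (g : R -> Omega -> R) (Lg : proc_L2 t g).
Let mg : measurable_fun [set: T2] (cut t g). Proof. by case: Lg. Qed.

(** The variable upper limit is moved into the integrand as the indicator of [u <= s], leaving a
    parameter integral over the whole line. *)
Lemma measurable_cut_drift : measurable_fun [set: T2] (cut t (drift g)).
Proof.
pose k (z : T2 * measurableTypeR R) : R :=
  \1_(`[0, +oo[%classic) (z.1.1 - z.2) * cut t g (z.2, z.1.2).
have mk : measurable_fun [set: T2 * measurableTypeR R] k.
  apply: measurable_funM.
    apply: (measurableT_comp (f := \1_(`[0, +oo[%classic) : R -> R)) => //.
    apply: measurable_funB => //; exact: (measurableT_comp measurable_fst).
  apply: (measurableT_comp mg); apply: measurable_fun_pair => //.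
  exact: (measurableT_comp measurable_snd).
have -> : cut t (drift g) =
    (fun p => \1_(`[0, t]%classic) p.1 * \int[leb]_u k (p, u)).
  apply/funext => -[s w]; rewrite /cut/= indicE.
  case: (boolP (s \in _)) => [|_]; last by rewrite !mul0r.
  rewrite inE/= in_itv/= => /andP[s0 st]; congr (_ * _).
  rewrite (drift_cut _ _ s0 st) Rintegral_mkcond; apply: eq_Rintegral => u _.
  rewrite patchE /k/= indicE !mem_setE !in_itv/= andbT subr_ge0.
  have [us|su] := leP u s; last by rewrite andbF mul0r.
  rewrite mul1r andbT; case: ifPn => // u0.
  by rewrite [RHS]cut_out// negb_and u0.
apply: measurable_funM; first exact: measurable_indic_fst.
exact: measurable_Rintegral.
Qed.

(** The bound uses [t + 1] instead of [t] so that it stays infinite where [energy] is infinite: at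
    [t = 0] the product [0 * +oo] would be 0. *)
Let t1 : 0 < t + 1. Proof. exact: ltr_wpDl. Qed.

Let energy w : \bar R := (\int[leb]_s ((cut t g (s, w)) ^+ 2)%:E)%E.

Let energy_ge0 w : (0 <= energy w)%E.
Proof. by apply: integral_ge0 => s _; rewrite lee_fin sqr_ge0. Qed.

Let mG : measurable_fun [set: T2] (fun p => ((cut t g p) ^+ 2)%:E).
Proof. by apply/measurable_EFinP; exact: measurable_funX. Qed.

Let measurable_energy : measurable_fun [set: Omega] energy.
Proof.
suff : measurable_fun [set: Omega] (fubini_G leb (fun p => ((cut t g p) ^+ 2)%:E)) by [].
by apply: measurable_fun_fubini_tonelli_G => // p; rewrite lee_fin sqr_ge0.
Qed.

Let energy_fin : (\int[Pr]_w energy w < +oo)%E.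
Proof.
have [_] := Lg; apply: le_lt_trans; rewrite le_eqVlt; apply/orP; left; apply/eqP/esym.
rewrite -[LHS]/(\int[(leb \x Pr)%E]_p (((cut t g p) ^+ 2)%:E))%E.
rewrite (fubini_tonelli2 (m1 := leb) (m2 := Pr) _ mG)//.
by move=> p; rewrite lee_fin sqr_ge0.
Qed.

Let drift_sq s w : 0 <= s -> s <= t ->
  (((drift g s w) ^+ 2)%:E <= (t + 1)%:E * energy w)%E.
Proof.
move=> s0 st; have ms := measurable_section w mg.
have [fin|] := ltP (energy w) +oo%E; last first.
  by rewrite leye_eq => /eqP ->; rewrite gt0_muley ?leey// lte_fin.
have Ls : L2fun leb (fun u => cut t g (u, w)) by [].
have L1 : L2fun leb (\1_(`[0, s]%classic) : R -> R).
  apply: sq_L2fun => //; have := @integrable_indic_itv R 0 s true false.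
  congr integrable; apply/funext => u /=.
  by rewrite indicE; case: (_ \in _); rewrite ?expr1n ?expr0n.
have eip : drift g s w = ip leb (\1_(`[0, s]%classic) : R -> R) (fun u => cut t g (u, w)).
  rewrite (drift_cut _ _ s0 st) Rintegral_mkcond; apply: eq_Rintegral => u _.
  by rewrite patchE indicE; case: (_ \in _); rewrite ?mul1r ?mul0r.
rewrite /energy (integral_sq Ls) -EFinM lee_fin eip.
apply: le_trans (ip_cauchy_schwarz L1 Ls) _.
rewrite ler_wpM2r ?ip_ge0//.
have -> : ip leb (\1_(`[0, s]%classic) : R -> R) (\1_(`[0, s]%classic) : R -> R) =
    \int[leb]_u \1_(`[0, s]%classic) u.
  apply: eq_Rintegral => u _.
  by rewrite indicE; case: (_ \in _); rewrite ?mul1r ?mul0r.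
rewrite /Rintegral integral_indic//= setIT lebesgue_measure_itv/= lte_fin.
by case: ifP => _ /=; lra.
Qed.

Lemma drift_L2 : L2P (drift g t).
Proof.
split.
  have := measurable_section1 t measurable_cut_drift.
  by congr measurable_fun; apply/funext => w; rewrite cut_in.
apply: (@le_lt_trans _ _ (\int[Pr]_w ((t + 1)%:E * energy w))%E).
  apply: ge0_le_integral => //.
  - by move=> w _; rewrite lee_fin sqr_ge0.
  - apply/measurable_EFinP; apply: measurable_funX.
    have := measurable_section1 t measurable_cut_drift.
    by congr measurable_fun; apply/funext => w; rewrite cut_in.
  - by apply: emeasurable_funM.
  - by move=> w _; exact: drift_sq.
rewrite ge0_integralZl//; last by rewrite lee_fin ltW.
by rewrite lte_mul_pinfty ?lee_fin// ltW.
Qed.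

Lemma drift_proc_L2 : proc_L2 t (drift g).
Proof.
split; first exact: measurable_cut_drift.
have mD : measurable_fun [set: T2] (fun p => ((cut t (drift g) p) ^+ 2)%:E).
  by apply/measurable_EFinP; apply: measurable_funX; exact: measurable_cut_drift.
rewrite -[X in (X < _)%E]/(\int[(leb \x Pr)%E]_p (((cut t (drift g) p) ^+ 2)%:E))%E.
rewrite (fubini_tonelli2 (m1 := leb) (m2 := Pr) _ mD); last first.
  by move=> p; rewrite lee_fin sqr_ge0.
apply: (@le_lt_trans _ _ (\int[Pr]_w (((t + 1) * t)%:E * energy w))%E).
  apply: ge0_le_integral => //.
  - by move=> w _; apply: integral_ge0 => s _; rewrite lee_fin sqr_ge0.
  - apply: (measurable_fun_fubini_tonelli_G (m1 := leb) _ mD) => p.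
    by rewrite lee_fin sqr_ge0.
  - by apply: emeasurable_funM.
  move=> w _; rewrite /fubini_G.
  apply: (@le_trans _ _ (\int[leb]_(s in `[0%R, t]) ((t + 1)%:E * energy w))%E).
    rewrite [leRHS]integral_mkcond; apply: ge0_le_integral => //.
    - by move=> s _; rewrite lee_fin sqr_ge0.
    - apply/measurable_EFinP; apply: measurable_funX.
      exact: (measurable_section w measurable_cut_drift).
    - by apply/(measurable_restrictT _ _).1.
    - move=> s _; rewrite patchE; case: ifPn => [|].
        by rewrite inE/= in_itv/= => /andP[s0 st]; rewrite cut_in//; exact: drift_sq.
      by rewrite mem_setE in_itv/= => st; rewrite cut_out// expr0n.
  rewrite integral_cst//= lebesgue_measure_itv/= lte_fin.
  case: ltP => [_|t0']; first by rewrite sube0 muleAC -EFinM.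
  by rewrite mule0 mule_ge0// lee_fin mulr_ge0// ltW.
rewrite ge0_integralZl//; last by rewrite lee_fin mulr_ge0// ltW.
by rewrite lte_mul_pinfty ?lee_fin// mulr_ge0// ltW.
Qed.

End Fixed.

Lemma ae_Rintegral (X Y : Omega -> R) :
  measurable_fun [set: Omega] X -> measurable_fun [set: Omega] Y ->
  {ae Pr, forall w, X w = Y w} -> \int[Pr]_w X w = \int[Pr]_w Y w.
Proof.
move=> mX mY XY; rewrite /Rintegral; congr fine; apply: ae_eq_integral => //.
- exact/measurable_EFinP.
- exact/measurable_EFinP.
- by apply: filterS XY => w e _; rewrite e.
Qed.

Lemma ip2_fubini t f h : proc_L2 t f -> proc_L2 t h ->
  leb.-integrable `[0, t] (EFin \o (fun s => ip Pr (f s) (h s))) /\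
  ip2 t f h = \int[leb]_(s in `[0, t]) ip Pr (f s) (h s).
Proof.
move=> Lf Lh; have [i1 e1] := Rfubini12 (m1 := leb) (m2 := Pr) (L2fun_mul Lf Lh).
have inside s : s \in `[0, t]%classic ->
    \int[Pr]_w (cut t f (s, w) * cut t h (s, w)) = ip Pr (f s) (h s).
  rewrite inE/= in_itv/= => /andP[s0 st].
  by apply: eq_Rintegral => w _; rewrite !cut_in.
split.
  have i2 : leb.-integrable `[0, t]
      (EFin \o (fun s => \int[Pr]_w (cut t f (s, w) * cut t h (s, w)))).
    exact: integrableS i1.
  by apply: eq_integrable i2 => // s sI /=; rewrite inside.
rewrite /ip2 /ip -[LHS]/(\int[(leb \x Pr)%E]_p (cut t f p * cut t h p)) e1.
rewrite [RHS]Rintegral_mkcond; apply: eq_Rintegral => s _; rewrite patchE.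
case: ifPn => [/inside //|]; rewrite mem_setE in_itv/= => st.
rewrite /Rintegral; under eq_integral do rewrite cut_out// mul0r.
by rewrite integral0.
Qed.

Let ae_section t f : proc_L2 t f ->
  {ae Pr, forall w, leb.-integrable [set: R] (EFin \o (fun s => cut t f (s, w)))}.
Proof.
move=> Lf; have L1 : L2P (fun _ => 1).
  apply: sq_L2fun => //; rewrite expr1n; exact: finite_measure_integrable_cst.
have i1 := L2fun_mul Lf (proc_L2_cst t L1).
apply: filterS (ae_integrable2 (m1 := leb) (m2 := Pr) i1) => w.
congr integrable; apply/funext => s /=; rewrite /cut/= indicE.
by case: (_ \in _); rewrite ?mulr1 ?mul1r ?mul0r.
Qed.

Lemma ip_drift t g (X : Omega -> R) : 0 <= t -> proc_L2 t g -> L2P X ->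
  ip Pr (drift g t) X = ip2 t g (fun _ => X).
Proof.
move=> t0 Lg LX; have LX' := proc_L2_cst t LX.
have [i1 e1] := Rfubini21 (m1 := leb) (m2 := Pr) (L2fun_mul Lg LX').
rewrite /ip2 -[RHS]/(\int[(leb \x Pr)%E]_p (cut t g p * cut t (fun _ => X) p)) e1.
have LD := drift_L2 t0 Lg.
apply: ae_Rintegral.
- by apply/measurable_EFinP; exact: (measurable_int Pr (L2fun_mul LD LX)).
- by apply/measurable_EFinP; exact: (measurable_int Pr i1).
apply: filterS (ae_section Lg) => w iw.
rewrite /drift -Rintegral_cut -RintegralZr//; apply: eq_Rintegral => s _.
rewrite /cut/= indicE; by case: (_ \in _); rewrite ?mul1r ?mul0r.
Qed.

(** Pathwise integration by parts, valid for almost every path by splitting the square along its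
    diagonal, followed by Fubini. *)
Lemma ip_drift_drift t f g : 0 <= t -> proc_L2 t f -> proc_L2 t g ->
  ip Pr (drift f t) (drift g t) = ip2 t f (drift g) + ip2 t (drift f) g.
Proof.
move=> t0 Lf Lg; have LDf := drift_proc_L2 t0 Lf; have LDg := drift_proc_L2 t0 Lg.
have [i1 e1] := Rfubini21 (m1 := leb) (m2 := Pr) (L2fun_mul Lf LDg).
have [i2 e2] := Rfubini21 (m1 := leb) (m2 := Pr) (L2fun_mul LDf Lg).
rewrite /ip2 -[X in _ = X + _]/(\int[(leb \x Pr)%E]_p (cut t f p * cut t (drift g) p)) e1.
rewrite -[X in _ = _ + X]/(\int[(leb \x Pr)%E]_p (cut t (drift f) p * cut t g p)) e2.
pose a w := \int[leb]_s (cut t f (s, w) * cut t (drift g) (s, w)).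
pose b w := \int[leb]_s (cut t (drift f) (s, w) * cut t g (s, w)).
have <- : \int[Pr]_w (a w + b w) = \int[Pr]_w a w + \int[Pr]_w b w by exact: RintegralD.
apply: ae_Rintegral.
- apply/measurable_EFinP.
  exact: (measurable_int Pr (L2fun_mul (drift_L2 t0 Lf) (drift_L2 t0 Lg))).
- apply: measurable_funD; apply/measurable_EFinP.
    exact: (measurable_int Pr i1).
  exact: (measurable_int Pr i2).
apply: filterS2 (ae_section Lf) (ae_section Lg) => w if_ ig_.
have tail h s : 0 <= s -> s <= t ->
    \int[leb]_(u in `]-oo, s]) cut t h (u, w) = drift h s w.
  move=> s0 st; rewrite /drift Rintegral_mkcond [RHS]Rintegral_mkcond.
  apply: eq_Rintegral => u _; rewrite !patchE !mem_setE !in_itv/=.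
  case: (leP u s) => [us|_]; last by rewrite andbF.
  rewrite andbT; case: ifPn => u0; first by rewrite cut_in// (le_trans us).
  by rewrite cut_out// negb_and u0.
have prod f' g' s : cut t f' (s, w) * \int[leb]_(u in `]-oo, s]) cut t g' (u, w) =
    cut t f' (s, w) * cut t (drift g') (s, w).
  have [/andP[s0 st]|st] := boolP (0 <= s <= t).
    by rewrite tail// [cut t (drift _) _]cut_in.
  by rewrite cut_out// !mul0r.
have -> : drift f t w * drift g t w =
    (\int[leb]_s cut t f (s, w)) * (\int[leb]_u cut t g (u, w)).
  by rewrite !Rintegral_cut.
have := integral_triangle if_ ig_; rewrite /= => ->; rewrite /a /b; congr (_ + _).
- by apply: eq_Rintegral => s _; exact: prod.
- by apply: eq_Rintegral => s _; rewrite prod mulrC.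
Qed.

End Drift.

(** * Second moments of a free state *)

Section Moments.
Context d (Omega : measurableType d) (R : realType) (Pr : probability Omega R).
Variables (F : R -> set (set Omega)) (hF : usual_filtration Pr F).
Variables (q : nat) (K : 'M[R]_q) (W : R -> Omega -> 'cV[R]_q).
Hypothesis hW : wiener Pr F K W.
Variables (n : nat) (A : 'M[R]_n) (N : 'I_q -> 'M[R]_n) (x0 : 'cV[R]_n).
Variable x : R -> Omega -> 'cV[R]_n.
Hypothesis hx : is_state Pr F W A N x0 (fun _ _ => 0) x.
Local Notation L2P := (L2fun Pr).
Local Notation leb := (@lebesgue_measure R).
Local Notation T2 := (measurableTypeR R * Omega)%type.
Local Notation ip2 := (ip2 Pr).
Local Notation proc_L2 := (proc_L2 Pr).

Let X (a : 'I_n) (s : R) (w : Omega) : R := x s w a 0.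
Let G (a : 'I_n) (s : R) (w : Omega) : R := (A *m x s w) a 0.
Let NX (i : 'I_q) (a : 'I_n) (s : R) (w : Omega) : R := (N i *m x s w) a 0.
(** The martingale part is defined from the state: the integrals [J] are supplied for each time
    separately and do not form a process. *)
Let M (a : 'I_n) (s : R) (w : Omega) : R := X a s w - x0 a 0 - drift (G a) s w.

Lemma proc_L2D t (f g : R -> Omega -> R) : proc_L2 t f -> proc_L2 t g ->
  proc_L2 t (fun s w => f s w + g s w).
Proof.
move=> Lf Lg; have := L2funD Lf Lg; congr L2fun.
by apply/funext => p; rewrite /cut mulrDr.
Qed.

Lemma proc_L2B t (f g : R -> Omega -> R) : proc_L2 t f -> proc_L2 t g ->
  proc_L2 t (fun s w => f s w - g s w).
Proof.
move=> Lf Lg; have := L2funB Lf Lg; congr L2fun.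
by apply/funext => p; rewrite /cut mulrBr.
Qed.

Lemma proc_L2_lin t k (c : 'I_k -> R) (f : 'I_k -> R -> Omega -> R) :
  (forall i, proc_L2 t (f i)) -> proc_L2 t (fun s w => \sum_i c i * f i s w).
Proof.
move=> Lf; have := L2fun_sum (index_enum 'I_k) (fun i => L2funZ (c i) (Lf i)).
congr L2fun; apply/funext => p; rewrite /cut mulr_sumr; apply: eq_bigr => i _.
by rewrite mulrCA.
Qed.

Lemma ip2C t f g : ip2 t f g = ip2 t g f.
Proof. exact: ipC. Qed.

Lemma ip2Dr t (f g h : R -> Omega -> R) : proc_L2 t f -> proc_L2 t g -> proc_L2 t h ->
  ip2 t f (fun s w => g s w + h s w) = ip2 t f g + ip2 t f h.
Proof.
move=> Lf Lg Lh; rewrite ![ip2 t f _]ip2C -[RHS](ipDl Lg Lh Lf).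
by apply: eq_Rintegral => p _; rewrite /cut mulrDr.
Qed.

Lemma ip2Zr t c (f g : R -> Omega -> R) : proc_L2 t f -> proc_L2 t g ->
  ip2 t f (fun s w => c * g s w) = c * ip2 t f g.
Proof.
move=> Lf Lg; rewrite ![ip2 t f _]ip2C -[RHS](ipZl c Lg Lf).
by apply: eq_Rintegral => p _; rewrite /cut; ring.
Qed.

Lemma state_wrt a t : 0 <= t -> measurable_wrt (F t) (X a t).
Proof. by move=> t0; exact: (state_adapted hx). Qed.

Lemma measurable_state t a : measurable_fun [set: T2] (cut t (X a)).
Proof.
pose D : set T2 := [set s : R | 0 <= s] `*` [set: Omega].
have mD : measurable D.
  apply: measurableX => //; have := @measurable_itv R `[0, +oo[.
  by congr measurable; apply/seteqP; split=> s; rewrite /= in_itv/= andbT.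
have mx := (measurable_restrictT _ mD).1 (state_measurable hx a).
have -> : cut t (X a) = (fun p => \1_(`[0, t]%classic) p.1 *
    ((fun p : T2 => x p.1 p.2 a 0) \_ D) p).
  apply/funext => -[s w]; rewrite /cut patchE /= indicE.
  case: (boolP (s \in `[0, t]%classic)) => [|_]; last by rewrite !mul0r.
  rewrite inE/= in_itv/= => /andP[s0 _]; rewrite mem_set//.
by apply: measurable_funM => //; exact: measurable_indic_fst.
Qed.

Lemma state_proc_L2 t a : 0 <= t -> proc_L2 t (X a).
Proof.
move=> t0; split; first exact: measurable_state.
pose Sq (p : T2) : \bar R := (\sum_b (cut t (X b) p) ^+ 2)%:E.
have mS : measurable_fun [set: T2] Sq.
  apply/measurable_EFinP; apply: measurable_sum => b.
  by apply: measurable_funX; exact: measurable_state.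
have S0 p : (0 <= Sq p)%E by rewrite lee_fin sumr_ge0// => b _; exact: sqr_ge0.
apply: (@le_lt_trans _ _ (\int[(leb \x Pr)%E]_p Sq p)%E).
  apply: ge0_le_integral => //.
  - by move=> p _; rewrite lee_fin sqr_ge0.
  - by apply/measurable_EFinP; apply: measurable_funX; exact: measurable_state.
  - move=> p _; rewrite lee_fin (bigD1 a)//= lerDl sumr_ge0// => b _.
    exact: sqr_ge0.
rewrite (fubini_tonelli2 (m1 := leb) (m2 := Pr) _ mS S0).
have := state_L2_loc hx t0; apply: le_lt_trans; rewrite le_eqVlt; apply/orP; left.
apply/eqP; apply: eq_integral => w _; rewrite /fubini_G [RHS]integral_mkcond.
apply: eq_integral => s _; rewrite patchE /Sq; case: ifPn => [|].
  rewrite inE/= in_itv/= => /andP[s0 st]; congr (_%:E).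
  by apply: eq_bigr => b _; rewrite cut_in.
rewrite mem_setE in_itv/= => st.
by rewrite big1// => b _; rewrite cut_out// expr0n.
Qed.

Lemma mul_state_proc_L2 (Y : 'M[R]_n) t a : 0 <= t ->
  proc_L2 t (fun s w => (Y *m x s w) a 0).
Proof.
move=> t0; have := proc_L2_lin (fun b => Y a b) (fun b => state_proc_L2 b t0).
by congr (proc_L2 _ _); apply/funext => s; apply/funext => w; rewrite mxE.
Qed.

Lemma L2fun_ae (Y Z : Omega -> R) : measurable_fun [set: Omega] Y -> L2P Z ->
  {ae Pr, forall w, Y w = Z w} -> L2P Y.
Proof.
move=> mY [mZ LZ] YZ; split=> //; apply: le_lt_trans LZ.
rewrite le_eqVlt; apply/orP; left; apply/eqP; apply: ae_eq_integral => //.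
- by apply/measurable_EFinP; exact: measurable_funX.
- by apply/measurable_EFinP; exact: measurable_funX.
- by apply: filterS YZ => w e _; rewrite e.
Qed.

Lemma ip_ae (Y Z V : Omega -> R) : L2P Y -> L2P Z -> L2P V ->
  {ae Pr, forall w, Y w = Z w} -> ip Pr Y V = ip Pr Z V.
Proof.
move=> LY LZ LV YZ; apply: ae_Rintegral.
- by apply: measurable_funM; [case: LY|case: LV].
- by apply: measurable_funM; [case: LZ|case: LV].
- by apply: filterS YZ => w e; rewrite e.
Qed.

Let GL t a : 0 <= t -> proc_L2 t (G a). Proof. exact: mul_state_proc_L2. Qed.
Let NL t i a : 0 <= t -> proc_L2 t (NX i a). Proof. exact: mul_state_proc_L2. Qed.
Let XL t a : 0 <= t -> proc_L2 t (X a). Proof. exact: state_proc_L2. Qed.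

Lemma cst_L2 (c : R) : L2P (fun _ => c).
Proof. by apply: sq_L2fun => //; exact: finite_measure_integrable_cst. Qed.

Let state_eq t : 0 <= t -> exists J : 'I_q -> Omega -> 'cV[R]_n,
  (forall i a, is_ito Pr F (fun s w => W s w i 0) t (NX i a) (fun w => J i w a 0)) /\
  forall a, {ae Pr, forall w, X a t w = x0 a 0 + drift (G a) t w + \sum_i J i w a 0}.
Proof.
move=> t0; have [J [hJ eqJ]] := state_integral hx t0; exists J; split=> // a.
apply: filterS eqJ => w /(_ a) e; rewrite /X e; congr (_ + _ + _).
by apply: eq_Rintegral => s _; rewrite addr0.
Qed.

(** [state_L2_loc] controls only integrals over time; square integrability at a fixed time is read
    off the right-hand side of the equation. *)
Lemma state_L2 t a : 0 <= t -> L2P (X a t).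
Proof.
move=> t0; have [J [hJ eqJ]] := state_eq t0.
apply: (L2fun_ae _ _ (eqJ a)).
  by apply: (adapted_measurable hF t0); exact: state_wrt.
apply: L2funD; last first.
  apply: L2fun_sum => i; apply: (is_ito_L2 hF hW (hJ i a)).
  by have [] := NL i a t0.
by apply: L2funD; [exact: cst_L2|exact: drift_L2 (GL a t0)].
Qed.

Let ML t a : 0 <= t -> L2P (M a t).
Proof.
move=> t0; apply: L2funB; last exact: drift_L2 (GL a t0).
by apply: L2funB; [exact: state_L2|exact: cst_L2].
Qed.

Let MPL t a : 0 <= t -> proc_L2 t (M a).
Proof.
move=> t0; apply: proc_L2B; last exact: drift_proc_L2 (GL a t0).
by apply: proc_L2B; [exact: XL|apply: proc_L2_cst; exact: cst_L2].
Qed.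

Let M_ito t : 0 <= t -> exists J : 'I_q -> Omega -> 'cV[R]_n,
  (forall i a, is_ito Pr F (fun s w => W s w i 0) t (NX i a) (fun w => J i w a 0)) /\
  forall a, {ae Pr, forall w, M a t w = \sum_i J i w a 0}.
Proof.
move=> t0; have [J [hJ eqJ]] := state_eq t0; exists J; split=> // a.
by apply: filterS (eqJ a) => w; rewrite /M => ->; ring.
Qed.

Let JL t (t0 : 0 <= t) (J : 'I_q -> Omega -> 'cV[R]_n) :
  (forall i a, is_ito Pr F (fun s w => W s w i 0) t (NX i a) (fun w => J i w a 0)) ->
  forall i a, L2P (fun w => J i w a 0).
Proof.
by move=> hJ i a; apply: (is_ito_L2 hF hW (hJ i a)); have [] := NL i a t0.
Qed.

Lemma martingale_part s t a (Z : Omega -> R) : 0 <= s -> s <= t ->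
  measurable_wrt (F s) Z -> L2P Z -> ip Pr (M a t) Z = ip Pr (M a s) Z.
Proof.
move=> s0 st mZ LZ; have t0 := le_trans s0 st.
have [J [hJ eJ]] := M_ito t0; have [J' [hJ' eJ']] := M_ito s0.
have LJ := JL t0 hJ; have LJ' := JL s0 hJ'.
rewrite (ip_ae (ML a t0) _ LZ (eJ a)); last by apply: L2fun_sum => i; exact: LJ.
rewrite (ip_ae (ML a s0) _ LZ (eJ' a)); last by apply: L2fun_sum => i; exact: LJ'.
rewrite !ip_suml//; apply: eq_bigr => i _.
apply: (ito_martingale hF hW s0 st (hJ i a) _ (hJ' i a) _ mZ LZ).
- by have [] := NL i a t0.
- by have [] := NL i a s0.
Qed.

Let ip2_0 f g : proc_L2 0 f -> proc_L2 0 g -> ip2 0 f g = 0.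
Proof.
by move=> Lf Lg; have [_ ->] := ip2_fubini Lf Lg; rewrite set_itv1 Rintegral_set1.
Qed.

(** The mean is constant in time. At time 0 the isometry gives the integrals norm 0, and
    Cauchy-Schwarz gives them mean 0. *)
Lemma martingale_part_mean t a : 0 <= t -> ip Pr (M a t) (fun _ => 1) = 0.
Proof.
move=> t0; have L1 := cst_L2 1.
rewrite (martingale_part a (lexx 0) t0)//; last first.
  by apply: measurable_wrt_cst; exact: (filt_sigma hF).
have [J [hJ eJ]] := M_ito (lexx 0); have LJ := JL (lexx 0) hJ.
rewrite (ip_ae (ML a (lexx 0)) _ L1 (eJ a)); last by apply: L2fun_sum => i; exact: LJ.
rewrite ip_suml// big1// => i _.
have JJ : ip Pr (fun w => J i w a 0) (fun w => J i w a 0) = 0.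
  have mN : mcut 0 (NX i a) by have [] := NL i a (lexx 0).
  rewrite (ito_isometry hF hW (hJ i a) mN (hJ i a) mN).
  by rewrite -[X in _ * X]/(ip2 0 (NX i a) (NX i a)) ip2_0 ?mulr0//; exact: NL.
have := ip_cauchy_schwarz (LJ i a) L1; rewrite JJ mul0r => h.
by apply/eqP; rewrite -sqrf_eq0 eq_le h sqr_ge0.
Qed.

Lemma martingale_part_isometry t a b : 0 <= t ->
  ip Pr (M a t) (M b t) = \sum_i \sum_j K i j * ip2 t (NX i a) (NX j b).
Proof.
move=> t0; have [J [hJ eJ]] := M_ito t0; have LJ := JL t0 hJ.
have LS c : L2P (fun w => \sum_i J i w c 0) by apply: L2fun_sum => i; exact: LJ.
rewrite (ip_ae (ML a t0) (LS a) (ML b t0) (eJ a)) ipC.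
rewrite (ip_ae (ML b t0) (LS b) (LS a) (eJ b)) ipC ip_suml//.
apply: eq_bigr => i _; rewrite ipC ip_suml//; apply: eq_bigr => j _; rewrite ipC.
apply: (ito_isometry hF hW (hJ i a) _ (hJ j b)).
- by have [] := NL i a t0.
- by have [] := NL j b t0.
Qed.

(** After Fubini, [G a s] is paired with [M b t]; being known at time [s], it sees only [M b s]. *)
Lemma drift_martingale t a b : 0 <= t ->
  ip Pr (drift (G a) t) (M b t) = ip2 t (G a) (M b).
Proof.
move=> t0; rewrite (ip_drift t0 (GL a t0) (ML b t0)).
have [_ ->] := ip2_fubini (GL a t0) (proc_L2_cst t (ML b t0)).
have [_ ->] := ip2_fubini (GL a t0) (MPL b t0).
apply: eq_Rintegral => s; rewrite inE/= in_itv/= => /andP[s0 st].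
have LG : L2P (G a s).
  have := L2fun_sum (index_enum 'I_n) (fun c => L2funZ (A a c) (state_L2 c s0)).
  by congr L2fun; apply/funext => w; rewrite /G mxE.
rewrite ipC [RHS]ipC; apply: martingale_part => //.
have -> : G a s = (fun w => \sum_c A a c * X c s w).
  by apply/funext => w; rewrite /G mxE.
apply: measurable_wrt_sum; first exact: (filt_sigma hF).
move=> c; apply: measurable_wrtM; first exact: (filt_sigma hF).
  by apply: measurable_wrt_cst; exact: (filt_sigma hF).
exact: state_wrt.
Qed.

(** Expand both coordinates as initial value, drift and martingale part. Drift-drift products are
    handled by integration by parts, mixed ones by the martingale property, and the
    martingale-martingale product by the isometry; the remaining terms reassemble into the two drift
    pairings. *)
Lemma second_moment t a b : 0 <= t ->
  ip Pr (X a t) (X b t) = x0 a 0 * x0 b 0 + ip2 t (G a) (X b) + ip2 t (X a) (G b)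
    + \sum_i \sum_j K i j * ip2 t (NX i a) (NX j b).
Proof.
move=> t0; have L1 := cst_L2 1.
have LD c := drift_L2 t0 (GL c t0); have LM c := ML c t0.
have LP1 := proc_L2_cst t L1.
have XE c : X c t = (fun w => x0 c 0 * 1 + (drift (G c) t w + M c t w)).
  by apply/funext => w; rewrite /M; ring.
have L1c c : L2P (fun w : Omega => x0 c 0 * 1) by exact: cst_L2.
have LDM c : L2P (fun w => drift (G c) t w + M c t w) by exact: L2funD.
have e11 : ip Pr (fun _ => 1) (fun _ => 1) = 1.
  rewrite /ip; under eq_Rintegral do rewrite mulr1.
  by rewrite Rintegral_cst//= probability_setT mul1r.
have eX Z c : L2P Z -> ip Pr Z (X c t) =
    x0 c 0 * ip Pr (fun _ => 1) Z + (ip Pr (drift (G c) t) Z + ip Pr (M c t) Z).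
  by move=> LZ; rewrite ipC XE ipDl// ipZl// ipDl.
have D1 c : ip Pr (fun _ => 1) (drift (G c) t) = ip2 t (G c) (fun _ _ => 1).
  by rewrite ipC (ip_drift t0 (GL c t0) L1).
have M1 c : ip Pr (fun _ => 1) (M c t) = 0 by rewrite ipC martingale_part_mean.
have LX c := state_L2 c t0.
have split c e : ip2 t (G c) (X e) = x0 e 0 * ip2 t (G c) (fun _ _ => 1)
    + ip2 t (G c) (drift (G e)) + ip2 t (G c) (M e).
  have -> : ip2 t (G c) (X e) =
      ip2 t (G c) (fun s w => (x0 e 0 * 1 + drift (G e) s w) + M e s w).
    congr (ip2 _ _ _); apply/funext => s; apply/funext => w; rewrite /M; ring.
  have Lc : proc_L2 t (fun _ _ => x0 e 0 * 1) by apply: proc_L2_cst; exact: L1c.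
  have LDr : proc_L2 t (drift (G e)) by exact: drift_proc_L2 (GL e t0).
  rewrite ip2Dr//; [|exact: GL|exact: proc_L2D|exact: MPL].
  rewrite ip2Dr//; last exact: GL.
  by rewrite (ip2Zr _ (GL c t0) LP1).
rewrite eX// [ip Pr (fun _ => 1) _]eX// [ip Pr (drift (G b) t) _]eX//.
rewrite [ip Pr (M b t) _]eX// e11 !D1 !M1.
rewrite [ip Pr (drift _ t) (fun _ => 1)]ipC D1 [ip Pr (M _ t) (fun _ => 1)]ipC M1.
rewrite (ip_drift_drift t0 (GL a t0) (GL b t0)) drift_martingale//.
rewrite [ip Pr (M a t) (drift _ _)]ipC drift_martingale//.
rewrite (martingale_part_isometry a b t0) (split a b) [ip2 t (X a) (G b)]ip2C (split b a).
have -> : ip2 t (drift (G a)) (G b) = ip2 t (G b) (drift (G a)) by exact: ip2C.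
move: (ip2 t (G a) (fun _ _ => 1)) (ip2 t (G b) (fun _ _ => 1)) (ip2 t (G a) (M b))
  (ip2 t (G b) (M a)) (ip2 t (G a) (drift (G b))) (ip2 t (G b) (drift (G a))) (\sum_i _).
by move=> u1 u2 u3 u4 u5 u6 u7; ring.
Qed.

Definition second_moments (t : R) : 'M[R]_n := \matrix_(a, b) ip Pr (X a t) (X b t).

Let ip_mul_state (Y Z : 'M[R]_n) t a b : 0 <= t ->
  ip Pr (fun w => (Y *m x t w) a 0) (fun w => (Z *m x t w) b 0) =
  (Y *m second_moments t *m Z^T) a b.
Proof.
move=> t0; have LX c := state_L2 c t0.
have e (V : 'M[R]_n) c : (fun w => (V *m x t w) c 0) = (fun w => \sum_k V c k * X k t w).
  by apply/funext => w; rewrite mxE.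
have LV (V : 'M[R]_n) c : L2P (fun w => \sum_k V c k * X k t w).
  by apply: L2fun_sum => k; exact: L2funZ.
rewrite !e ipC [RHS]mxE ip_suml//; last by move=> k; exact: L2funZ.
apply: eq_bigr => k _; rewrite ipZl// ipC ip_suml//; last by move=> l; exact: L2funZ.
rewrite mulrC [_^T _ _]mxE mxE; congr (_ * _); apply: eq_bigr => l _.
by rewrite ipZl// mxE.
Qed.

Lemma second_moments_generator t a b : 0 <= t ->
  generator K A N (second_moments t) a b =
  ip Pr (G a t) (X b t) + ip Pr (X a t) (G b t) +
  \sum_i \sum_j K i j * ip Pr (NX i a t) (NX j b t).
Proof.
move=> t0; have X1 c : X c t = (fun w => (1%:M *m x t w) c 0).
  by apply/funext => w; rewrite mul1mx.
rewrite /generator !addmxE summxE; congr (_ + _ + _).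
- by rewrite X1 ip_mul_state// trmx1 mulmx1.
- by rewrite X1 ip_mul_state// mul1mx.
- apply: eq_bigr => i _; rewrite summxE; apply: eq_bigr => j _.
  by rewrite scalemxE ip_mul_state.
Qed.

Lemma psd_second_moments t : 0 <= t -> psd (second_moments t).
Proof.
move=> t0; split; first by apply/matrixP => a b; rewrite !mxE ipC.
move=> v; have LX c := state_L2 c t0.
have -> : (v^T *m second_moments t *m v) 0 0 =
    ip Pr (fun w => \sum_a v a 0 * X a t w) (fun w => \sum_a v a 0 * X a t w).
  have LS : L2P (fun w => \sum_a v a 0 * X a t w).
    by apply: L2fun_sum => k; exact: L2funZ.
  rewrite ip_suml//; last by move=> k; exact: L2funZ.
  rewrite mxE; apply: eq_bigr => k _; rewrite ipZl// ipC ip_suml//; last first.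
    by move=> l; exact: L2funZ.
  rewrite mulrC mxE; congr (_ * _); apply: eq_bigr => l _.
  by rewrite ipZl// !mxE.
exact: ip_ge0.
Qed.

Lemma second_moments_flow : moment_flow K A N second_moments.
Proof.
split; first exact: psd_second_moments.
- move=> t t0 a b; have [+ _] := ip2_fubini (XL a t0) (XL b t0).
  by congr integrable; apply/funext => s; rewrite /= mxE.
- move=> t t0 a b.
  have -> : second_moments 0 a b = x0 a 0 * x0 b 0.
    rewrite mxE second_moment// !ip2_0 ?addr0//; try exact: XL; try exact: GL.
    rewrite big1 ?addr0// => i _; rewrite big1// => j _.
    by rewrite ip2_0 ?mulr0//; exact: NL.
  rewrite mxE second_moment// -!addrA; congr (_ + _); rewrite addrA.
  have [i1 e1] := ip2_fubini (GL a t0) (XL b t0).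
  have [i2 e2] := ip2_fubini (XL a t0) (GL b t0).
  have i3 i j := (ip2_fubini (NL i a t0) (NL j b t0)).1.
  have e3 i j := (ip2_fubini (NL i a t0) (NL j b t0)).2.
  have i3' i j : leb.-integrable `[0, t]
      (EFin \o (fun s => K i j * ip Pr (NX i a s) (NX j b s))).
    by apply: integrableZlR => //; exact: i3.
  have i3'' i : leb.-integrable `[0, t] (EFin \o
      (fun s => \sum_j K i j * ip Pr (NX i a s) (NX j b s))) by exact: integrable_sumR.
  transitivity (\int[leb]_(s in `[0, t]) ((ip Pr (G a s) (X b s) + ip Pr (X a s) (G b s)) +
    \sum_i \sum_j K i j * ip Pr (NX i a s) (NX j b s))); last first.
    apply: eq_Rintegral => s; rewrite inE/= in_itv/= => /andP[s0 _].
    by rewrite second_moments_generator.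
  rewrite RintegralD//; last 2 first.
  - by apply: integrableD i1 i2.
  - exact: integrable_sumR.
  rewrite RintegralD// -e1 -e2; congr (_ + _).
  rewrite Rintegral_sum//; apply: eq_bigr => i _.
  rewrite Rintegral_sum//; apply: eq_bigr => j _.
  by rewrite RintegralZl// -e3.
Qed.

Lemma second_moments_init : second_moments 0 = x0 *m x0^T.
Proof.
apply/matrixP => a b; rewrite [RHS]mxE big_ord1 [_^T _ _]mxE mxE second_moment//.
rewrite !ip2_0 ?addr0//; try exact: XL; try exact: GL.
rewrite big1 ?addr0// => i _; rewrite big1// => j _.
by rewrite ip2_0 ?mulr0//; exact: NL.
Qed.

Lemma expectation_sqnorm2 t : 0 <= t ->
  ('E_Pr[fun w => sqnorm2 (x t w)] = (\tr (second_moments t))%:E)%E.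
Proof.
move=> t0; have LX c := state_L2 c t0; rewrite unlock.
transitivity (\sum_a (\int[Pr]_w ((X a t w) ^+ 2)%:E))%E.
  rewrite -ge0_integral_sum//; last 2 first.
  - move=> a; apply/measurable_EFinP; apply: measurable_funX.
    exact: L2fun_measurable (LX a).
  - by move=> a w _; rewrite lee_fin sqr_ge0.
  by apply: eq_integral => w _; rewrite /sqnorm2 -sumEFin.
rewrite /mxtrace -sumEFin; apply: eq_bigr => a _.
by rewrite integral_sq// mxE.
Qed.

(** The trace is the expectation of the squared norm of [C x(t)]. *)
Lemma output_eq0 (c : nat) (C : 'M[R]_(c, n)) t : 0 <= t ->
  \tr ((C^T *m C) *m second_moments t) = 0 -> {ae Pr, forall w, C *m x t w = 0}.
Proof.
move=> t0; have LX k := state_L2 k t0.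
pose y (r : 'I_c) w : R := \sum_k C r k * X k t w.
have Ly r : L2P (y r) by apply: L2fun_sum => k; exact: L2funZ.
have -> : \tr ((C^T *m C) *m second_moments t) = \sum_r ip Pr (y r) (y r).
  rewrite -mulmxA mxtrace_mulC /mxtrace; apply: eq_bigr => r _.
  rewrite ip_suml//; last by move=> k; exact: L2funZ.
  rewrite mxE; apply: eq_bigr => k _.
  rewrite ipZl// ipC ip_suml//; last by move=> l; exact: L2funZ.
  rewrite [RHS]mulrC [X in _ * X = _]mxE; congr (_ * _).
  rewrite mxE; apply: eq_bigr => l _.
  by rewrite ipZl// !mxE.
move=> /eqP; rewrite psumr_eq0 => [/allP y0|r _]; last exact: ip_ge0.
have ae0 r : {ae Pr, forall w, y r w = 0}.
  have /eqP := y0 r (mem_index_enum _) => yr.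
  have h : (\int[Pr]_w `|((y r w) ^+ 2)%:E| = 0)%E.
    transitivity (\int[Pr]_w ((y r w) ^+ 2)%:E)%E.
      by apply: eq_integral => w _; rewrite gee0_abs// lee_fin sqr_ge0.
    by rewrite integral_sq// yr.
  have my : measurable_fun [set: Omega] (fun w => ((y r w) ^+ 2)%:E).
    by apply/measurable_EFinP; apply: measurable_funX; exact: L2fun_measurable (Ly r).
  have /(ae_eq_integral_abs _ measurableT my) := h.
  by apply: filterS => w /(_ I)/= [yw]; apply/eqP; rewrite -sqrf_eq0; apply/eqP.
have : {ae Pr, forall w, forall r, y r w = 0} by exact: filter_forall.
apply: filterS => w yw; apply/matrixP => r j; rewrite (ord1 j) [RHS]mxE -(yw r).
by rewrite mxE.
Qed.

End Moments.

(** * From moments to observability and stability *)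

Section Basis.
Context (R : realType) (d : measure_display) (Omega : measurableType d).
Variables (Pr : probability Omega R) (F : R -> set (set Omega)).
Hypothesis hF : usual_filtration Pr F.
Variables (q : nat) (K : 'M[R]_q) (W : R -> Omega -> 'cV[R]_q).
Hypothesis hW : wiener Pr F K W.

(** The form [v^T K v] is the second moment of [v^T W(1)]. *)
Lemma wiener_psd : psd K.
Proof.
split=> [|v]; first by apply/matrixP => i j; rewrite mxE; exact: (wiener_sym hW).
have L i := wiener_L2 hF hW i ler01.
pose f w : R := \sum_i v i 0 * W 1 w i 0.
have Lf : L2fun Pr f by apply: L2fun_sum => i; exact: L2funZ.
suff -> : (v^T *m K *m v) 0 0 = ip Pr f f by exact: ip_ge0.
rewrite ip_suml//; last by move=> i; exact: L2funZ.
rewrite -mulmxA mxE; apply: eq_bigr => i _; rewrite ipZl// mxE; congr (_ * _).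
rewrite ipC ip_suml//; last by move=> j; exact: L2funZ.
rewrite mxE; apply: eq_bigr => j _.
by rewrite ipZl// (wiener_cov hW)// mulr1 mulrC (wiener_sym hW).
Qed.

Lemma tr_outer n (x : 'cV[R]_n) : \tr (x *m x^T) = sqnorm2 x.
Proof.
by rewrite mxtrace_mulC /mxtrace big_ord1 mxE; apply: eq_bigr => i _; rewrite mxE.
Qed.

(** Every solution started at a point [U y] has zero output, because its second moments stay in the
    annihilator of [C^T C]; observability then forces [U y = 0] for all [y]. *)
Lemma stationary_observable_eq0 n p (A : 'M[R]_n) (N : 'I_q -> 'M[R]_n)
    (C : 'M[R]_(p, n)) (U : 'M[R]_n) :
  observable Pr F W A C N -> psd U -> C *m U = 0 -> generator K A N U = 0 -> U = 0.
Proof.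
move=> obs psdU CU gU; have range0 (y : 'cV[R]_n) : U *m y = 0.
  apply: obs => x hx t t0; apply: (output_eq0 hF hW hx t0).
  apply: (stationary_range_flow wiener_psd psdU gU CU _ erefl _ t0).
    exact: (second_moments_flow hF hW hx).
  exact: (second_moments_init hF hW hx).
by apply/matrixP => i j; have := congr1 (fun z : 'cV_n => z i 0) (range0 (delta_mx j 0));
  rewrite -colE !mxE.
Qed.

Lemma stable_lyapunov n (A : 'M[R]_n) (N : 'I_q -> 'M[R]_n) (D : 'M[R]_n) k1 k2 :
  0 < k1 -> (forall V, psd V -> k1 * \tr V <= \tr (D *m V)) ->
  (forall V, psd V -> \tr (D *m V) <= k2 * \tr V) ->
  (forall V, psd V -> \tr (D *m generator K A N V) <= 0) ->
  (forall V, psd V -> generator K A N V = 0 -> V = 0) ->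
  stable Pr F W A N.
Proof.
move=> k10 lo up lyap ker0; have [M [c [M1 c0 decay]]] := flow_decay k10 lo up lyap ker0.
exists M, c; split=> // x0 x hx t t0.
rewrite (expectation_sqnorm2 hF hW hx t0) lee_fin -tr_outer.
rewrite -(second_moments_init hF hW hx); apply: decay => //.
exact: (second_moments_flow hF hW hx).
Qed.

End Basis.

Lemma tr_diag_mul (R : realType) n (s : 'I_n -> R) (V : 'M[R]_n) :
  \tr (diag_mx (\row_i s i) *m V) = \sum_i s i * V i i.
Proof. by apply: eq_bigr => i _; rewrite mul_diag_mx !mxE. Qed.

Theorem theorem4p2 (R : realType) (d : measure_display)
    (Omega : measurableType d) (Pr : probability Omega R)
    (F : R -> set (set Omega)) (hF : usual_filtration Pr F)
    (q : nat) (K : 'M[R]_q) (W : R -> Omega -> 'cV[R]_q)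
    (hW : wiener Pr F K W)
    (n m p : nat) (A : 'M[R]_n) (N : 'I_q -> 'M[R]_n)
    (B : 'M[R]_(n, m)) (C : 'M[R]_(p, n))
    (hstab : stabilizable Pr F W A B N)
    (hobs : observable Pr F W A C N)
    (P : 'M[R]_n) (hP : posdef P) (hPlmi : lqg_filter_lmi K A B C N P)
    (Q : 'M[R]_n) (hQ : posdef Q) (hQric : lqg_control_riccati K A B C N Q)
    (hQstab : stable Pr F W (A - B *m B^T *m Q) N)
    (r : nat) (hr1 : (1 <= r)%N) (hrn : (r < n)%N)
    (sigma : 'I_n -> R) (hsigma : sqrt_spectrum (P *m Q) sigma)
    (hgap : forall i j : 'I_n, (i < r)%N -> (r <= j)%N -> sigma i <> sigma j)
    (S : 'M[R]_n) (hS : balancing P Q sigma S) :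
  let Ar := trunc_state (ltnW hrn) S A in
  let Nr := fun i => trunc_state (ltnW hrn) S (N i) in
  let Br := trunc_input (ltnW hrn) S B in
  let Sigmar := trunc_sigma (ltnW hrn) sigma in
  stable Pr F W (Ar - Br *m Br^T *m Sigmar) Nr.
Proof.
have [sigma_mono sigma_gt0 _] := hsigma; have psdK := wiener_psd hF hW.
have r0 : (r.-1 < n)%N by rewrite prednK// ltnW.
have n0 : (0 < n)%N by exact: leq_ltn_trans hrn.
move=> Ar Nr Br Sigmar.
(* The bounds for [tr (Sigma_r V)] are the extreme retained values. Indices start at 0, so these are
   the entries [r.-1] (smallest) and 0 (largest) of [sigma]. *)
apply: (@stable_lyapunov _ _ _ _ _ hF _ _ _ hW _ _ _ Sigmar
  (sigma (Ordinal r0)) (sigma (Ordinal n0))) => //.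
- move=> V psdV; rewrite tr_diag_mul mulr_sumr; apply: ler_sum => i _.
  apply: ler_wpM2r; first exact: psd_diag_ge0.
  by apply: sigma_mono => /=; rewrite -ltnS prednK.
- move=> V psdV; rewrite tr_diag_mul mulr_sumr; apply: ler_sum => i _.
  apply: ler_wpM2r; first exact: psd_diag_ge0.
  exact: sigma_mono.
- by move=> V psdV; exact: (truncated_lyapunov (ltnW hrn) psdK hQric sigma_gt0 hS).
- move=> V psdV gV; apply/eqP/negPn/negP => V0.
  have [U [psdU /eqP U0 CU gU]] :=
    truncated_kernel psdK hPlmi hQric sigma_gt0 hgap hS psdV V0 gV.
  by apply: U0; exact: (stationary_observable_eq0 hF hW hobs).
Qed.
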